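(* Let $X\subset\mathbb{R}^N$ be a closed semialgebraic set with $0\in X$, and let $F:X\to\mathbb{R}^m$ be a continuous semialgebraic mapping with $F(0)=0$. Put $r=r(X)+r(\operatorname{graph}F)$ and $d=\max\{\kappa(X),\kappa(\operatorname{graph}F)\}$. Then $$\mathcal{L}^{\mathbb{R}}_0(F|X)\le d(6d-3)^{N+r-1}.$$ If, additionally, $0$ is an isolated zero of $F$, then $$\mathcal{L}^{\mathbb{R}}_0(F|X)\le\frac{(2d-1)^{N+r}+1}{2}.$$
   Context: $|\cdot|$ is the Euclidean norm, $\operatorname{dist}$ the Euclidean distance to a set. It is assumed that $0$ is an accumulation point of $X$. Łojasiewicz exponent at $0$. For a continuous semialgebraic mapping $F:X\to\mathbb{R}^m$ with $F(0)=0$, $\mathcal{L}^{\mathbb{R}}_0(F|X)$ is the smallest exponent $\eta$ for which there exist $C,\varepsilon>0$ such that $$|F(x)|\ge C\operatorname{dist}(x,F^{-1}(0)\cap X)^{\eta}\quad\text{for } x\in X,\ |x|<\varepsilon.$$ If $0$ is not an accumulation point of $X\setminus F^{-1}(0)$, one puts $\mathcal{L}^{\mathbb{R}}_0(F|X)=0$. Complexity numbers. Every closed semialgebraic set $S\subset\mathbb{R}^M$ has a decomposition $S=S_1\cup\dots\cup S_k$ into closed basic semialgebraic sets $$S_i=\{x\in\mathbb{R}^M: g_{i,1}(x)\ge 0,\dots,g_{i,r_i}(x)\ge 0,\ h_{i,1}(x)=\dots=h_{i,l_i}(x)=0\},\quad i=1,\dots,k,$$ with $g_{i,j},h_{i,s}\in\mathbb{R}[x_1,\dots,x_M]$,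 where $r_i$ is taken to be the smallest possible number of inequalities in the definition of $S_i$. The number $r(S)$ is the minimum of $\max\{r_1,\dots,r_k\}$ over all such decompositions of $S$. The number $\kappa(S)$ is the minimum of the maximal degree of all the polynomials $g_{i,j},h_{i,s}$ over all such decompositions (descriptions) of $S$ that satisfy $r_i\le r(S)$ for all $i$. Here $\operatorname{graph}F$ is regarded as a closed semialgebraic subset of $\mathbb{R}^{N+m}$. *)

(* Defs.v *)
From HB Require Import structures.
From mathcomp Require Import all_boot all_order all_algebra.
From mathcomp Require Import all_classical all_reals all_analysis.
From mathcomp Require Import -(notations) mpoly.

Set Implicit Arguments.
Unset Strict Implicit.
Unset Printing Implicit Defensive.

Import Order.TTheory GRing.Theory Num.Theory.
Import numFieldNormedType.Exports.

Local Open Scope classical_set_scope.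
Local Open Scope ring_scope.

(* The smallest element of A, or the default value x0 when A has none. *)
Definition smallest {d} {T : porderType d} (x0 : T) (A : set T) : T :=
  xget x0 (A `&` lbound A).

(* The library norm on 'rV[R]_n is the maximum norm; it induces the same
   topology as the Euclidean one. *)
Definition enorm (R : realType) n (x : 'rV[R]_n) : R :=
  Num.sqrt (\sum_(i < n) x 0 i ^+ 2).

Definition edist (R : realType) n (x : 'rV[R]_n) (A : set 'rV[R]_n) : R :=
  inf [set enorm (x - y) | y in A].

Definition peval (R : realType) n (p : mpoly n R) (x : 'rV[R]_n) : R :=
  meval (fun i => x 0 i) p.

(* Total degree; constant polynomials, 0 included, get degree 0. *)
Definition pdeg (R : realType) n (p : mpoly n R) : nat :=
  (mmeasure mdeg p).-1.

(* Polynomials g for inequalities (>= 0 in closed basic sets, > 0 in general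
   semialgebraic sets) and polynomials h for equations h = 0. *)
Definition description (R : realType) n : Type :=
  (seq (mpoly n R) * seq (mpoly n R))%type.

Definition semialgebraic (R : realType) n (S : set 'rV[R]_n) : Prop :=
  exists bs : seq (description R n),
    S = [set x | exists2 b, b \in bs &
           (forall g, g \in b.1 -> 0 < peval g x) /\
           (forall h, h \in b.2 -> peval h x = 0)].

Definition basic_set (R : realType) n (b : description R n) : set 'rV[R]_n :=
  [set x | (forall g, g \in b.1 -> 0 <= peval g x) /\
           (forall h, h \in b.2 -> peval h x = 0)].

Definition minimal_description (R : realType) n (b : description R n) : Prop :=
  forall b' : description R n,
    basic_set b' = basic_set b -> (size b.1 <= size b'.1)%N.

Definition decomposition (R : realType) n (S : set 'rV[R]_n)
    (bs : seq (description R n)) : Prop :=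
  S = [set x | exists2 b, b \in bs & basic_set b x] /\
  (forall b, b \in bs -> minimal_description b).

(* Every closed semialgebraic set has a decomposition, so the default value 0
   in rnum and kappa is not reached on such sets. *)
Definition rnum (R : realType) n (S : set 'rV[R]_n) : nat :=
  smallest 0%N [set k | exists2 bs, decomposition S bs &
                          k = (\max_(b <- bs) size b.1)%N].

Definition kappa (R : realType) n (S : set 'rV[R]_n) : nat :=
  smallest 0%N
    [set k | exists bs, [/\ decomposition S bs,
       forall b, b \in bs -> (size b.1 <= rnum S)%N &
       k = (\max_(b <- bs) \max_(p <- b.1 ++ b.2) pdeg p)%N]].

(* A mapping X -> R^m is represented by a total function, of which only the
   values on X matter. *)
Definition graph_on (R : realType) N m (X : set 'rV[R]_N)
    (F : 'rV[R]_N -> 'rV[R]_m) : set 'rV[R]_(N + m) :=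
  [set row_mx x (F x) | x in X].

Definition zeros (R : realType) N m (X : set 'rV[R]_N)
    (F : 'rV[R]_N -> 'rV[R]_m) : set 'rV[R]_N :=
  X `&` F @^-1` [set 0].

Definition lojasiewicz_inequality (R : realType) N m (X : set 'rV[R]_N)
    (F : 'rV[R]_N -> 'rV[R]_m) (eta : R) : Prop :=
  exists C eps : R, [/\ 0 < C, 0 < eps &
    forall x, X x -> enorm x < eps ->
      C * edist x (zeros X F) `^ eta <= enorm (F x)].

(* The default value +oo ensures that an upper bound on the exponent can only
   hold when a smallest exponent exists. *)
Definition lojasiewicz_exponent (R : realType) N m (X : set 'rV[R]_N)
    (F : 'rV[R]_N -> 'rV[R]_m) : \bar R :=
  if `[< limit_point (X `\` zeros X F) 0 >]
  then smallest +oo%E [set eta%:E | eta in lojasiewicz_inequality X F]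
  else 0%E.

(* Main.v *)
Require Import Defs.
From HB Require Import structures.
From mathcomp Require Import all_boot all_order all_algebra.
From mathcomp Require Import all_classical all_reals all_analysis.
From mathcomp Require Import -(notations) mpoly.
From mathcomp Require Import polyXY ring lra zify.
From mathcomp Require ordered_qelim qe_rcf.

Set Implicit Arguments.
Unset Strict Implicit.
Unset Printing Implicit Defensive.

Import Order.TTheory GRing.Theory Num.Theory.
Import numFieldNormedType.Exports.

Local Open Scope classical_set_scope.
Local Open Scope ring_scope.

(** A description of the graph of [F] bounds [|F x| ^ 2] from below by the value at [(x, y)]
    of a nonnegative polynomial [f] of degree [D = 2 d] on a box, where each inequality
    [g >= 0] contributes the square of [g - y_j] with a slack variable [y_j >= 0]. On a box,
    Ekeland's principle turns a gradient inequality [|grad f| ^ 2 >= c q ^ (2 (L - 1))], where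
    [q ^ L = f], valid on every face into [f >= C dist ^ L]. The gradient inequality is read
    off the definable curve of maximisers of [a f - |grad f| ^ 2 - a ^ 4 v] for a suitable
    polynomial [v]: the first-order conditions are polynomial equations in [a] and [x], and
    eliminating all coordinates but one bounds the speed at which the curve converges as [a]
    tends to [0]. At an isolated zero the same elimination is applied to the minimisers of [f]
    perturbed by a polynomial of degree [D].

    A closed semialgebraic set is a finite union of closed basic sets because the product of
    the strict inequalities of a piece of its complement is controlled by the equations of
    that piece. The infimum of the admissible exponents is attained because the minimum of
    [|F| ^ 2] on [dist >= t] is a root of one of finitely many polynomials, whose Newton
    polygons have finitely many slopes. *)

(** * Polynomial functions and semialgebraic predicates *)

(** The polynomial [f] is compared with the square of the norm of [F], so an exponent for [f] is
    halved for [F]: the two bounds are half of [D (3 D - 3) ^ (n - 1)] and of [(D - 1) ^ n + 1] with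
    [n = N + r]. A slack variable costs one dimension and no degree. Eliminating from [n] equations
    with pure leading powers of degree [m] leaves a polynomial of degree [m ^ n]. Derivatives of
    [|grad f| ^ 2] have degree [2 D - 3], whence the exponent [(2 D - 3) ^ n + 2]; it lies below the
    target for [n >= 3], but above it in the plane for large [D]. Hence the plane is treated through
    the Jacobian of [f] and [|grad f| ^ 2], of degree below [3 D - 3], and the line by factoring.
    The perturbation by [v] supplies the pure powers that make elimination nondegenerate without any
    genericity assumption; the factor [a ^ 4] makes it negligible beside [a f] on the scale
    [a = k q ^ (L - 2)] on which it is used. The box provides compactness at the price of faces:
    extrema may lie on the boundary, where the fixed coordinates contribute equations of their
    own. *)

Definition pfun (R : realType) (D : nat) n (phi : 'rV[R]_n -> R) : Prop :=
  exists2 p : mpoly n R, (mmeasure mdeg p <= D.+1)%N & forall x, phi x = peval p x.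

Definition polyfun (R : realType) n (phi : 'rV[R]_n -> R) : Prop :=
  exists D, pfun D phi.

Section PolynomialFunctions.
Context {R : realType} {n : nat}.
Implicit Types (phi psi : 'rV[R]_n -> R) (D : nat).

Lemma pfun_ext D phi psi : phi =1 psi -> pfun D phi -> pfun D psi.
Proof. by move=> e [p sp pE]; exists p => // x; rewrite -e pE. Qed.

Lemma pfun_le D D' phi : (D <= D')%N -> pfun D phi -> pfun D' phi.
Proof. by move=> DD' [p sp pE]; exists p => //; exact: leq_trans sp _. Qed.

Lemma pfun_peval (p : mpoly n R) : pfun (pdeg p) (peval p).
Proof. by exists p => //; exact: leqSpred. Qed.

Lemma pfun_const D (c : R) : pfun D (fun _ : 'rV[R]_n => c).
Proof.
exists (mpolyC n c); last by move=> x; rewrite /peval mevalC.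
by rewrite mmeasureC; case: (c != 0).
Qed.

Lemma pfun_coord (i : 'I_n) : pfun 1 (fun x : 'rV[R]_n => x 0 i).
Proof.
exists (mpolyX R (mnm1 i)); last by move=> x; rewrite /peval mevalXU.
by rewrite msizeX mdeg1.
Qed.

Lemma pfunD D phi psi : pfun D phi -> pfun D psi -> pfun D (fun x => phi x + psi x).
Proof.
move=> [p sp pE] [q sq qE]; exists (p + q).
  by rewrite (leq_trans (mmeasureD_le _ _ _)) // geq_max sp.
by move=> x; rewrite /peval mevalD pE qE.
Qed.

Lemma pfunM D D' phi psi :
  pfun D phi -> pfun D' psi -> pfun (D + D') (fun x => phi x * psi x).
Proof.
move=> [p sp pE] [q sq qE]; exists (p * q).
  have [->|p0] := eqVneq p 0; first by rewrite mul0r mmeasure0.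
  have [->|q0] := eqVneq q 0; first by rewrite mulr0 mmeasure0.
  rewrite msizeM //; move: sp sq; rewrite (mpolySpred mdeg p0) (mpolySpred mdeg q0).
  by lia.
by move=> x; rewrite /peval mevalM pE qE.
Qed.

Lemma pfunN D phi : pfun D phi -> pfun D (fun x => - phi x).
Proof.
move=> [p sp pE]; exists (- p); first by rewrite mmeasureN.
by move=> x; rewrite /peval mevalN pE.
Qed.

Lemma pfunB D phi psi : pfun D phi -> pfun D psi -> pfun D (fun x => phi x - psi x).
Proof. by move=> hp /pfunN; exact: pfunD. Qed.

Lemma pfun_sum D (I : Type) (r : seq I) (F : I -> 'rV[R]_n -> R) :
  (forall i, pfun D (F i)) -> pfun D (fun x => \sum_(i <- r) F i x).
Proof.
move=> h; elim: r => [|i r IH].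
  by apply: pfun_ext (pfun_const D 0) => x; rewrite big_nil.
by apply: pfun_ext (pfunD (h i) IH) => x; rewrite big_cons.
Qed.

Lemma pfun_sumin D (I : eqType) (r : seq I) (F : I -> 'rV[R]_n -> R) :
  (forall i, i \in r -> pfun D (F i)) -> pfun D (fun x => \sum_(i <- r) F i x).
Proof.
elim: r => [|i r IH] h.
  by apply: pfun_ext (pfun_const D 0) => x; rewrite big_nil.
have h1 := h i (mem_head _ _).
have h2 : pfun D (fun x => \sum_(i <- r) F i x).
  by apply: IH => j jr; apply: h; rewrite inE jr orbT.
by apply: pfun_ext (pfunD h1 h2) => x; rewrite big_cons.
Qed.

Lemma pfunX D phi k : pfun D phi -> pfun (k * D) (fun x => phi x ^+ k).
Proof.
move=> h; elim: k => [|k IH]; first by apply: pfun_ext (pfun_const _ 1) => x; rewrite expr0.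
by apply: pfun_ext (pfunM h IH) => x; rewrite exprS.
Qed.

Lemma polyfun_ext phi psi : phi =1 psi -> polyfun phi -> polyfun psi.
Proof. by move=> e [D h]; exists D; exact: pfun_ext h. Qed.

Lemma polyfun_peval (p : mpoly n R) : polyfun (peval p).
Proof. by exists (pdeg p); exact: pfun_peval. Qed.

Lemma polyfun_const (c : R) : polyfun (fun _ : 'rV[R]_n => c).
Proof. by exists 0%N; exact: pfun_const. Qed.

Lemma polyfun_coord (i : 'I_n) : polyfun (fun x : 'rV[R]_n => x 0 i).
Proof. by exists 1%N; exact: pfun_coord. Qed.

Lemma polyfunD phi psi : polyfun phi -> polyfun psi -> polyfun (fun x => phi x + psi x).
Proof.
move=> [D h] [D' h']; exists (maxn D D'); apply: pfunD.
  by apply: pfun_le h; exact: leq_maxl.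
by apply: pfun_le h'; exact: leq_maxr.
Qed.

Lemma polyfunM phi psi : polyfun phi -> polyfun psi -> polyfun (fun x => phi x * psi x).
Proof. by move=> [D h] [D' h']; exists (D + D')%N; exact: pfunM. Qed.

Lemma polyfunN phi : polyfun phi -> polyfun (fun x => - phi x).
Proof. by move=> [D h]; exists D; exact: pfunN. Qed.

Lemma polyfunB phi psi : polyfun phi -> polyfun psi -> polyfun (fun x => phi x - psi x).
Proof. by move=> h /polyfunN; exact: polyfunD. Qed.

Lemma polyfunX phi k : polyfun phi -> polyfun (fun x => phi x ^+ k).
Proof. by move=> [D h]; exists (k * D)%N; exact: pfunX. Qed.

Lemma polyfun_sum (I : Type) (r : seq I) (F : I -> 'rV[R]_n -> R) :
  (forall i, polyfun (F i)) -> polyfun (fun x => \sum_(i <- r) F i x).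
Proof.
move=> h; elim: r => [|i r IH].
  by apply: polyfun_ext (polyfun_const 0) => x; rewrite big_nil.
by apply: polyfun_ext (polyfunD (h i) IH) => x; rewrite big_cons.
Qed.

Lemma polyfun_prod (I : Type) (r : seq I) (F : I -> 'rV[R]_n -> R) :
  (forall i, polyfun (F i)) -> polyfun (fun x => \prod_(i <- r) F i x).
Proof.
move=> h; elim: r => [|i r IH].
  by apply: polyfun_ext (polyfun_const 1) => x; rewrite big_nil.
by apply: polyfun_ext (polyfunM (h i) IH) => x; rewrite big_cons.
Qed.

End PolynomialFunctions.

Lemma peval_sum (R : realType) n (p : mpoly n R) (x : 'rV[R]_n) :
  peval p x = \sum_(mu <- msupp p) mcoeff mu p * \prod_i x 0 i ^+ mu i.
Proof. by rewrite /peval mevalE. Qed.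

Lemma pfun_comp (R : realType) n k D (phi : 'rV[R]_n -> R) (f : 'rV[R]_k -> 'rV[R]_n) :
  (forall i, pfun 1 (fun x => f x 0 i)) -> pfun D phi -> pfun D (phi \o f).
Proof.
move=> hf [p sp pE].
apply: (@pfun_ext _ _ _
  (fun x => \sum_(mu <- msupp p) mcoeff mu p * \prod_i f x 0 i ^+ mu i)).
  by move=> x; rewrite /= pE peval_sum.
apply: pfun_sumin => mu mup; rewrite -(add0n D); apply: pfunM; first exact: pfun_const.
have hmu : (mdeg mu <= D)%N by have := msize_mdeg_lt mup; lia.
apply: (pfun_le hmu); rewrite mdegE.
elim: (index_enum _) => [|i r IH].
  by rewrite big_nil; apply: pfun_ext (pfun_const _ 1) => x; rewrite big_nil.
rewrite big_cons; apply: (@pfun_ext _ _ _ (fun x => f x 0 i ^+ mu i *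
    \prod_(j <- r) f x 0 j ^+ mu j)); first by move=> x; rewrite big_cons.
by apply: pfunM => //; have := pfunX (mu i) (hf i); rewrite muln1.
Qed.

Lemma polyfun_comp (R : realType) n k (phi : 'rV[R]_n -> R) (f : 'rV[R]_k -> 'rV[R]_n) :
  (forall i, polyfun (fun x => f x 0 i)) -> polyfun phi -> polyfun (phi \o f).
Proof.
move=> hf [D [p sp pE]].
apply: (@polyfun_ext _ _
  (fun x => \sum_(mu <- msupp p) mcoeff mu p * \prod_i f x 0 i ^+ mu i)).
  by move=> x; rewrite /= pE peval_sum.
apply: polyfun_sum => mu; apply: polyfunM; first exact: polyfun_const.
by apply: polyfun_prod => i; exact: polyfunX.
Qed.

(** Conditions rather than sets, so that semialgebraicity is proved by recursion on the shape of a
    first-order formula. *)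
Definition sa (R : realType) n (P : 'rV[R]_n -> Prop) : Prop :=
  semialgebraic [set x | P x].

Definition sign_set (R : realType) n (b : description R n) (x : 'rV[R]_n) : Prop :=
  (forall g, g \in b.1 -> 0 < peval g x) /\ (forall h, h \in b.2 -> peval h x = 0).

Section SemialgebraicPredicates.
Context {R : realType} {n : nat}.
Implicit Types (P Q : 'rV[R]_n -> Prop) (phi psi : 'rV[R]_n -> R).

Lemma saP P : sa P <->
  exists bs : seq (description R n), forall x, P x <-> exists2 b, b \in bs & sign_set b x.
Proof.
split=> [[bs hbs]|[bs hbs]]; exists bs.
  by move=> x; have := congr1 (fun A => A x) hbs; rewrite /mkset /= => ->.
by apply/seteqP; split=> x /hbs.
Qed.

Lemma sa_ext P Q : (forall x, P x <-> Q x) -> sa P -> sa Q.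
Proof.
by move=> e /saP[bs h]; apply/saP; exists bs => x; rewrite -e.
Qed.

Lemma sa_false : sa (fun _ : 'rV[R]_n => False).
Proof. by apply/saP; exists [::] => x; split=> [//|[]]. Qed.

Lemma sa_true : sa (fun _ : 'rV[R]_n => True).
Proof.
by apply/saP; exists [:: ([::], [::])] => x; split=> // _; exists ([::], [::]); rewrite ?mem_head.
Qed.

Lemma sa_or P Q : sa P -> sa Q -> sa (fun x => P x \/ Q x).
Proof.
move=> /saP[bs h] /saP[bs' h']; apply/saP; exists (bs ++ bs') => x; split.
  by case=> [/h|/h'] [b bb sb]; exists b; rewrite // mem_cat bb ?orbT.
by move=> [b]; rewrite mem_cat => /orP[] bb sb; [left; apply/h|right; apply/h']; exists b.
Qed.

Lemma sa_and P Q : sa P -> sa Q -> sa (fun x => P x /\ Q x).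
Proof.
move=> /saP[bs h] /saP[bs' h']; apply/saP.
exists [seq (b.1 ++ c.1, b.2 ++ c.2) | b <- bs, c <- bs'] => x; split.
  move=> [/h[b bb [sb1 sb2]] /h'[c cc [sc1 sc2]]].
  exists (b.1 ++ c.1, b.2 ++ c.2); first by apply/allpairsP; exists (b, c).
  by split=> g /=; rewrite mem_cat => /orP[]; auto.
move=> [_ /allpairsP[[b c] /= [bb cc ->]] [s1 s2]]; split.
  apply/h; exists b => //; split=> g gb; [apply: s1|apply: s2];
    by rewrite mem_cat gb.
apply/h'; exists c => //; split=> g gb; [apply: s1|apply: s2];
  by rewrite mem_cat gb orbT.
Qed.

Lemma sa_gt0 phi : polyfun phi -> sa (fun x => 0 < phi x).
Proof.
move=> [D [p _ pE]]; apply/saP; exists [:: ([:: p], [::])] => x; rewrite pE; split.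
  move=> h; exists ([:: p], [::]); first exact: mem_head.
  by split=> // g; rewrite inE => /eqP ->.
by move=> [b]; rewrite inE => /eqP -> [h _]; apply: h; exact: mem_head.
Qed.

Lemma sa_eq0 phi : polyfun phi -> sa (fun x => phi x = 0).
Proof.
move=> [D [p _ pE]]; apply/saP; exists [:: ([::], [:: p])] => x; rewrite pE; split.
  move=> h; exists ([::], [:: p]); first exact: mem_head.
  by split=> // g; rewrite inE => /eqP ->.
by move=> [b]; rewrite inE => /eqP -> [_ h]; apply: h; exact: mem_head.
Qed.

Lemma sa_bigor (T : eqType) (r : seq T) (F : T -> 'rV[R]_n -> Prop) :
  (forall t, sa (F t)) -> sa (fun x => exists2 t, t \in r & F t x).
Proof.
move=> h; elim: r => [|t r IH].
  by apply: sa_ext sa_false => x; split=> [//|[]].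
apply: sa_ext (sa_or (h t) IH) => x; split.
  by case=> [ft|[s sr fs]]; [exists t|exists s]; rewrite // inE ?eqxx ?sr ?orbT.
by move=> [s]; rewrite inE => /orP[/eqP ->|sr fs]; [left|right; exists s].
Qed.

Lemma sa_bigand (T : eqType) (r : seq T) (F : T -> 'rV[R]_n -> Prop) :
  (forall t, sa (F t)) -> sa (fun x => forall t, t \in r -> F t x).
Proof.
move=> h; elim: r => [|t r IH].
  by apply: sa_ext sa_true => x; split.
apply: sa_ext (sa_and (h t) IH) => x; split.
  by move=> [ft fr] s; rewrite inE => /orP[/eqP ->|]; auto.
by move=> f; split=> [|s sr]; apply: f; rewrite inE ?eqxx ?sr ?orbT.
Qed.

Lemma sa_lt phi psi : polyfun phi -> polyfun psi -> sa (fun x => phi x < psi x).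
Proof.
move=> h h'; apply: sa_ext (sa_gt0 (polyfunB h' h)) => x.
by rewrite subr_gt0.
Qed.

Lemma sa_eq phi psi : polyfun phi -> polyfun psi -> sa (fun x => phi x = psi x).
Proof.
move=> h h'; apply: sa_ext (sa_eq0 (polyfunB h h')) => x.
by split=> [/eqP|->]; rewrite ?subrr // subr_eq0 => /eqP.
Qed.

Lemma sa_le phi psi : polyfun phi -> polyfun psi -> sa (fun x => phi x <= psi x).
Proof.
move=> h h'; apply: sa_ext (sa_or (sa_lt h h') (sa_eq h h')) => x.
rewrite le_eqVlt; split; first by case=> [->|->]; rewrite ?orbT ?eqxx.
by case/orP=> [/eqP|]; [right|left].
Qed.

Lemma sa_not P : sa P -> sa (fun x => ~ P x).
Proof.
move=> /saP[bs h].
apply: (@sa_ext (fun x => forall b, b \in bs -> ~ sign_set b x)).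
  by move=> x; rewrite h; split=> [hb [b /hb]//|hb b bb sb]; apply: hb; exists b.
apply: sa_bigand => b.
apply: (@sa_ext (fun x => (exists2 g, g \in b.1 & peval g x <= 0) \/
    (exists2 h, h \in b.2 & (0 < peval h x \/ peval h x < 0)))).
  move=> x; split.
    case=> [[g gb gx] [/(_ _ gb)]|[k kb kx] [_ /(_ _ kb)]]; first by rewrite ltNge gx.
    by move=> e; case: kx; rewrite e ltxx.
  move=> nb; apply: contrapT => no; apply: nb; split=> [g gb|k kb].
    by rewrite ltNge; apply/negP => gx; apply: no; left; exists g.
  apply/eqP; apply: contrapT => /negP /lt_total kx; apply: no; right; exists k => //.
  by case/orP: kx; [right|left].
apply: sa_or.
  apply: sa_bigor => g; apply: sa_le; [exact: polyfun_peval|exact: polyfun_const].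
apply: sa_bigor => k; apply: sa_or; apply: sa_lt;
  by [exact: polyfun_peval|exact: polyfun_const].
Qed.

Lemma sa_imp P Q : sa P -> sa Q -> sa (fun x => P x -> Q x).
Proof.
move=> h h'; apply: sa_ext (sa_or (sa_not h) h') => x; split; first by case.
by move=> f; case: (pselect (P x)) => [/f|]; [right|left].
Qed.

Lemma sa_allI (T : finType) (F : T -> 'rV[R]_n -> Prop) :
  (forall t, sa (F t)) -> sa (fun x => forall t, F t x).
Proof.
move=> h; apply: sa_ext (sa_bigand (enum T) h) => x; split=> f t //.
by apply: f; rewrite mem_enum.
Qed.

Lemma sa_const (P : Prop) : sa (fun _ : 'rV[R]_n => P).
Proof.
by case: (pselect P) => p; [apply: sa_ext sa_true|apply: sa_ext sa_false] => x; split.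
Qed.

End SemialgebraicPredicates.

Lemma sa_comp (R : realType) n k (P : 'rV[R]_n -> Prop) (f : 'rV[R]_k -> 'rV[R]_n) :
  (forall i, polyfun (fun x => f x 0 i)) -> sa P -> sa (fun x => P (f x)).
Proof.
move=> hf /saP[bs h].
apply: (@sa_ext _ _ (fun x => exists2 b, b \in bs & (forall g, g \in b.1 -> 0 < peval g (f x)) /\
   (forall h, h \in b.2 -> peval h (f x) = 0))); first by move=> x; rewrite h.
apply: sa_bigor => b; apply: sa_and; apply: sa_bigand => g.
  by apply: sa_gt0; exact: (polyfun_comp hf (polyfun_peval g)).
by apply: sa_eq0; exact: (polyfun_comp hf (polyfun_peval g)).
Qed.

(** * Projections of semialgebraic sets *)

Definition upd (R : realType) n (x : 'rV[R]_n) (i : 'I_n) (y : R) : 'rV[R]_n :=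
  \row_j (if j == i then y else x 0 j).

Section TarskiSeidenberg.
Context {R : realType} {n : nat}.
Implicit Types (x : 'rV[R]_n).

(** A point read as an environment for first-order formulas over ordered rings; indices from [n] on
    take the default value [0]. *)
Definition env x : seq R := [seq x 0 j | j <- enum 'I_n].

Lemma env_nth x (j : 'I_n) : (env x)`_j = x 0 j.
Proof. by rewrite (nth_map j) ?nth_ord_enum // size_enum_ord. Qed.

Lemma env_default x k : (n <= k)%N -> (env x)`_k = 0.
Proof. by move=> nk; rewrite nth_default // size_map size_enum_ord. Qed.

Lemma set_nth_env x (i : 'I_n) y : set_nth 0 (env x) i y = env (upd x i y).
Proof.
have sE z : size (env z) = n by rewrite size_map size_enum_ord.
apply: (@eq_from_nth _ 0); first by rewrite size_set_nth !sE; apply/maxn_idPr.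
move=> k; rewrite size_set_nth sE (maxn_idPr (ltn_ord i)) => kn.
rewrite nth_set_nth /= (env_nth (upd x i y) (Ordinal kn)) mxE -val_eqE /=.
by case: eqP => // _; rewrite (env_nth x (Ordinal kn)).
Qed.

Lemma polyfun_term (t : GRing.term R) :
  GRing.rterm t -> polyfun (fun x => GRing.eval (env x) t).
Proof.
elim: t => //=.
- move=> k _; have [kn|nk] := ltnP k n.
    by apply: polyfun_ext (polyfun_coord (Ordinal kn)) => x; rewrite -env_nth.
  by apply: polyfun_ext (polyfun_const 0) => x; rewrite env_default.
- by move=> c _; exact: polyfun_const.
- by move=> k _; exact: polyfun_const.
- by move=> s IHs t IHt /andP[/IHs ? /IHt ?]; exact: polyfunD.
- by move=> s IHs /IHs; exact: polyfunN.
- move=> s IHs k /IHs h; apply: polyfun_ext (polyfunM h (polyfun_const k%:R)) => x.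
  by rewrite mulr_natr.
- by move=> s IHs t IHt /andP[/IHs ? /IHt ?]; exact: polyfunM.
- by move=> s IHs k /IHs h; exact: polyfunX.
Qed.

Lemma sa_qf_eval (f : ordered_qelim.ord.formula R) :
  ordered_qelim.ord.qf_form f -> ordered_qelim.ord.rformula f ->
  sa (fun x => ordered_qelim.ord.qf_eval (env x) f).
Proof.
elim: f => //=.
- by move=> b _ _; exact: sa_const.
- move=> s t _ /andP[/polyfun_term hs /polyfun_term ht].
  by apply: sa_ext (sa_eq hs ht) => x; split=> /eqP.
- by move=> s t _ /andP[/polyfun_term hs /polyfun_term ht]; exact: sa_lt.
- by move=> s t _ /andP[/polyfun_term hs /polyfun_term ht]; exact: sa_le.
- move=> f IHf g IHg /andP[/IHf hf /IHg hg] /andP[/hf {}hf /hg {}hg].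
  by apply: sa_ext (sa_and hf hg) => x; split=> /andP.
- move=> f IHf g IHg /andP[/IHf hf /IHg hg] /andP[/hf {}hf /hg {}hg].
  by apply: sa_ext (sa_or hf hg) => x; split=> /orP.
- move=> f IHf g IHg /andP[/IHf hf /IHg hg] /andP[/hf {}hf /hg {}hg].
  by apply: sa_ext (sa_imp hf hg) => x; split=> /implyP.
- move=> f IHf /IHf hf /hf {}hf.
  by apply: sa_ext (sa_not hf) => x; split=> /negP.
Qed.

Fixpoint term_sum (s : seq (GRing.term R)) : GRing.term R :=
  if s is t :: s' then GRing.Add t (term_sum s') else GRing.NatConst _ 0.

Fixpoint term_prod (s : seq (GRing.term R)) : GRing.term R :=
  if s is t :: s' then GRing.Mul t (term_prod s') else GRing.NatConst _ 1.

Definition mpoly_term (p : mpoly n R) : GRing.term R :=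
  term_sum [seq GRing.Mul (GRing.Const (mcoeff mu p))
     (term_prod [seq GRing.Exp (GRing.Var R i) (mu i) | i : 'I_n <- enum 'I_n]) | mu <- msupp p].

Lemma rterm_mpoly p : GRing.rterm (mpoly_term p).
Proof.
rewrite /mpoly_term; elim: (msupp p) => //= mu s ->; rewrite andbT.
by elim: (enum 'I_n).
Qed.

Lemma eval_mpoly p x : GRing.eval (env x) (mpoly_term p) = peval p x.
Proof.
rewrite peval_sum /mpoly_term; elim: (msupp p) => [|mu s IH] /=.
  by rewrite big_nil.
rewrite big_cons IH; congr (_ * _ + _); rewrite -big_enum /=.
elim: (enum 'I_n) => [|i r IH'] /=; first by rewrite big_nil.
by rewrite big_cons IH' env_nth.
Qed.

(** The quantifier distributes over the pieces of a description. On one piece it is removed by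
    quantifier elimination for real closed fields, whose quantifier-free output is again
    semialgebraic. *)
Lemma sa_ex1 (P : 'rV[R]_n -> Prop) (i : 'I_n) :
  sa P -> sa (fun x => exists y, P (upd x i y)).
Proof.
move=> /saP[bs h].
apply: (@sa_ext _ _ (fun x => exists2 b, b \in bs & exists y, sign_set b (upd x i y))).
  move=> x; split; first by move=> [b bb [y sy]]; exists y; apply/h; exists b.
  by move=> [y /h[b bb sb]]; exists b => //; exists y.
apply: sa_bigor => b.
(* A clause lists equations before strict inequalities, in the reverse order of a description. *)
pose bc := ([seq mpoly_term p | p <- b.2], [seq mpoly_term p | p <- b.1]).
have rbc : ordered_qelim.ord.dnf_rterm (ordered_qelim.ord.w_to_oclause bc).
  rewrite /ordered_qelim.ord.dnf_rterm /= !all_map andbT.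
  by apply/andP; split; apply/allP => p _ /=; exact: rterm_mpoly.
have /andP[qf rf] := qe_rcf.wf_QE_wproj i rbc.
apply: sa_ext (sa_qf_eval qf rf) => x.
have V := qe_rcf.valid_QE_wproj i (env x) rbc.
have and_fold (Q : GRing.term R -> ordered_qelim.ord.formula R) s e :
    ordered_qelim.ord.holds e
      (foldr (fun t => ordered_qelim.ord.And (Q t)) (ordered_qelim.ord.Bool true) s)
    <-> (forall t, List.In t s -> ordered_qelim.ord.holds e (Q t)).
  elim: s => [|t s IH] /=; first by split.
  rewrite IH; split=> [[qt qs] u [<-|]//|qs]; first exact: qs.
  by split=> [|u us]; apply: qs; [left|right].
have inmap (s : seq (mpoly n R)) (Q : GRing.term R -> Prop) :
    (forall t, List.In t [seq mpoly_term p | p <- s] -> Q t) <->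
    (forall p, p \in s -> Q (mpoly_term p)).
  elim: s => [|p s IH] /=; first by split=> // _ p.
  split=> [hq q|hq t].
    rewrite inE => /orP[/eqP ->|qs]; first by apply: hq; left.
    by apply: (IH.1 _ q qs) => t ts; apply: hq; right.
  case=> [<-|ts]; first by apply: hq; rewrite mem_head.
  by apply: (IH.2 _ t ts) => q qs; apply: hq; rewrite inE qs orbT.
have hE y : ordered_qelim.ord.holds (set_nth 0 (env x) i y)
    (ordered_qelim.ord.odnf_to_oform [:: ordered_qelim.ord.w_to_oclause bc]) <->
    sign_set b (upd x i y).
  rewrite set_nth_env /= !and_fold !inmap /sign_set; split.
    case=> // -[e [_ [l _]]]; split=> g gb; rewrite -eval_mpoly; first exact: l.
    exact: e.
  move=> [l e]; left; split=> [g gb|]; first by rewrite /= eval_mpoly; exact: e.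
  by split=> //; split=> // g gb /=; rewrite eval_mpoly; exact: l.
split; first by move=> /V [y /hE sy]; exists y.
by move=> [y /hE sy]; apply/V; exists y.
Qed.

End TarskiSeidenberg.

Lemma sa_ex (R : realType) n m (P : 'rV[R]_n -> 'rV[R]_m -> Prop) :
  sa (fun w : 'rV[R]_(n + m) => P (lsubmx w) (rsubmx w)) ->
  sa (fun x => exists y, P x y).
Proof.
move=> h.
(* [k] counts the coordinates already quantified; those of index at least [k] are still read off
   from [w]. *)
have hk k : sa (fun w : 'rV[R]_(n + m) =>
    exists y : 'rV[R]_m, (forall j : 'I_m, (k <= j)%N -> y 0 j = w 0 (rshift n j)) /\
      P (lsubmx w) y).
  elim: k => [|k IH].
    apply: sa_ext h => w; split=> [pw|[y [yw]]]; first by exists (rsubmx w); split=> // j _; rewrite mxE.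
    by have -> // : y = rsubmx w by apply/rowP => j; rewrite yw // mxE.
  have [km|mk] := ltnP k m; last first.
    apply: sa_ext IH => w; split=> -[y [yw pw]]; exists y; split=> // j kj; apply: yw.
      by rewrite ltnW.
    by have := ltn_ord j; lia.
  apply: sa_ext (sa_ex1 (rshift n (Ordinal km)) IH) => w.
  have lE z : lsubmx (upd w (rshift n (Ordinal km)) z) = lsubmx w.
    by apply/rowP => j; rewrite !mxE eq_lrshift.
  have rE z j : upd w (rshift n (Ordinal km)) z 0 (rshift n j) =
      if j == Ordinal km then z else w 0 (rshift n j).
    by rewrite mxE (inj_eq (@rshift_inj n m)).
  split=> [[z [y [yw pw]]]|[y [yw pw]]].
    exists y; split=> [j kj|]; last by rewrite -(lE z).
    rewrite yw; last by lia.
    by rewrite rE; case: eqP => // jk; move: kj; rewrite jk /= ltnn.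
  exists (y 0 (Ordinal km)), y; split=> [j kj|]; last by rewrite lE.
  rewrite rE; case: eqP => [->//|/eqP]; rewrite -val_eqE /= => jk.
  by apply: yw; lia.
apply: (@sa_ext _ _ (fun x => exists y : 'rV[R]_m,
    (forall j : 'I_m, (m <= j)%N -> y 0 j = (row_mx x (0 : 'rV[R]_m)) 0 (rshift n j)) /\
      P (lsubmx (row_mx x (0 : 'rV[R]_m))) y)).
  move=> x; rewrite row_mxKl; split=> [[y [_ py]]|[y py]]; exists y => //.
  by split=> // j; have := ltn_ord j; lia.
apply: (@sa_comp _ _ _ _ (fun x : 'rV[R]_n => row_mx x (0 : 'rV[R]_m)) _ (hk m)).
move=> i; case: (split_ordP i) => j ->.
  by apply: polyfun_ext (polyfun_coord j) => x; rewrite row_mxEl.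
by apply: polyfun_ext (polyfun_const 0) => x; rewrite row_mxEr mxE.
Qed.

Lemma sa_all (R : realType) n m (P : 'rV[R]_n -> 'rV[R]_m -> Prop) :
  sa (fun w : 'rV[R]_(n + m) => P (lsubmx w) (rsubmx w)) ->
  sa (fun x => forall y, P x y).
Proof.
move=> /sa_not h; apply: sa_ext (sa_not (sa_ex (P := fun x y => ~ P x y) h)) => x.
by split=> [np y|py [y]]; [apply: contrapT => npy; apply: np; exists y|apply].
Qed.

Lemma sa_exR (R : realType) n (P : 'rV[R]_n -> R -> Prop) :
  sa (fun w : 'rV[R]_(n + 1) => P (lsubmx w) (w 0 (rshift n 0))) ->
  sa (fun x => exists y, P x y).
Proof.
move=> h; apply: (@sa_ext _ _ (fun x => exists y : 'rV[R]_1, P x (y 0 0))).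
  move=> x; split=> [[y py]|[y py]]; first by exists (y 0 0).
  by exists (\row_j y); rewrite mxE.
by apply: sa_ex; apply: sa_ext h => w; rewrite mxE.
Qed.

Lemma sa_allR (R : realType) n (P : 'rV[R]_n -> R -> Prop) :
  sa (fun w : 'rV[R]_(n + 1) => P (lsubmx w) (w 0 (rshift n 0))) ->
  sa (fun x => forall y, P x y).
Proof.
move=> /sa_not h; apply: sa_ext (sa_not (sa_exR (P := fun x y => ~ P x y) h)) => x.
by split=> [np y|py [y]]; [apply: contrapT => npy; apply: np; exists y|apply].
Qed.

(** * Roots of a polynomial in two variables *)

(** A polynomial is built from constants and coordinates by sums and products, so a class of
    functions stable under these operations that contains the coordinates of [f] contains the
    composite. It is applied to polynomials in one and in two variables. *)
Lemma polyfun_closed (R : realType) n (T : Type) (S : (T -> R) -> Prop)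
    (phi : 'rV[R]_n -> R) (f : T -> 'rV[R]_n) :
  (forall g h, g =1 h -> S g -> S h) -> (forall c, S (fun _ => c)) ->
  (forall g h, S g -> S h -> S (fun t => g t + h t)) ->
  (forall g h, S g -> S h -> S (fun t => g t * h t)) ->
  polyfun phi -> (forall i, S (fun t => f t 0 i)) -> S (fun t => phi (f t)).
Proof.
move=> Sext Sc Sadd Smul [D [p _ pE]] Sf.
apply: (Sext (fun t => \sum_(mu <- msupp p) mcoeff mu p * \prod_i f t 0 i ^+ mu i)).
  by move=> t; rewrite pE peval_sum.
elim: (msupp p) => [|mu s IH].
  by apply: Sext (Sc 0) => t; rewrite big_nil.
apply: (Sext (fun t => mcoeff mu p * \prod_i f t 0 i ^+ mu i +
   \sum_(mu <- s) mcoeff mu p * \prod_i f t 0 i ^+ mu i)).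
  by move=> t; rewrite big_cons.
apply: (Sadd _ _) => //; apply: (Smul _ _) => //.
elim: (index_enum _) => [|i r IH'].
  by apply: Sext (Sc 1) => t; rewrite big_nil.
apply: (Sext (fun t => f t 0 i ^+ mu i * \prod_(j <- r) f t 0 j ^+ mu j)).
  by move=> t; rewrite big_cons.
apply: (Smul _ _) => //; elim: (mu i) => [|k IH''].
  by apply: Sext (Sc 1) => t; rewrite expr0.
by apply: Sext (Smul _ _ (Sf i) IH'') => t; rewrite exprS.
Qed.

Lemma polyfun_poly (R : realType) n (phi : 'rV[R]_n -> R) (f : R -> 'rV[R]_n) :
  polyfun phi -> (forall i, exists q : {poly R}, forall t, f t 0 i = q.[t]) ->
  exists q : {poly R}, forall t, phi (f t) = q.[t].
Proof.
apply: (@polyfun_closed _ _ _ (fun g : R -> R => exists q : {poly R}, forall t, g t = q.[t])).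
- by move=> g h e [q qE]; exists q => t; rewrite -e.
- by move=> c; exists c%:P => t; rewrite hornerC.
- by move=> g h [q qE] [r rE]; exists (q + r) => t; rewrite hornerD qE rE.
- by move=> g h [q qE] [r rE]; exists (q * r) => t; rewrite hornerM qE rE.
Qed.

(** The outer variable is [s] and the coefficients are polynomials in [a], so [size P] bounds the
    degree in [s], which is the degree that becomes an exponent. *)
Definition bieval (R : comNzRingType) (P : {poly {poly R}}) (a s : R) : R :=
  (P.[s%:P]).[a].

Lemma polyfun_bipoly (R : realType) n (phi : 'rV[R]_n -> R) (f : R -> R -> 'rV[R]_n) :
  polyfun phi ->
  (forall i, exists Q : {poly {poly R}}, forall a s, f a s 0 i = bieval Q a s) ->
  exists Q : {poly {poly R}}, forall a s, phi (f a s) = bieval Q a s.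
Proof.
move=> pf ff.
have [Q QE] := @polyfun_closed _ _ _ (fun g : R * R -> R => exists Q : {poly {poly R}},
  forall as_, g as_ = bieval Q as_.1 as_.2) phi (fun as_ => f as_.1 as_.2)
  ltac:(by move=> g h e [q qE]; exists q => t; rewrite -e)
  ltac:(by move=> c; exists c%:P%:P => t; rewrite /bieval !hornerC)
  ltac:(by move=> g h [q qE] [r rE]; exists (q + r) => t; rewrite /bieval !hornerD qE rE)
  ltac:(by move=> g h [q qE] [r rE]; exists (q * r) => t; rewrite /bieval !hornerM qE rE)
  pf ltac:(by move=> i; have [Q QE] := ff i; exists Q => t; exact: QE).
by exists Q => a s; have := QE (a, s).
Qed.

Lemma poly_bounded (R : realFieldType) (p : {poly R}) (M : R) :
  exists2 B, 0 <= B & forall t, `|t| <= M -> `|p.[t]| <= B.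
Proof.
elim/poly_ind: p => [|p c [B B0 hB]]; first by exists 0 => // t _; rewrite horner0 normr0.
exists (B * `|M| + `|c|) => [|t tM]; first by rewrite addr_ge0 // mulr_ge0.
rewrite hornerMXaddC (le_trans (ler_normD _ _)) // lerD2r normrM.
by rewrite ler_pM // ?hB // (le_trans tM) // ler_norm.
Qed.

Lemma bieval_bounded (R : realFieldType) (P : {poly {poly R}}) (M : R) :
  exists2 B, 0 <= B & forall a s, `|a| <= M -> `|s| <= M -> `|bieval P a s| <= B.
Proof.
elim/poly_ind: P => [|P c [B B0 hB]].
  by exists 0 => // a s _ _; rewrite /bieval !horner0 normr0.
have [B' B'0 hB'] := poly_bounded c M.
exists (B * `|M| + B') => [|a s aM sM]; first by rewrite addr_ge0 // mulr_ge0.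
rewrite /bieval hornerMXaddC hornerD hornerM hornerC (le_trans (ler_normD _ _)) //.
rewrite lerD ?hB' // normrM ler_pM ?hB //.
by rewrite (le_trans sM) // ler_norm.
Qed.

(** After the full power of [X - x0] is factored out, the cofactor stays away from zero near [x0].
    The multiplicity is at most the degree, and [d <= 1] allows the exponent to be raised to the
    degree. *)
Lemma poly_lower (R : realFieldType) (p : {poly R}) (x0 : R) : p != 0 ->
  exists c d, [/\ 0 < c, 0 < d, d <= 1 & forall s, `|s - x0| < d ->
    c * `|s - x0| ^+ (size p).-1 <= `|p.[s]|].
Proof.
move=> p0; have [m [q qr pE]] := multiplicity_XsubC p x0.
rewrite p0 /= in qr; have q0 : q.[x0] != 0 by rewrite rootE in qr.
have [u uE] : exists u, q = u * ('X - x0%:P) + q.[x0]%:P.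
  have /factor_theorem[u uE] : root (q - q.[x0]%:P) x0.
    by rewrite rootE hornerD hornerN hornerC subrr.
  by exists u; rewrite -uE subrK.
have [B B0 hB] := poly_bounded u (`|x0| + 1).
have qx0 : 0 < `|q.[x0]| by rewrite normr_gt0.
pose d := Order.min 1 (`|q.[x0]| / (2 * (B + 1))).
have B1 : 0 < 2 * (B + 1) by rewrite mulr_gt0 // ltr_wpDl.
exists (`|q.[x0]| / 2), d; split.
- by rewrite divr_gt0.
- by rewrite lt_min ltr01 divr_gt0.
- by rewrite ge_min lexx.
move=> s; rewrite lt_min => /andP[s1 sB].
have hm : (m <= (size p).-1)%N.
  have q00 : q != 0 by apply: contraNneq q0 => ->; rewrite horner0.
  rewrite pE size_mul ?expf_neq0 ?polyXsubC_eq0 // size_exp_XsubC.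
  have : (0 < size q)%N by rewrite lt0n size_poly_eq0.
  by rewrite addnS /=; case: (size q) => // k _; rewrite addSn /= leq_addl.
have hq : `|q.[x0]| / 2 <= `|q.[s]|.
  have -> : q.[s] = u.[s] * (s - x0) + q.[x0].
    by rewrite [in LHS]uE hornerD hornerM hornerXsubC hornerC.
  have h1 : `|u.[s] * (s - x0)| <= `|q.[x0]| / 2.
    rewrite normrM.
    have us : `|u.[s]| <= B.
      apply: hB; have := ler_normD (s - x0) x0; rewrite subrK => h.
      by rewrite (le_trans h) // addrC lerD2l ltW.
    have : B * `|s - x0| <= `|q.[x0]| / 2.
      rewrite ltr_pdivlMr // in sB.
      have : 0 <= `|s - x0| by []. nra.
    by apply: le_trans; rewrite ler_wpM2r.
  have h3 : `|q.[x0]| <= `|u.[s] * (s - x0) + q.[x0]| + `|u.[s] * (s - x0)|.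
    have := ler_normB (u.[s] * (s - x0) + q.[x0]) (u.[s] * (s - x0)).
    by rewrite addrAC subrr add0r.
  move: h1 h3; set A := `|_|; set B' := `|_|; set C' := `|_| => h1 h3; lra.
have -> : p.[s] = q.[s] * (s - x0) ^+ m by rewrite [in LHS]pE hornerM horner_exp hornerXsubC.
rewrite normrM normrX ler_pM //.
rewrite -(subnK hm) exprD ler_piMl ?exprn_ge0 // exprn_ile1 // ltW //.
Qed.

Lemma poly_strip (F : idomainType) (p : {poly F}) : p != 0 ->
  exists k q, p = q * 'X^k /\ q`_0 != 0.
Proof.
move=> p0; have [k [q qr pE]] := multiplicity_XsubC p 0.
exists k, q; rewrite subr0 in pE; split=> //.
by move: qr; rewrite p0 /= rootE horner_coef0.
Qed.

(* After removing the largest power of [a], the coefficient of [a ^ 0] is a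
   nonzero polynomial in [s], whose order of vanishing at [x0] is at most its degree. *)
Lemma newton_bound (R : realFieldType) (P : {poly {poly R}}) (x0 : R) : P != 0 ->
  exists C d, [/\ 0 < C, 0 < d & forall a s, 0 < a -> a < d -> `|s - x0| < d ->
    bieval P a s = 0 -> `|s - x0| ^+ (size P).-1 <= C * a].
Proof.
move=> P0; have sP0 : swapXY P != 0 by rewrite swapXY_eq0.
have [k [Q [QE Q0]]] := poly_strip sP0.
have PE : P = swapXY Q * ('X%:P) ^+ k.
  by rewrite -[LHS]swapXYK QE rmorphM /= rmorphXn /= swapXY_X.
have [c [d [c0 d0 d1 hc]]] := poly_lower x0 Q0.
(* With the variables exchanged, [Q] is a polynomial in [a] over polynomials in [s], and [U] is its
   quotient by [a]: at a root the constant term equals [- a U], which is of order [a]. *)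
pose U : {poly {poly R}} := \poly_(i < (size Q).-1) Q`_i.+1.
have QU : Q = U * 'X + (Q`_0)%:P.
  apply/polyP => -[|i]; rewrite coefD coefMX coefC /= ?add0r // addr0 coef_poly.
  case: ltnP => // h; rewrite nth_default //.
  by rewrite (leq_trans (leqSpred _)).
have [B B0 hB] := bieval_bounded (swapXY U) (`|x0| + 1).
exists ((B + 1) / c), d; split=> //; first by rewrite divr_gt0 // ltr_wpDl.
move=> a s a0 ad sd Pas.
have hE (V : {poly {poly R}}) : bieval (swapXY V) a s = V.[a%:P].[s].
  by rewrite /bieval horner2_swapXY.
have : bieval (swapXY Q) a s = 0.
  move: Pas; rewrite PE /bieval hornerM horner_exp hornerC hornerM horner_exp hornerX => /eqP.
  by rewrite mulf_eq0 expf_eq0 (gt_eqF a0) andbF orbF => /eqP.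
rewrite hE QU hornerMXaddC hornerD hornerM hornerC -hE => e.
have hp : c * `|s - x0| ^+ (size Q`_0).-1 <= B * a.
  apply: (le_trans (hc s sd)).
  have -> : (Q`_0).[s] = - (bieval (swapXY U) a s * a) by move/eqP: e; rewrite addrC addr_eq0 => /eqP.
  rewrite normrN normrM (gtr0_norm a0) ler_wpM2r ?(ltW a0) //.
  apply: hB; last first.
    have := ler_normD (s - x0) x0; rewrite subrK => h.
    by rewrite (le_trans h) // addrC lerD2l (le_trans (ltW sd)).
  by rewrite gtr0_norm // (le_trans (ltW ad)) // (le_trans d1) // lerDr.
have hs : ((size (Q`_0)%R).-1 <= (size P).-1)%N.
  have -> : Q`_0 = (swapXY P)`_k by rewrite QE coefMXn ltnn subnn.
  have := max_size_coefXY (swapXY P) k; rewrite sizeYE swapXYK => h.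
  by rewrite -!subn1 leq_sub2r.
have : `|s - x0| ^+ (size P).-1 <= `|s - x0| ^+ (size Q`_0).-1.
  rewrite -(subnK hs) exprD ler_piMl ?exprn_ge0 // exprn_ile1 //.
  by rewrite ltW // (lt_le_trans sd).
move=> h; rewrite (le_trans h) // mulrAC ler_pdivlMr // mulrC.
by rewrite (le_trans hp) // ler_wpM2r ?ltW // ltrDl.
Qed.

(** * Semialgebraic conditions near zero *)

Section Tame.
Context {R : realType}.
Implicit Types (A B : R -> Prop) (p q : {poly R}).

Definition ev0 A : Prop := exists2 d : R, 0 < d & forall t, 0 < t -> t < d -> A t.

Lemma ev0_and A B : ev0 A -> ev0 B -> ev0 (fun t => A t /\ B t).
Proof.
move=> [d d0 hd] [e e0 he]; exists (Order.min d e); first by rewrite lt_min d0.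
by move=> t t0; rewrite lt_min => /andP[td te]; split; [exact: hd|exact: he].
Qed.

Lemma ev0_imp A B : (forall t, 0 < t -> A t -> B t) -> ev0 A -> ev0 B.
Proof. by move=> AB [d d0 hd]; exists d => // t t0 td; apply: AB => //; exact: hd. Qed.

Lemma ev0_all A : (forall t, 0 < t -> A t) -> ev0 A.
Proof. by move=> h; exists 1 => // t t0 _; exact: h. Qed.

Lemma ev0_lt (d : R) : 0 < d -> ev0 (fun t => t < d).
Proof. by move=> d0; exists d. Qed.

Lemma ev0_ex A : ev0 A -> exists2 t, 0 < t & A t.
Proof.
move=> [d d0 hd]; exists (d / 2); first by rewrite divr_gt0.
by apply: hd; lra.
Qed.

(** Eventually true or eventually false as [t] decreases to [0]: the germ form of o-minimality. *)
Definition tame A : Prop := ev0 A \/ ev0 (fun t => ~ A t).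

Lemma tame_ext A B : (forall t, A t <-> B t) -> tame A -> tame B.
Proof.
by move=> AB [h|h]; [left|right]; apply: ev0_imp h => t _; rewrite AB.
Qed.

Lemma tame_not A : tame A -> tame (fun t => ~ A t).
Proof.
by case=> h; [right|left]; apply: ev0_imp h => t _ //; move=> ? ?.
Qed.

Lemma tame_and A B : tame A -> tame B -> tame (fun t => A t /\ B t).
Proof.
case=> hA; last by move=> _; right; apply: ev0_imp hA => t _ nA [].
case=> hB; first by left; exact: ev0_and.
by right; apply: ev0_imp hB => t _ nB [].
Qed.

Lemma tame_allin (T : eqType) (r : seq T) (F : T -> R -> Prop) :
  (forall t, tame (F t)) -> tame (fun x => forall t, t \in r -> F t x).
Proof.
move=> h; elim: r => [|t r IH]; first by left; exact: ev0_all.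
apply: tame_ext (tame_and (h t) IH) => x; split.
  by move=> [ft fr] s; rewrite inE => /orP[/eqP ->|]; auto.
by move=> f; split=> [|s sr]; apply: f; rewrite inE ?eqxx ?sr ?orbT.
Qed.

Lemma tame_exin (T : eqType) (r : seq T) (F : T -> R -> Prop) :
  (forall t, tame (F t)) -> tame (fun x => exists2 t, t \in r & F t x).
Proof.
move=> h; have := tame_not (tame_allin r (fun t => tame_not (h t))).
apply: tame_ext => x; split=> [nf|[t tr ft] f]; last exact: f tr ft.
by apply: contrapT => ne; apply: nf => t tr ft; apply: ne; exists t.
Qed.

Lemma poly_pos_near p (y0 : R) : 0 < p.[y0] ->
  exists2 d : R, 0 < d & forall y, `|y - y0| < d -> 0 < p.[y].
Proof.
move=> h; have /cvgrPdist_lt /(_ _ h) /nbhs_ballP[d /= d0 hd] := @continuous_horner R p y0.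
exists d => // y yd; have := hd y; rewrite /ball /= distrC => /(_ yd).
by rewrite ltr_norml => /andP[_]; lra.
Qed.

(** The lower bound at [0] excludes roots on a small interval to the right, and the intermediate
    value theorem then fixes the sign. *)
Lemma poly_sign_near0 p : p != 0 ->
  ev0 (fun t => 0 < p.[t]) \/ ev0 (fun t => p.[t] < 0).
Proof.
move=> p0; have [c [d [c0 d0 d1 hd]]] := poly_lower 0 p0.
have nz t : 0 < t -> t < d -> p.[t] != 0.
  move=> t0 td; rewrite -normr_gt0.
  have := hd t; rewrite subr0 gtr0_norm // => /(_ td); apply: lt_le_trans.
  by rewrite mulr_gt0 // exprn_gt0.
have d2 : 0 < d / 2 by rewrite divr_gt0.
have d2d : d / 2 < d by lra.
have same s t : 0 < s -> s < d -> 0 < t -> t < d -> s <= t -> p.[s] * p.[t] > 0.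
  move=> s0 sd t0 td st; rewrite ltNge; apply/negP => le0.
  have [x] := polyrcf.poly_ivt st le0; rewrite in_itv /= => /andP[sx xt] /eqP rx.
  by move: (nz x (lt_le_trans s0 sx) (le_lt_trans xt td)); rewrite rx eqxx.
have [h|h] := ltP 0 p.[d / 2]; [left|right]; exists d => // t t0 td;
  have [le|/ltW le] := leP t (d / 2).
- by have := same _ _ t0 td d2 d2d le; rewrite pmulr_lgt0.
- by have := same _ _ d2 d2d t0 td le; rewrite pmulr_rgt0.
- have := same _ _ t0 td d2 d2d le; have := nz _ d2 d2d; nra.
- have := same _ _ d2 d2d t0 td le; have := nz _ d2 d2d; nra.
Qed.

Lemma tame_pos p : tame (fun t => 0 < p.[t]).
Proof.
have [->|/poly_sign_near0[h|h]] := eqVneq p 0.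
- by right; apply: ev0_all => t _; rewrite horner0 ltxx.
- by left.
- by right; apply: ev0_imp h => t _ h; apply/negP; rewrite -leNgt ltW.
Qed.

Lemma tame_zero p : tame (fun t => p.[t] = 0).
Proof.
have [->|/poly_sign_near0[h|h]] := eqVneq p 0.
- by left; apply: ev0_all => t _; rewrite horner0.
- by right; apply: ev0_imp h => t _ h e; move: h; rewrite e ltxx.
- by right; apply: ev0_imp h => t _ h e; move: h; rewrite e ltxx.
Qed.

(** Each of the finitely many polynomials of a description has a constant sign to the right of [0],
    so every Boolean combination of sign conditions is decided there. *)
Lemma sa_tame A : sa (fun x : 'rV[R]_1 => A (x 0 0)) -> tame A.
Proof.
move=> /saP[bs h].
pose line t : 'rV[R]_1 := \row_i t.
have hline (i : 'I_1) : exists q : {poly R}, forall t, line t 0 i = q.[t].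
  by exists 'X => t; rewrite hornerX mxE.
apply: (@tame_ext (fun t => exists2 b, b \in bs & sign_set b (line t))).
  by move=> t; rewrite -h mxE.
apply: tame_exin => b; apply: tame_and; apply: tame_allin => g;
  have [q qE] := polyfun_poly (polyfun_peval g) hline.
- by apply: tame_ext (tame_pos q) => t; rewrite qE.
- by apply: tame_ext (tame_zero q) => t; rewrite qE.
Qed.

(** If every polynomial of the list vanishing at [y0] vanished on the whole line over [x], the
    equations of the piece containing [y0] would hold everywhere on that line and its strict
    inequalities near [y0], so the solution would not be unique. The list does not depend on [x]. *)
Lemma sa_root k (A : 'rV[R]_k -> R -> Prop) :
  sa (fun w : 'rV[R]_(k + 1) => A (lsubmx w) (w 0 (rshift k 0))) ->
  exists L : seq (mpoly (k + 1) R), forall x y0, (forall y, A x y <-> y = y0) ->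
    exists q : mpoly (k + 1) R, [/\ q \in L, peval q (row_mx x (\row_i y0)) = 0 &
      exists y, peval q (row_mx x (\row_i y)) <> 0].
Proof.
move=> /saP[bs h]; exists (flatten [seq b.1 ++ b.2 | b <- bs]) => x y0 hy.
apply: contrapT => nq.
pose line y : 'rV[R]_(k + 1) := row_mx x (\row_i y).
have AE y : A x y <-> exists2 b, b \in bs & sign_set b (line y).
  by rewrite -h row_mxKl row_mxEr mxE.
have [b bb [gb hb]] : exists2 b, b \in bs & sign_set b (line y0).
  by apply/AE/hy.
have inL (q : mpoly (k + 1) R) : q \in b.1 ++ b.2 -> q \in flatten [seq b.1 ++ b.2 | b <- bs].
  by move=> qb; apply/flatten_mapP; exists b.
have hline (i : 'I_(k + 1)) : exists q : {poly R}, forall t, line t 0 i = q.[t].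
  case: (split_ordP i) => j ->.
    by exists (x 0 j)%:P => t; rewrite row_mxEl hornerC.
  by exists 'X => t; rewrite row_mxEr mxE hornerX.
have hb' (q : mpoly (k + 1) R) : q \in b.2 -> forall y, peval q (line y) = 0.
  move=> qb y; apply: contrapT => qy; apply: nq; exists q; split.
  - by apply: inL; rewrite mem_cat qb orbT.
  - exact: hb.
  - by exists y.
have [d d0 hd] : exists2 d : R, 0 < d & forall y, `|y - y0| < d ->
    forall g, g \in b.1 -> 0 < peval g (line y).
  elim: (b.1) gb {inL nq hb hb'} => [_|g r IH gb]; first by exists 1.
  have [|d d0 hd] := IH; first by move=> g' g'r; apply: gb; rewrite inE g'r orbT.
  have [q qE] := polyfun_poly (polyfun_peval g) hline.
  have [|e e0 he] := @poly_pos_near q y0; first by rewrite -qE; apply: gb; rewrite mem_head.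
  exists (Order.min d e); first by rewrite lt_min d0.
  move=> y; rewrite lt_min => /andP[yd ye] g'; rewrite inE => /orP[/eqP ->|]; last exact: hd.
  by rewrite qE; exact: he.
(* A second solution, contradicting uniqueness. *)
have /hy : A x (y0 + d / 2).
  apply/AE; exists b => //; split=> [g gin|q qin]; last exact: hb'.
  by apply: hd => //; rewrite addrAC subrr add0r gtr0_norm; lra.
by move: d0; lra.
Qed.

End Tame.

(** * Taylor estimates and compactness *)

Section RowVectors.
Context {R : realType} {n : nat}.
Implicit Types (x y : 'rV[R]_n).

Lemma coord_le_norm x i : `|x 0 i| <= `|x|.
Proof.
rewrite [leRHS]/Num.Def.normr /= mx_normrE; apply/bigmax_geP; right => /=.
by exists (0, i).
Qed.

Lemma norm_le_coord x (M : R) : 0 <= M -> (forall i, `|x 0 i| <= M) -> `|x| <= M.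
Proof.
move=> M0 h; rewrite [leLHS]/Num.Def.normr /= mx_normrE; apply/bigmax_leP; split=> // -[j i] _ /=.
by rewrite (ord1 j).
Qed.

Lemma norm_coord_eq x : x != 0 -> exists i, `|x| = `|x 0 i|.
Proof.
move=> x0; have /mx_norm_neq0[[j i] /= e] : mx_norm x != 0.
  by apply: contra_neq x0 => /mx_norm_eq0.
by exists i; rewrite -(ord1 j).
Qed.

Lemma updE x i (y : R) j : upd x i y 0 j = if j == i then y else x 0 j.
Proof. by rewrite mxE. Qed.

Lemma upd_dist x i h : `|upd x i (x 0 i + h) - x| <= `|h|.
Proof.
apply: norm_le_coord => // j; rewrite !mxE; case: eqP => [->|_].
  by rewrite addrAC subrr add0r.
by rewrite subrr normr0.
Qed.

End RowVectors.

Lemma mpoly_gen_ind (R : realType) n (P : mpoly n R -> Prop) :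
  (forall c, P (mpolyC n c)) -> (forall i, P (mpolyX R (mnm1 i))) ->
  (forall p q, P p -> P q -> P (p + q)) -> (forall p q, P p -> P q -> P (p * q)) ->
  forall p, P p.
Proof.
move=> Pc PX PD PM p; rewrite (mpolyE p); elim: (msupp p) => [|mu s IH].
  by rewrite big_nil -mpolyC0; exact: Pc.
rewrite big_cons; apply: (PD _ _) => //; rewrite -mul_mpolyC; apply: (PM _ _) => //.
rewrite mpolyXE_id; elim: (index_enum _) => [|i r IH']; first by rewrite big_nil -mpolyC1; exact: Pc.
rewrite big_cons; apply: (PM _ _) => //; elim: (mu i) => [|k IHk].
  by rewrite expr0 -mpolyC1; exact: Pc.
by rewrite exprS; exact: PM.
Qed.

Section Taylor.
Context {R : realType} {n : nat}.
Implicit Types (x y : 'rV[R]_n) (p : mpoly n R).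

Definition dpeval p x y : R := \sum_j peval (mderiv j p) x * (y 0 j - x 0 j).

(** The size of [p], its Lipschitz bound, the bound on the differential and the quadratic remainder
    are proved together because the product step for each draws on the others. *)
Lemma taylor p (M : R) : exists2 C, 0 <= C & forall x y, `|x| <= M -> `|y| <= M ->
  [/\ `|peval p x| <= C, `|peval p y - peval p x| <= C * `|y - x|,
      `|dpeval p x y| <= C * `|y - x| &
      `|peval p y - peval p x - dpeval p x y| <= C * `|y - x| ^+ 2].
Proof.
elim/mpoly_gen_ind: p => [c|i|p q [C C0 hC] [D D0 hD]|p q [C C0 hC] [D D0 hD]].
- exists `|c| => // x y _ _.
  have dE : dpeval (mpolyC n c) x y = 0.
    by rewrite /dpeval big1 // => j _; rewrite mderivC /peval meval0 mul0r.
  rewrite dE /peval !mevalC subrr subr0 !normr0; split=> //; rewrite mulr_ge0 // ?exprn_ge0 //.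
- exists (`|M| + 1) => [|x y xM yM]; first by rewrite addr_ge0.
  have dE : dpeval (mpolyX R (mnm1 i)) x y = y 0 i - x 0 i.
    rewrite /dpeval (bigD1 i) //= big1 ?addr0.
      rewrite mderivX mnmE eqxx scale1r /peval.
      have -> : mnm_sub (mnm1 i) (mnm1 i) = mnm0 by apply/mnmP => j; rewrite !mnmE subnn.
      by rewrite mpolyX0 meval1 mul1r.
    move=> j ji; rewrite mderivX mnmE eq_sym (negbTE ji) scale0r /peval meval0 mul0r //.
  have xi : `|y 0 i - x 0 i| <= `|y - x| by have := coord_le_norm (y - x) i; rewrite !mxE.
  have le1 : `|y - x| <= (`|M| + 1) * `|y - x| by rewrite ler_peMl // lerDr.
  rewrite dE /peval !mevalXU subrr normr0; split.
  + by rewrite (le_trans (coord_le_norm _ _)) // (le_trans xM) // (le_trans (ler_norm _)) // lerDl.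
  + exact: le_trans le1.
  + exact: le_trans le1.
  + by rewrite mulr_ge0 ?exprn_ge0 // addr_ge0.
- exists (C + D) => [|x y xM yM]; first exact: addr_ge0.
  have [c1 c2 c3 c4] := hC x y xM yM; have [d1 d2 d3 d4] := hD x y xM yM.
  have dE : dpeval (p + q) x y = dpeval p x y + dpeval q x y.
    by rewrite /dpeval -big_split; apply: eq_bigr => j _; rewrite mderivD /peval mevalD mulrDl.
  rewrite dE /peval !mevalD -/(peval p x) -/(peval q x) -/(peval p y) -/(peval q y).
  split; rewrite ?mulrDl.
  + by rewrite (le_trans (ler_normD _ _)) // lerD.
  + by rewrite opprD addrACA (le_trans (ler_normD _ _)) // lerD.
  + by rewrite (le_trans (ler_normD _ _)) // lerD.
  + rewrite (_ : _ - _ = (peval p y - peval p x - dpeval p x y) +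
       (peval q y - peval q x - dpeval q x y)); last by ring.
    by rewrite (le_trans (ler_normD _ _)) // lerD.
(* The remainder of a product splits into three terms: either remainder times the other factor, and
   the product of the two increments. *)
- exists (3 * (C * D)) => [|x y xM yM]; first by rewrite !mulr_ge0.
  have [c1 c2 c3 c4] := hC x y xM yM; have [d1 d2 d3 d4] := hD x y xM yM.
  have [_ _ _ _] := hC y y yM yM.
  have [d1' _ _ _] := hD y y yM yM.
  have dE : dpeval (p * q) x y = dpeval p x y * peval q x + peval p x * dpeval q x y.
    rewrite /dpeval mulr_suml mulr_sumr -big_split; apply: eq_bigr => j _ /=.
    by rewrite mderivM /peval mevalD !mevalM; ring.
  rewrite dE /peval !mevalM -/(peval p x) -/(peval q x) -/(peval p y) -/(peval q y).
  have t0 : 0 <= `|y - x| by [].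
  have CD : 0 <= C * D by rewrite mulr_ge0.
  have nn (z : R) : 0 <= `|z| by [].
  split.
  + rewrite normrM; have := ler_pM (nn _) (nn _) c1 d1; nra.
  + rewrite (_ : _ - _ = (peval p y - peval p x) * peval q y + peval p x * (peval q y - peval q x)); last by ring.
    rewrite (le_trans (ler_normD _ _)) // !normrM.
    have := ler_pM (nn _) (nn _) c2 d1'; have := ler_pM (nn _) (nn _) c1 d2.
    have : 0 <= C * D * `|y - x| by rewrite mulr_ge0.
    nra.
  + rewrite (le_trans (ler_normD _ _)) // !normrM.
    have := ler_pM (nn _) (nn _) c3 d1; have := ler_pM (nn _) (nn _) c1 d3.
    have : 0 <= C * D * `|y - x| by rewrite mulr_ge0.
    nra.
  + rewrite (_ : _ - _ = (peval p y - peval p x - dpeval p x y) * peval q x +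
      (peval p x * (peval q y - peval q x - dpeval q x y) +
       (peval p y - peval p x) * (peval q y - peval q x))); last by ring.
    rewrite (le_trans (ler_normD _ _)) // (le_trans (lerD (lexx _) (ler_normD _ _))) // !normrM.
    have := ler_pM (nn _) (nn _) c4 d1; have := ler_pM (nn _) (nn _) c1 d4.
    have := ler_pM (nn _) (nn _) c2 d2.
    have -> : C * `|y - x| * (D * `|y - x|) = C * D * `|y - x| ^+ 2 by ring.
    have -> : C * (D * `|y - x| ^+ 2) = C * D * `|y - x| ^+ 2 by ring.
    have -> : C * `|y - x| ^+ 2 * D = C * D * `|y - x| ^+ 2 by ring.
    lra.
Qed.

Lemma peval_continuous p : continuous (peval p).
Proof.
move=> x A /nbhs_ballP[e /= e0 hA].
have [C C0 hC] := taylor p (`|x| + 1).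
have e1 : 0 < Order.min 1 (e / (C + 1)) by rewrite lt_min ltr01 divr_gt0 // ltr_wpDl.
apply/nbhs_ballP; exists (Order.min 1 (e / (C + 1))) => // y.
rewrite -ball_normE /= lt_min => /andP[h1 h2]; apply: hA.
rewrite -ball_normE /=.
have yM : `|y| <= `|x| + 1.
  have := ler_normD x (y - x); rewrite addrC subrK => /le_trans; apply.
  by rewrite distrC lerD2l ltW.
have [_ h _ _] := hC y x yM ltac:(by rewrite lerDl).
apply: (le_lt_trans h); move: h2; rewrite ltr_pdivlMr ?ltr_wpDl //.
have : 0 <= `|x - y| by []. nra.
Qed.

Lemma polyfun_continuous (phi : 'rV[R]_n -> R) : polyfun phi -> continuous phi.
Proof.
move=> [D [p _ pE]]; have -> : phi = peval p by apply/funext.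
exact: peval_continuous.
Qed.

(* With [k = 0] this is Fermat's rule in the [i]-th coordinate. *)
Lemma slope_bound p x (i : 'I_n) (k e : R) : 0 <= k -> 0 < e ->
  (forall h, `|h| < e -> peval p x - k * `|h| <= peval p (upd x i (x 0 i + h))) ->
  `|peval (mderiv i p) x| <= k.
Proof.
move=> k0 e0 hp; have [C C0 hC] := taylor p (`|x| + 1).
set d := peval (mderiv i p) x.
have dE h : dpeval p x (upd x i (x 0 i + h)) = d * h.
  rewrite /dpeval (bigD1 i) //= big1 ?addr0; first by rewrite updE eqxx addrAC subrr add0r.
  by move=> j ji; rewrite updE (negbTE ji) subrr mulr0.
rewrite leNgt; apply/negP => kd.
(* Short enough for the quadratic remainder to cost at most half of [(|d| - k) h]. *)
pose h := Order.min (Order.min 1 (e / 2)) ((`|d| - k) / (2 * (C + 1))).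
have h0 : 0 < h by rewrite !lt_min ltr01 !divr_gt0 ?subr_gt0 // mulr_gt0 // ltr_wpDl.
have h1 : h <= 1 by rewrite /h !ge_min lexx.
have he : h < e.
  by rewrite (@le_lt_trans _ _ (e / 2)) // ?/h ?ge_min ?lexx ?orbT // ltr_pdivrMr //; lra.
have hC' : h * (C + 1) <= (`|d| - k) / 2.
  rewrite -ler_pdivlMr ?ltr_wpDl // -mulrA -invfM /h ge_min.
  by apply/orP; right.
(* A step against the sign of the derivative lowers the value at rate [|d|], faster than the rate
   [k] that is allowed. *)
pose t := - Num.sg d * h.
have d0 : d != 0 by rewrite -normr_gt0 (le_lt_trans k0).
have tn : `|t| = h by rewrite normrM normrN normr_sg d0 mul1r gtr0_norm.
have dt : d * t = - (`|d| * h) by rewrite /t normrEsg; ring.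
have ty : `|upd x i (x 0 i + t)| <= `|x| + 1.
  have := ler_normD x (upd x i (x 0 i + t) - x); rewrite addrC subrK => /le_trans; apply.
  by rewrite lerD2l (le_trans (upd_dist _ _ _)) // tn.
have [_ _ _] := hC x _ ltac:(by rewrite lerDl) ty.
rewrite dE dt ler_norml => /andP[_ hu].
have hl : peval p x - k * h <= peval p (upd x i (x 0 i + t)).
  by have := hp t; rewrite tn => /(_ he).
have hs : C * `|upd x i (x 0 i + t) - x| ^+ 2 <= C * h ^+ 2.
  by rewrite ler_wpM2l // ler_pXn2r ?nnegrE ?(ltW h0) // -tn upd_dist.
have : (`|d| - k) * h <= C * h ^+ 2 by lra.
rewrite expr2 mulrA ler_pM2r //; have : h * (C + 1) <= (`|d| - k) / 2 by [].
by move: kd h0; lra.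
Qed.

End Taylor.

Section Compactness.
Context {R : realType} {n : nat}.
Implicit Types (x y : 'rV[R]_n) (A : set 'rV[R]_n).

Lemma compact_argmin A (f : 'rV[R]_n -> R) :
  A !=set0 -> compact A -> continuous f -> exists2 c, A c & forall x, A x -> f c <= f x.
Proof.
move=> A0 cA cf; have [|c cA' hc] := EVT_min_rV A0 cA (f := f).
  exact: continuous_subspaceT.
by exists c; [rewrite inE in cA'|move=> x Ax; apply: hc; rewrite inE].
Qed.

Lemma compact_box A (M : R) : closed A -> (forall x, A x -> `|x| <= M) -> compact A.
Proof.
move=> cA hA; apply: bounded_closed_compact => //.
by exists M; split; [exact: num_real|move=> M' MM' x /hA h /=; rewrite (le_trans h) // ltW].
Qed.

Lemma closed_lefun (f g : 'rV[R]_n -> R) :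
  continuous f -> continuous g -> closed [set x | f x <= g x].
Proof.
move=> cf cg.
have -> : [set x | f x <= g x] = (fun x => g x - f x) @^-1` [set y | 0 <= y].
  by apply/seteqP; split=> x /=; rewrite subr_ge0.
apply: closed_comp; last exact: closed_ge.
by move=> x _; apply: continuousB; [exact: cg|exact: cf].
Qed.

Lemma closed_eqfun (f g : 'rV[R]_n -> R) :
  continuous f -> continuous g -> closed [set x | f x = g x].
Proof.
move=> cf cg.
have -> : [set x | f x = g x] = [set x | f x <= g x] `&` [set x | g x <= f x].
  apply/seteqP; split=> x /=; first by move=> ->.
  by move=> [h1 h2]; apply/eqP; rewrite eq_le h1 h2.
by apply: closedI; exact: closed_lefun.
Qed.

Lemma closed_forall (I : Type) (F : I -> set 'rV[R]_n) :
  (forall i, closed (F i)) -> closed [set x | forall i, F i x].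
Proof.
move=> h; have -> : [set x | forall i, F i x] = \bigcap_(i in setT) F i.
  by apply/seteqP; split=> x hx; [move=> i _; exact: hx|move=> i; exact: hx].
by apply: closed_bigI => i _.
Qed.

End Compactness.

(** * Elimination *)

Lemma fin_bound (R : realDomainType) (T : finType) (F : T -> R) :
  exists2 K, 0 <= K & forall t, F t <= K.
Proof.
exists (\sum_t `|F t|) => [|t]; first by apply: sumr_ge0.
by rewrite (bigD1 t) //= (le_trans (ler_norm _)) // lerDl sumr_ge0.
Qed.

Lemma poly_growth (R : realFieldType) (p : {poly R}) k (a : R) : 1 <= a ->
  (size p <= k.+1)%N -> `|p.[a]| <= (\sum_(i < size p) `|p`_i|) * a ^+ k.
Proof.
move=> a1 sp; rewrite horner_coef mulr_suml (le_trans (ler_norm_sum _ _ _)) //.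
apply: ler_sum => i _; rewrite normrM ler_wpM2l // normrX ger0_norm; last by lra.
by rewrite ler_weXn2l // -ltnS (leq_trans _ sp).
Qed.

Definition monv (R : realType) n (mu : multinom n) (x : 'rV[R]_n) : R :=
  \prod_i x 0 i ^+ mu i.

Definition peval2 (R : realType) n (p : mpoly n {poly R}) (a : R) (x : 'rV[R]_n) : R :=
  (meval (fun i => (x 0 i)%:P) p).[a].

Section Elimination.
Context {R : realType} {n m q : nat}.
Hypotheses (m0 : (0 < m)%N) (q0 : (0 < q)%N).
Variable r : 'I_n -> mpoly n {poly R}.
Hypotheses (r_deg : forall j, (mmeasure mdeg (r j) <= m.+1)%N)
  (r_top : forall j mu, mdeg mu = m -> (size (mcoeff mu (r j)) <= q)%N)
  (r_coef : forall j mu, (size (mcoeff mu (r j)) <= q.+1)%N).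

(** The hypotheses on [r] make the pure powers dominate for large [a]: a term of full degree [m]
    carries fewer than [q] powers of [a], a term of lower degree at most [q]. *)
Let solution a (x : 'rV[R]_n) :=
  forall j, a ^+ q * x 0 j ^+ m + peval2 (r j) a x = 0.

(** Monomials of degree at most [n (m - 1) + 1]. A reduced monomial, with all exponents below [m],
    has degree at most [n (m - 1)], so its product with any variable stays in [T]. *)
Let T : finType := bmultinom n (n * m.-1).+2.
Let reduced (mu : multinom n) := [forall i, (mu i < m)%N].
Let J : finType := {mu in [pred mu : T | ~~ reduced mu]}.
Let B : finType := {mu in [pred mu : T | reduced mu]}.

Let Jm (b : J) : multinom n := (val b : T).
Let Bm (b : B) : multinom n := (val b : T).
Let ej (i : 'I_#|J|) : J := enum_val i.
Let eb (i : 'I_#|B|) : B := enum_val i.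

Lemma nonreduced_big (b : J) : exists i : 'I_n, (m <= Jm b i)%N.
Proof.
have /forallPn[i] := valP b; rewrite -leqNgt => h; by exists i.
Qed.

Let big_index (b : J) : 'I_n := xchoose (nonreduced_big b).
Let shift (b : J) : multinom n := mnm_sub (Jm b) (mnm_muln (mnm1 (big_index b)) m).

Lemma shiftK b : mnm_add (mnm_muln (mnm1 (big_index b)) m) (shift b) = Jm b.
Proof.
rewrite addmC submK //; apply/mnm_lepP => i; rewrite mulmnE mnm1E.
by case: eqP => [<-|//]; rewrite mul1n; exact: (xchooseP (nonreduced_big b)).
Qed.

Lemma mdeg_shift b : mdeg (Jm b) = (m + mdeg (shift b))%N.
Proof. by rewrite -shiftK mdegD mdegMn mdeg1 mul1n. Qed.

(** The equation whose pure power divides the monomial [b], multiplied by the complementary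
    monomial. It expresses [a ^ q] times [b] through monomials of no larger degree, as in Macaulay's
    resultant. *)
Let row_poly (b : J) : mpoly n {poly R} := r (big_index b) * mpolyX _ (shift b).

Lemma row_coef b mu : mcoeff mu (row_poly b) != 0 ->
  exists2 nu, mu = mnm_add (shift b) nu & mcoeff mu (row_poly b) = mcoeff nu (r (big_index b)) /\
    nu \in msupp (r (big_index b)).
Proof.
rewrite -mcoeff_msupp (perm_mem (msuppMX _ _)) => /mapP[nu nur muE]; exists nu => //.
by rewrite muE mcoeffMX.
Qed.

Lemma row_size b mu : (size (mcoeff mu (row_poly b)) <= q.+1)%N.
Proof.
have [->|/row_coef[nu _ [-> _]]] := eqVneq (mcoeff mu (row_poly b)) 0; last exact: r_coef.
by rewrite size_poly0.
Qed.

Lemma row_size_top b mu : mdeg mu = mdeg (Jm b) -> (size (mcoeff mu (row_poly b)) <= q)%N.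
Proof.
have [->|/row_coef[nu muE [-> _]]] := eqVneq (mcoeff mu (row_poly b)) 0.
  by rewrite size_poly0.
by rewrite muE mdegD mdeg_shift => h; apply: r_top; lia.
Qed.

Lemma row_deg b mu : mcoeff mu (row_poly b) != 0 -> (mdeg mu <= mdeg (Jm b))%N.
Proof.
move=> /row_coef[nu -> [_ /msize_mdeg_lt h]]; rewrite mdegD mdeg_shift.
by have := r_deg (big_index b); lia.
Qed.

Let A : 'M[{poly R}]_#|J| := \matrix_(i, j)
  ('X^q *+ (i == j) + mcoeff (Jm (ej j)) (row_poly (ej i))).
Let C : 'M[{poly R}]_(#|J|, #|B|) := \matrix_(i, j)
  mcoeff (Bm (eb j)) (row_poly (ej i)).

(** For one large value of [a] the matrix is diagonally dominant once the monomials are weighted by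
    a power of [1 / a] equal to their degree, so it has no kernel there. *)
Lemma det_A_neq0 : \det A != 0.
Proof.
apply/eqP => dA.
have [K K0 hK] := fin_bound (fun bg : J * J =>
  \sum_(i < size (mcoeff (Jm bg.2) (row_poly bg.1))) `|(mcoeff (Jm bg.2) (row_poly bg.1))`_i|).
set c := #|J|%:R * K.
have c0 : 0 <= c by rewrite mulr_ge0.
pose a := 2 * c + 2; pose w := a^-1.
have a2 : 2 <= a by rewrite /a; lra.
have a0 : 0 < a by lra.
have w0 : 0 < w by rewrite invr_gt0.
have w1 : w <= 1 by rewrite invf_le1 //; lra.
have a1 : 1 <= a by lra.
have /det0P[v v0 vA] : \det (map_mx (horner_eval a) A^T) == 0.
  by rewrite det_map_mx det_tr dA rmorph0.
have [i0 vi0] : exists i, v 0 i != 0 by apply/rV0Pn.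
pose dg i := mdeg (Jm (ej i)).
(* The row examined is the one where the weighted kernel vector is largest. *)
pose h i := `|v 0 i| * w ^+ dg i.
have := @arg_maxP _ _ _ i0 xpredT h isT; case: arg_maxP => // i _ hi _.
have hi0 : 0 < h i by rewrite (lt_le_trans _ (hi i0 isT)) // mulr_gt0 ?normr_gt0 // exprn_gt0.
have E : \sum_j v 0 j * (A i j).[a] = 0.
  by move/rowP: vA => /(_ i); rewrite !mxE => {2}<-; apply: eq_bigr => j _; rewrite !mxE.
have E2 : v 0 i * a ^+ q = - \sum_j v 0 j * (mcoeff (Jm (ej j)) (row_poly (ej i))).[a].
  apply/eqP; rewrite -addr_eq0 -[X in _ == X]E; apply/eqP.
  have -> : v 0 i * a ^+ q = \sum_j v 0 j * ('X^q *+ (i == j)).[a].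
    rewrite (bigD1 i) //= eqxx mulr1n hornerXn big1 ?addr0 // => j ji.
    by rewrite eq_sym (negbTE ji) mulr0n horner0 mulr0.
  by rewrite -big_split; apply: eq_bigr => j _; rewrite /= mxE hornerD mulrDr.
(* A column of equal degree gains a factor [w] because its coefficient has fewer than [q] powers of
   [a], a column of smaller degree because of its weight. A column of larger degree does not occur
   in the row. *)
have bnd j : `|v 0 j * (mcoeff (Jm (ej j)) (row_poly (ej i))).[a]| * w ^+ dg i
     <= K * (a ^+ q * w) * h i.
  set z := mcoeff _ _.
  have [z0|z0] := eqVneq z 0.
    by rewrite z0 horner0 mulr0 normr0 mul0r !mulr_ge0 ?exprn_ge0 ?(ltW a0) ?(ltW w0) ?(ltW hi0).
  have dle : (dg j <= dg i)%N by exact: row_deg.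
  have hKz : \sum_(i < size z) `|z`_i| <= K by exact: (hK (ej i, ej j)).
  have hj : `|v 0 j| * w ^+ dg i = h j * w ^+ (dg i - dg j).
    by rewrite /h -mulrA -exprD subnKC.
  rewrite normrM mulrAC hj.
  have hjle := hi j isT.
  have hj0 : 0 <= h j by rewrite mulr_ge0 // exprn_ge0 // ltW.
  have [e|ne] := eqVneq (dg j) (dg i).
    have sz : (size z <= q.-1.+1)%N by rewrite prednK // row_size_top.
    rewrite e subnn expr0 mulr1 mulrC ler_pM //.
    rewrite (le_trans (poly_growth a1 sz)) // -{2}(prednK q0) exprS mulrAC mulfV ?gt_eqF // mul1r.
    by rewrite ler_wpM2r // exprn_ge0 // ltW.
  have sz : (size z <= q.+1)%N by exact: row_size.
  have pw : w ^+ (dg i - dg j) <= w.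
    have lt : (0 < dg i - dg j)%N by rewrite subn_gt0 ltn_neqAle ne.
    by rewrite -(prednK lt) exprS ler_piMr ?(ltW w0) // exprn_ile1 // ltW.
  have := poly_growth a1 sz => hz.
  have hz2 : `|z.[a]| <= K * a ^+ q.
    by rewrite (le_trans hz) // ler_wpM2r // exprn_ge0 // ltW.
  have -> : K * (a ^+ q * w) * h i = h i * w * (K * a ^+ q) by ring.
  have wp : 0 <= w ^+ (dg i - dg j) by rewrite exprn_ge0 // ltW.
  have l1 : h j * w ^+ (dg i - dg j) <= h i * w by exact: ler_pM.
  have l0 : 0 <= h j * w ^+ (dg i - dg j) by exact: mulr_ge0.
  exact: (ler_pM l0 (normr_ge0 _) l1 hz2).
have S : a ^+ q * h i <= #|J|%:R * (K * (a ^+ q * w) * h i).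
  have -> : a ^+ q * h i = `|v 0 i * a ^+ q| * w ^+ dg i.
    by rewrite normrM normrX (gtr0_norm a0) /h mulrA [a ^+ q * _]mulrC.
  rewrite E2 normrN (le_trans (ler_wpM2r _ (ler_norm_sum _ _ _))) ?exprn_ge0 ?(ltW w0) //.
  rewrite mulr_suml (le_trans (ler_sum _ (fun j _ => bnd j))) //.
  by rewrite sumr_const card_ord mulr_natl.
have : 1 <= c * w.
  have P0 : 0 < a ^+ q * h i by rewrite mulr_gt0 // exprn_gt0.
  rewrite -(ler_pM2l P0) mulr1 (le_trans S) // /c.
  by rewrite le_eqVlt; apply/orP; left; apply/eqP; ring.
by rewrite ler_pdivlMr // mul1r /a; lra.
Qed.

Lemma monvD (x : 'rV[R]_n) mu nu : monv (mnm_add mu nu) x = monv mu x * monv nu x.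
Proof. by rewrite /monv -big_split; apply: eq_bigr => i _; rewrite mnmE exprD. Qed.

Lemma peval2_sum (p : mpoly n {poly R}) k a x : (mmeasure mdeg p <= k)%N ->
  peval2 p a x = \sum_(mu : bmultinom n k) (mcoeff mu p).[a] * monv mu x.
Proof.
move=> h; rewrite /peval2 {1}(mpolywE h) raddf_sum horner_sum; apply: eq_bigr => mu _ /=.
rewrite mevalZ hornerM mevalX; congr (_ * _).
by rewrite horner_prod /monv; apply: eq_bigr => i _; rewrite horner_exp hornerC.
Qed.

Let XJ (x : 'rV[R]_n) : 'cV[R]_#|J| := \col_i monv (Jm (ej i)) x.
Let XB (x : 'rV[R]_n) : 'cV[R]_#|B| := \col_i monv (Bm (eb i)) x.

Lemma row_deg_le b : (mmeasure mdeg (row_poly b) <= (n * m.-1).+2)%N.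
Proof.
rewrite msizeE; apply/bigmax_leqP_seq => mu; rewrite mcoeff_msupp => h _.
apply: (leq_ltn_trans (row_deg h)).
exact: bmdeg.
Qed.

Lemma sum_split (F : T -> R) :
  \sum_mu F mu = \sum_(i < #|J|) F (val (ej i)) + \sum_(i < #|B|) F (val (eb i)).
Proof.
have e (U : finType) (G : U -> R) : \sum_u G u = \sum_(i < #|U|) G (enum_val i).
  by rewrite -(big_enum_val (A := U) G).
rewrite (bigID (fun mu : T => reduced mu)) /= addrC; congr (_ + _).
  by rewrite -(e J (fun b => F (val b))) (big_sub [pred mu : T | ~~ reduced mu]).
by rewrite -(e B (fun b => F (val b))) (big_sub [pred mu : T | reduced mu]).
Qed.

Lemma solution_row a x : solution a x ->
  map_mx (horner_eval a) A *m XJ x = - (map_mx (horner_eval a) C *m XB x).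
Proof.
move=> sol; apply/eqP; rewrite -subr_eq0 opprK; apply/eqP/matrixP => i k.
rewrite (ord1 k) mxE [X in X + _]mxE [X in _ + X]mxE [RHS]mxE.
have -> : \sum_j map_mx (horner_eval a) A i j * XJ x j 0 =
    a ^+ q * monv (Jm (ej i)) x +
    \sum_j (mcoeff (Jm (ej j)) (row_poly (ej i))).[a] * monv (Jm (ej j)) x.
  have -> : a ^+ q * monv (Jm (ej i)) x =
      \sum_j ('X^q *+ (i == j)).[a] * monv (Jm (ej j)) x.
    rewrite (bigD1 i) //= eqxx mulr1n hornerXn big1 ?addr0 // => j ji.
    by rewrite eq_sym (negbTE ji) mulr0n horner0 mul0r.
  rewrite -big_split; apply: eq_bigr => j _ /=.
  by rewrite !mxE /horner_eval hornerD mulrDl.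
have -> : \sum_j map_mx (horner_eval a) C i j * XB x j 0 =
    \sum_j (mcoeff (Bm (eb j)) (row_poly (ej i))).[a] * monv (Bm (eb j)) x.
  by apply: eq_bigr => j _; rewrite !mxE.
rewrite -addrA -(sum_split (fun mu => (mcoeff mu (row_poly (ej i))).[a] * monv mu x)).
rewrite -(peval2_sum _ _ (row_deg_le _)) -(shiftK (ej i)) monvD.
have -> : peval2 (row_poly (ej i)) a x =
    peval2 (r (big_index (ej i))) a x * monv (shift (ej i)) x.
  rewrite /peval2 /row_poly mevalM hornerM mevalX; congr (_ * _).
  by rewrite horner_prod /monv; apply: eq_bigr => j _; rewrite horner_exp hornerC.
rewrite mulrA -mulrDl.
have -> : monv (mnm_muln (mnm1 (big_index (ej i))) m) x = x 0 (big_index (ej i)) ^+ m.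
  rewrite /monv (bigD1 (big_index (ej i))) //= big1 ?mulr1.
    by rewrite mulmnE mnm1E eqxx mul1n.
  by move=> j ji; rewrite mulmnE mnm1E eq_sym (negbTE ji) mul0n expr0.
by rewrite sol mul0r.
Qed.

Lemma card_B : (#|B| <= m ^ n)%N.
Proof.
have -> : (m ^ n = #|{ffun 'I_n -> 'I_m}|)%N by rewrite card_ffun !card_ord.
pose f (b : B) : {ffun 'I_n -> 'I_m} := [ffun i => insubd (Ordinal m0) (Bm b i)].
apply: (@leq_card _ _ f) => b c /ffunP fbc; apply/val_inj/val_inj/mnmP => i.
have := fbc i; rewrite !ffunE => /(congr1 val); rewrite !val_insubd.
have hb (d : B) : (Bm d i < m)%N by have /forallP := valP d; apply.
by rewrite !hb.
Qed.

Lemma reduced_deg (b : B) : (mdeg (Bm b) <= n * m.-1)%N.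
Proof.
have -> : (n * m.-1 = \sum_(i < n) m.-1)%N by rewrite sum_nat_const card_ord.
rewrite mdegE; apply: leq_sum => i _; have /forallP/(_ i) : reduced (Bm b) by exact: (valP b).
by rewrite /=; move: m0; lia.
Qed.

Lemma card_B_gt0 : (0 < #|B|)%N.
Proof.
have d0 : (mdeg (mnm0 : multinom n) < (n * m.-1).+2)%N by rewrite mdeg0.
have r0 : reduced (BMultinom d0) by apply/forallP => i; rewrite /= mnm0E.
by apply/card_gt0P; exists (Sub (BMultinom d0) r0).
Qed.

(** The reduced monomials behave like a basis of the quotient ring: multiplication by [x_i], scaled
    by [\det A], acts on their values by a matrix polynomial in [a]. Hence [\det A] times [x_i] is
    an eigenvalue, and the characteristic polynomial has degree at most [m ^ n] in [x_i]. It is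
    nonzero because [\det A] is. *)
Lemma elimination (i : 'I_n) : exists2 P : {poly {poly R}},
  P != 0 /\ (size P <= (m ^ n).+1)%N &
  forall a x, solution a x -> bieval P a (x 0 i) = 0.
Proof.
pose next (b : B) : multinom n := mnm_add (mnm1 i) (Bm b).
pose S1 : 'M[{poly R}]_#|B| := \matrix_(k, l) (next (eb k) == Bm (eb l))%:R.
pose S2 : 'M[{poly R}]_(#|B|, #|J|) := \matrix_(k, l) (next (eb k) == Jm (ej l))%:R.
(* [S1] and [S2] record whether the product of a reduced monomial with [x_i] is reduced or not; in
   the second case the adjugate of [A] rewrites it through reduced monomials. *)
pose M := \det A *: S1 - S2 *m \adj A *m C.
pose P := char_poly M \Po (\det A *: 'X).
have sP : (size P).-1 = #|B|.
  rewrite size_comp_poly size_char_poly /= size_scale ?det_A_neq0 // size_polyX /=.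
  by rewrite muln1.
have P0 : P != 0.
  apply/eqP => e; move: sP card_B_gt0; rewrite e size_poly0 => <-; exact.
exists P; first by split=> //; rewrite (leq_trans (leqSpred _)) // ltnS sP card_B.
move=> a x sol.
have step : x 0 i *: XB x = map_mx (horner_eval a) S1 *m XB x + map_mx (horner_eval a) S2 *m XJ x.
  apply/matrixP => k z; rewrite (ord1 z) mxE [XB x k 0]mxE [RHS]mxE [X in _ = X + _]mxE [X in _ = _ + X]mxE.
  have dn : (mdeg (next (eb k)) < (n * m.-1).+2)%N.
    by rewrite mdegD mdeg1 add1n ltnS ltnS reduced_deg.
  have -> : x 0 i * monv (Bm (eb k)) x = \sum_(mu : T) (next (eb k) == mu)%:R * monv mu x.
    rewrite (bigD1 (BMultinom dn)) //= eqxx mul1r big1 ?addr0.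
      rewrite monvD; congr (_ * _); rewrite /monv (bigD1 i) //= mnm1E eqxx expr1 big1 ?mulr1 //.
      by move=> j ji; rewrite mnm1E eq_sym (negbTE ji) expr0.
    move=> mu; rewrite eq_sym -(inj_eq val_inj) /= => /negbTE h.
    by rewrite h mul0r.
  rewrite sum_split addrC; congr (_ + _); apply: eq_bigr => l _; rewrite !mxE /horner_eval;
    by rewrite -[RHS]/(_ * _); congr (_ * _); case: (_ == _); rewrite ?hornerC.
have key : map_mx (horner_eval a) M *m XB x = ((\det A).[a] * x 0 i) *: XB x.
  rewrite -scalerA step scalerDr map_mxB map_mxZ mulmxBl -scalemxAl; congr (_ + _).
  rewrite !map_mxM -!mulmxA -2!mulmxN -(solution_row sol).
  rewrite [X in _ *m X]mulmxA -map_mxM mul_adj_mx map_scalar_mx mul_scalar_mx.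
  by rewrite -scalemxAr.
(* The constant monomial is reduced, so one entry is [1]. *)
have XB0 : XB x != 0.
  have d0 : (mdeg (mnm0 : multinom n) < (n * m.-1).+2)%N by rewrite mdeg0.
  have r0 : reduced (BMultinom d0) by apply/forallP => j; rewrite /= mnm0E.
  pose b0 : B := Sub (BMultinom d0) r0.
  apply/eqP => /matrixP/(_ (enum_rank b0) 0); rewrite !mxE /eb enum_rankK /Bm /=.
  by rewrite /monv big1 => [/eqP|j _]; rewrite ?oner_eq0 // mnm0E expr0.
have eig : eigenvalue (map_mx (horner_eval a) M)^T ((\det A).[a] * x 0 i).
  apply/eigenvalueP; exists (XB x)^T; first by rewrite -trmx_mul key linearZ.
  by rewrite trmx_eq0.
have ctr (U : 'M[R]_#|B|) : char_poly U^T = char_poly U.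
  by rewrite /char_poly /char_poly_mx -det_tr linearB /= tr_scalar_mx map_trmx trmxK.
move: eig; rewrite eigenvalue_root_char ctr -map_char_poly => /rootP h.
rewrite /bieval horner_comp hornerZ hornerX -[LHS]/(horner_eval a _) -horner_map /=.
by rewrite /horner_eval hornerM hornerC.
Qed.

End Elimination.

(** * Derivatives of polynomials and elimination over the reals *)

Section PolynomialEvaluation.
Context {R : realType} {n : nat}.
Implicit Types (p q : mpoly n R) (x : 'rV[R]_n).

Lemma pevalD p q x : peval (p + q) x = peval p x + peval q x.
Proof. exact: mevalD. Qed.

Lemma pevalN p x : peval (- p) x = - peval p x.
Proof. exact: mevalN. Qed.

Lemma pevalB p q x : peval (p - q) x = peval p x - peval q x.
Proof. exact: mevalB. Qed.

Lemma pevalM p q x : peval (p * q) x = peval p x * peval q x.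
Proof. exact: mevalM. Qed.

Lemma pevalZ c p x : peval (c *: p) x = c * peval p x.
Proof. exact: mevalZ. Qed.

Lemma pevalC c x : peval (mpolyC n c) x = c.
Proof. exact: mevalC. Qed.

Lemma pevalXU i x : peval (mpolyX R (mnm1 i)) x = x 0 i.
Proof. exact: mevalXU. Qed.

Lemma pevalX p k x : peval (p ^+ k) x = peval p x ^+ k.
Proof. by rewrite /peval rmorphXn. Qed.

Lemma pevalsum (I : Type) (r : seq I) (F : I -> mpoly n R) x :
  peval (\sum_(i <- r) F i) x = \sum_(i <- r) peval (F i) x.
Proof. by rewrite /peval raddf_sum. Qed.

Lemma mderivXU i j : mderiv i (mpolyX R (mnm1 j)) = mpolyC n (i == j)%:R.
Proof.
rewrite mderivX mnmE eq_sym; case: eqP => [->|_]; last by rewrite scale0r mpolyC0.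
by rewrite scale1r (_ : mnm_sub _ _ = mnm0) ?mpolyX0 //; apply/mnmP => k; rewrite !mnmE subnn.
Qed.

Lemma peval0 x : peval 0 x = 0.
Proof. exact: meval0. Qed.

Lemma mderivXB i j c : mderiv i (mpolyX R (mnm1 j) - mpolyC n c) = mpolyC n (i == j)%:R.
Proof. by rewrite mderivB mderivXU mderivC subr0. Qed.

Lemma mderivXn i p k : mderiv i (p ^+ k) = k%:R *: (p ^+ k.-1 * mderiv i p).
Proof.
elim: k => [|[|k] IH]; first by rewrite expr0 scale0r -mpolyC1 mderivC.
  by rewrite !expr1 expr0 mul1r scale1r.
rewrite exprS mderivM IH /= -[k.+2]addn1 natrD scalerDl scale1r [RHS]addrC.
congr (_ + _); first by rewrite mulrC.
by rewrite -!mul_mpolyC mulrCA [p * _]mulrA -exprS.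
Qed.

Lemma mderiv_sum (I : Type) (r : seq I) i (F : I -> mpoly n R) :
  mderiv i (\sum_(k <- r) F k) = \sum_(k <- r) mderiv i (F k).
Proof. by rewrite raddf_sum. Qed.

Lemma msize_mderiv D p i : (mmeasure mdeg p <= D.+1)%N -> (mmeasure mdeg (mderiv i p) <= D.-1.+1)%N.
Proof.
move=> sp; rewrite msizeE; apply/bigmax_leqP_seq => mu.
rewrite mcoeff_msupp mcoeff_mderiv => h _; have : mnm_add mu (mnm1 i) \in msupp p.
  by rewrite mcoeff_msupp; apply: contra_neq h => ->; rewrite mul0rn.
by move=> /msize_mdeg_lt; rewrite mdegD mdeg1; lia.
Qed.

Lemma pfun_mderiv D p i : (mmeasure mdeg p <= D.+1)%N -> pfun D.-1 (peval (mderiv i p)).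
Proof. by move=> sp; exists (mderiv i p) => //; exact: msize_mderiv. Qed.

End PolynomialEvaluation.

(** Allows an equation [x_j = c] on a face to be written as [(x_j - c) ^ m = 0], whose leading power
    is pure as elimination requires. *)
Lemma pfun_powB (R : realType) n m (i : 'I_n) (c : R) :
  pfun m.-1 (fun x : 'rV[R]_n => (x 0 i - c) ^+ m - x 0 i ^+ m).
Proof.
apply: (@pfun_ext _ _ _ (fun x => (- c) *
    \sum_(k <- index_enum 'I_m) (x 0 i - c) ^+ (m.-1 - k) * x 0 i ^+ k)).
  move=> x; rewrite subrXX (_ : x 0 i - c - x 0 i = - c); last by ring.
  by congr (_ * _); apply: eq_bigr => k _; congr (_ ^+ _ * _); lia.
rewrite -[X in pfun X]add0n; apply: pfunM; first exact: pfun_const.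
apply: pfun_sum => k.
have -> : (m.-1 = (m.-1 - k) * 1 + k * 1)%N by have := ltn_ord k; lia.
apply: pfunM; last by apply: pfunX; exact: pfun_coord.
have -> : ((m.-1 - k) * 1 + k * 1 - k = m.-1 - k)%N by lia.
by apply: pfunX; apply: pfunB; [exact: pfun_coord|exact: pfun_const].
Qed.

(** The degrees are arranged so that [a ^ q] multiplies only terms of degree below [m] besides the
    pure power. For [q = 1] a term [a phi1] of degree [m] would compete with it, whence the side
    condition. *)
Lemma elimination_real (R : realType) n m q (phi0 phi1 phi2 : 'I_n -> 'rV[R]_n -> R) :
  (0 < m)%N -> (0 < q)%N ->
  (forall j, pfun m (phi0 j)) -> (forall j, pfun m (phi1 j)) -> (forall j, pfun m.-1 (phi2 j)) ->
  (q = 1%N -> forall j x, phi1 j x = 0) ->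
  forall i : 'I_n, exists2 P : {poly {poly R}}, P != 0 /\ (size P <= (m ^ n).+1)%N &
  forall a (x : 'rV[R]_n), (forall j, a ^+ q * x 0 j ^+ m + (phi0 j x + a * phi1 j x + a ^+ q * phi2 j x) = 0) ->
    bieval P a (x 0 i) = 0.
Proof.
move=> m0 q0 h0 h1 h2 q1 i.
have /fin_all_exists2[p0 sp0 p0E] j : exists2 p : mpoly n R, (mmeasure mdeg p <= m.+1)%N &
  phi0 j =1 peval p by have [p sp pE] := h0 j; exists p.
have /fin_all_exists2[p2 sp2 p2E] j : exists2 p : mpoly n R, (mmeasure mdeg p <= m)%N &
  phi2 j =1 peval p by have [p sp pE] := h2 j; exists p => //; rewrite -(prednK m0).
have /fin_all_exists2[p1 sp1 p1E] j : exists2 p : mpoly n R, (mmeasure mdeg p <= m.+1)%N /\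
    (q = 1%N -> p = 0) & phi1 j =1 peval p.
  have [e|/eqP qn1] := eqVneq q 1%N.
    exists 0; first by rewrite mmeasure0.
    by move=> x; rewrite (q1 e) /peval meval0.
  by have [p sp pE] := h1 j; exists p.
pose r j : mpoly n {poly R} := map_mpoly polyC (p0 j) + mpolyC n 'X * map_mpoly polyC (p1 j) +
  mpolyC n 'X^q * map_mpoly polyC (p2 j).
have rE j mu : mcoeff mu (r j) = (mcoeff mu (p0 j))%:P + 'X * (mcoeff mu (p1 j))%:P +
    'X^q * (mcoeff mu (p2 j))%:P.
  rewrite /r mcoeffD mcoeffD [X in _ + X + _ = _]mcoeffCM [X in _ + _ + X = _]mcoeffCM.
  congr (_ + _ * _ + _ * _); exact: mcoeff_map_mpoly.
have big0 (p : mpoly n R) k mu : (mmeasure mdeg p <= k)%N -> (k <= mdeg mu)%N -> mcoeff mu p = 0.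
  by move=> sp kmu; apply/eqP; rewrite mcoeff_eq0 msize_mdeg_ge // (leq_trans sp).
have s0 j mu : (size (mcoeff mu (p0 j))%:P <= q)%N by rewrite (leq_trans (size_polyC_leq1 _)).
have s1 j mu : (size ('X * (mcoeff mu (p1 j))%:P)%R <= q)%N.
  have [e|ne] := eqVneq q 1%N.
    by have [_ ->//] := sp1 j; rewrite mcoeff0 polyC0 mulr0 size_poly0.
  rewrite (leq_trans (size_polyMleq _ _)) // size_polyX; have := size_polyC_leq1 (mcoeff mu (p1 j)).
  by move: ne q0; lia.
have s2 j mu : (size ('X^q * (mcoeff mu (p2 j))%:P)%R <= q.+1)%N.
  rewrite (leq_trans (size_polyMleq _ _)) // size_polyXn; have := size_polyC_leq1 (mcoeff mu (p2 j)).
  by lia.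
have [|||P [P0 sP] hP] := @elimination R n m q m0 q0 r _ _ _ i.
- move=> j; rewrite msizeE; apply/bigmax_leqP_seq => mu; rewrite mcoeff_msupp rE => h _.
  rewrite ltnNge; apply: contra_neqN h => hmu.
  rewrite (big0 _ _ _ (sp0 j) hmu) (big0 _ _ _ (sp1 j).1 hmu) (big0 _ _ _ (sp2 j)) ?(ltnW hmu) //.
  by rewrite polyC0 !mulr0 !addr0.
- move=> j mu hmu; rewrite rE [mcoeff mu (p2 j)](big0 _ _ _ (sp2 j)) ?hmu //.
  rewrite polyC0 mulr0 addr0 (leq_trans (size_polyD _ _)) // geq_max s0 s1 //.
- move=> j mu; rewrite rE (leq_trans (size_polyD _ _)) // geq_max s2 andbT.
  by rewrite (leq_trans (size_polyD _ _)) // geq_max (leqW (s0 _ _)) (leqW (s1 _ _)).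
exists P => // a x hx; apply: hP => j; rewrite -[RHS](hx j); congr (_ + _).
have mE (p : mpoly n R) : (meval (fun i => (x 0 i)%:P) (map_mpoly polyC p)) = (peval p x)%:P.
  rewrite mevalE peval_sum raddf_sum /=.
  rewrite (perm_big (msupp p)) /=; last first.
    by apply: msupp_map_mpoly; exact: polyC_inj.
  apply: eq_bigr => mu _; rewrite mcoeff_map_mpoly rmorphM rmorph_prod /=; congr (_ * _).
  by apply: eq_bigr => k _; rewrite rmorphXn.
rewrite /peval2 /r mevalD mevalD [X in (_ + X + _).[_]]mevalM [X in (_ + _ + X).[_]]mevalM.
rewrite [X in (_ + X * _ + _).[_]]mevalC [X in (_ + _ + X * _).[_]]mevalC.
rewrite [X in (X + _ + _).[_]]mE [X in (_ + _ * X + _).[_]]mE [X in (_ + _ + _ * X).[_]]mE.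
rewrite 2!hornerD 2!hornerM hornerX hornerXn 3!hornerC.
by rewrite p0E p1E p2E.
Qed.

(** One constant serves as radius and as coefficient, so that shrinking it preserves the statement
    and finitely many instances can share it. *)
Lemma newton_bound1 (R : realFieldType) (P : {poly {poly R}}) (x0 : R) E :
  P != 0 -> (size P <= E.+1)%N ->
  exists2 d, 0 < d & forall a s, 0 < a -> a < d -> `|s - x0| < d ->
    bieval P a s = 0 -> d * `|s - x0| ^+ E <= a.
Proof.
move=> P0 sP; have [C [d [C0 d0 hd]]] := newton_bound x0 P0.
exists (Order.min (Order.min d 1) C^-1); first by rewrite !lt_min d0 ltr01 invr_gt0.
move=> a s a0; rewrite !lt_min => /andP[/andP[ad a1] aC] /andP[/andP[sd s1] sC] e.
have h := hd _ _ a0 ad sd e.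
have le : `|s - x0| ^+ E <= C * a.
  apply: le_trans h; have hE : ((size P).-1 <= E)%N by rewrite -subn1 leq_subLR add1n.
  by rewrite -(subnK hE) exprD ler_piMl ?exprn_ge0 // exprn_ile1 // ltW.
apply: (@le_trans _ _ (C^-1 * `|s - x0| ^+ E)).
  by rewrite ler_wpM2r ?exprn_ge0 // ge_min lexx orbT.
by rewrite mulrC ler_pdivrMr // mulrC.
Qed.

Lemma fin_unif (R : realFieldType) (T : finType) (Q : T -> R -> Prop) :
  (forall t d d', 0 < d' -> d' <= d -> Q t d -> Q t d') ->
  (forall t, exists2 d, 0 < d & Q t d) -> exists2 d, 0 < d & forall t, Q t d.
Proof.
move=> mono /fin_all_exists2[d d0 hd]; have [K K0 hK] := fin_bound (fun t => (d t)^-1).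
exists (K + 1)^-1 => [|t]; first by rewrite invr_gt0 ltr_wpDl.
apply: mono (hd t); first by rewrite invr_gt0 ltr_wpDl.
rewrite -[leRHS]invrK lef_pV2 ?posrE ?invr_gt0 ?ltr_wpDl ?d0 //.
by rewrite (le_trans (hK t)) // lerDl.
Qed.

(** * Isolated zeros on a box *)

Definition box (R : realType) n (lo hi x : 'rV[R]_n) : Prop :=
  forall i, lo 0 i <= x 0 i /\ x 0 i <= hi 0 i.

Section Boxes.
Context {R : realType} {n : nat}.
Implicit Types (lo hi x y z : 'rV[R]_n).

Lemma box_norm lo hi x : box lo hi x -> `|x| <= `|lo| + `|hi|.
Proof.
move=> hx; apply: norm_le_coord => [|i]; first exact: addr_ge0.
have := coord_le_norm lo i; have := coord_le_norm hi i; have [h1 h2] := hx i.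
by rewrite !ler_norml => /andP[a b] /andP[c d]; apply/andP; split; lra.
Qed.

Lemma closed_box lo hi : closed [set x | box lo hi x].
Proof.
apply: (@closed_forall _ _ _ (fun i => [set x | lo 0 i <= x 0 i] `&` [set x | x 0 i <= hi 0 i])) => i.
have ci : continuous (fun x : 'rV[R]_n => x 0 i) by exact: coord_continuous.
have cc (c : R) : continuous (fun x : 'rV[R]_n => c) by exact: cst_continuous.
by apply: closedI; [exact: (closed_lefun (cc _) ci)|exact: (closed_lefun ci (cc _))].
Qed.

Lemma compact_boxI lo hi (A : set 'rV[R]_n) : closed A -> compact ([set x | box lo hi x] `&` A).
Proof.
move=> cA; apply: (@compact_box _ _ _ (`|lo| + `|hi|)); last by move=> x [/box_norm].
by apply: closedI => //; exact: closed_box.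
Qed.

Lemma normB_continuous z : continuous (fun x : 'rV[R]_n => `|x - z|).
Proof.
move=> x A /nbhs_ballP[e /= e0 hA]; apply/nbhs_ballP; exists e => // y.
rewrite -ball_normE /= => h; apply: hA; rewrite -ball_normE /=.
apply: le_lt_trans h; have := ler_dist_dist (x - z) (y - z).
by rewrite opprB addrA subrK.
Qed.

Lemma box_vary lo hi x i : box lo hi x -> x 0 i != lo 0 i -> x 0 i != hi 0 i ->
  exists2 e, 0 < e & forall h, `|h| < e -> box lo hi (upd x i (x 0 i + h)).
Proof.
move=> bx l u; have [xl xu] := bx i.
have {l}l : lo 0 i < x 0 i by rewrite lt_neqAle eq_sym l.
have {u}u : x 0 i < hi 0 i by rewrite lt_neqAle u.
exists (Order.min (x 0 i - lo 0 i) (hi 0 i - x 0 i)); first by rewrite lt_min !subr_gt0 l.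
move=> h; rewrite lt_min => /andP[]; rewrite !ltr_norml => /andP[h1 h2] /andP[h3 h4] j.
by rewrite updE; case: eqP => [->|_]; [split; lra|exact: bx].
Qed.

End Boxes.

(** On the box, [f + c V - c l] is minimised for each signed coordinate function [l] vanishing at
    [z]. Elimination bounds [l] at the minimiser by a root of [c] of order [E], and minimality then
    bounds [f] below at every point by [c] times nearly the value of [l] there. With [c] of order
    [|x - z| ^ E] this gives the exponent [E + 1]. *)
Lemma box_isolated (R : realType) n d (f : mpoly n R) (lo hi z : 'rV[R]_n) :
  (0 < d)%N -> (mmeasure mdeg f <= (2 * d).+1)%N -> box lo hi z ->
  (forall x, box lo hi x -> 0 <= peval f x) -> peval f z = 0 ->
  (forall x, box lo hi x -> peval f x = 0 -> x = z) ->
  exists2 C, 0 < C & forall x, box lo hi x ->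
    C * `|x - z| ^+ ((2 * d).-1 ^ n).+1 <= peval f x.
Proof.
move=> d0 sf bz f0 fz zuniq; set D := (2 * d)%N; set m := D.-1; set E := (m ^ n)%N.
have D2 : (1 < D)%N by rewrite /D; lia.
have m0 : (0 < m)%N by rewrite /m; lia.
have Dm : D = m.+1 by rewrite /m; lia.
have E0 : (0 < E)%N by rewrite expn_gt0 m0.
have fpos mu : 0 < mu -> exists2 c, 0 < c &
    forall x, box lo hi x -> mu <= `|x - z| -> c <= peval f x.
  move=> mu0; pose A : set 'rV[R]_n := [set x | mu <= `|x - z|].
  have cA : closed A.
    have cc : continuous (fun x : 'rV[R]_n => mu) by exact: cst_continuous.
    exact: closed_lefun cc (@normB_continuous _ _ z).
  have [[x [bx Ax]]|none] := pselect (([set x | box lo hi x] `&` A) !=set0).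
    have [c [bc Ac] hc] := compact_argmin (ex_intro _ x (conj bx Ax)) (compact_boxI (lo := lo) (hi := hi) cA)
      (@peval_continuous _ _ f).
    exists (peval f c) => [|y by_ Ay]; last by apply: hc.
    rewrite lt_neqAle f0 // andbT eq_sym; apply/eqP => /(zuniq _ bc) e.
    by move: Ac; rewrite /A /= e subrr normr0 leNgt mu0.
  exists 1 => // y by_ Ay; exfalso; apply: none; by exists y.
set M := `|lo| + `|hi| + `|z|.
have M0 : 0 <= M by rewrite !addr_ge0.
have bM x : box lo hi x -> `|x - z| <= M.
  by move=> /box_norm h; rewrite (le_trans (ler_normB _ _)) // lerD2r.
(* Normalised so that its partial derivatives are the pure powers [(x_j - z_j) ^ m], of the same
   degree as those of [f]. *)
pose V : mpoly n R := D%:R^-1 *: \sum_(j < n) (mpolyX R (mnm1 j) - mpolyC n (z 0 j)) ^+ D.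
have VE x : peval V x = D%:R^-1 * \sum_(j < n) (x 0 j - z 0 j) ^+ D.
  rewrite pevalZ pevalsum; congr (_ * _); apply: eq_bigr => j _.
  by rewrite pevalX pevalB pevalXU pevalC.
have dV x j : peval (mderiv j V) x = (x 0 j - z 0 j) ^+ m.
  rewrite mderivZ pevalZ mderiv_sum pevalsum (bigD1 j) //= big1 ?addr0.
    rewrite mderivXn mderivXB pevalZ pevalM pevalX pevalB pevalXU 2!pevalC eqxx.
    by rewrite mulr1 mulrA mulVf ?mul1r // pnatr_eq0 Dm.
  move=> k kj; rewrite mderivXn mderivXB eq_sym (negbTE kj).
  by rewrite mpolyC0 mulr0 scaler0 peval0.
have V0 x : 0 <= peval V x.
  rewrite VE mulr_ge0 ?invr_ge0 // sumr_ge0 // => j _.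
  by rewrite /D exprM exprn_ge0 // sqr_ge0.
have Vle x : `|x - z| <= 1 -> peval V x <= n%:R * `|x - z| ^+ 2.
  move=> x1; rewrite VE mulrC ler_pdivrMr ?ltr0n ?(ltnW D2) //.
  apply: (@le_trans _ _ (n%:R * `|x - z| ^+ 2)); last first.
    by rewrite ler_peMr ?mulr_ge0 ?exprn_ge0 // ler1n ltnW.
  rewrite -[X in X%:R]card_ord -sum1_card natr_sum mulr_suml; apply: ler_sum => j _.
  rewrite mul1r (le_trans (ler_norm _)) // normrX.
  have hj : `|x 0 j - z 0 j| <= `|x - z| by have := coord_le_norm (x - z) j; rewrite !mxE.
  apply: (@le_trans _ _ (`|x - z| ^+ D)); first by rewrite lerXn2r ?nnegrE.
  by rewrite -(subnK D2) exprD ler_piMl ?exprn_ge0 // exprn_ile1.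
pose sgn (b : bool) : R := (-1) ^+ b.
(* A face is coded by a value in ['I_3] for each coordinate: [0] for free, [1] for the lower side,
   [2] for the upper side. *)
pose fixed (s : 'I_3) j : R := if s == 1 then lo 0 j else hi 0 j.
pose T : finType := ('I_n * bool * {ffun 'I_n -> 'I_3})%type.
pose eqn (t : T) (c : R) (x : 'rV[R]_n) j :=
  if t.2 j == 0 then peval (mderiv j f) x + c * (x 0 j - z 0 j) ^+ m - c * sgn t.1.2 * (j == t.1.1)%:R
  else x 0 j - fixed (t.2 j) j.
(* There are finitely many faces, coordinates and signs, so one constant [k] serves all the
   eliminations. *)
have /fin_unif[|k k0 hk] (t : T) : exists2 k, 0 < k & forall c (x : 'rV[R]_n), 0 < c -> c < k ->
    `|x 0 t.1.1 - z 0 t.1.1| < k -> (forall j, eqn t c x j = 0) ->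
    k * `|x 0 t.1.1 - z 0 t.1.1| ^+ E <= c.
  pose phi0 j x := if t.2 j == 0 then peval (mderiv j f) x else 0.
  pose phi2 j (x : 'rV[R]_n) := if t.2 j == 0
    then (x 0 j - z 0 j) ^+ m - x 0 j ^+ m - sgn t.1.2 * (j == t.1.1)%:R
    else (x 0 j - fixed (t.2 j) j) ^+ m - x 0 j ^+ m.
  have [||||P [P0 sP] hP] := @elimination_real R n m 1 phi0 (fun _ _ => 0) phi2 m0 isT _ _ _ _ t.1.1.
  - move=> j; rewrite /phi0; case: eqP => _; last exact: pfun_const.
    by apply: (pfun_le _ (pfun_mderiv j sf)).
  - by move=> j; exact: pfun_const.
  - move=> j; rewrite /phi2; case: eqP => _; last exact: pfun_powB.
    by apply: pfunB; [exact: pfun_powB|exact: pfun_const].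
  - by [].
  have [k k0 hk] := newton_bound1 (z 0 t.1.1) P0 sP.
  exists k => // c x c0 ck xk hx; apply: hk => //; apply: hP => j.
  have := hx j; rewrite /eqn /phi0 /phi2; case: eqP => _ e.
    by rewrite -[RHS]e expr1; ring.
  rewrite (_ : _ + _ = c * (x 0 j - fixed (t.2 j) j) ^+ m); last by ring.
  by rewrite e expr0n gtn_eqF // mulr0.
- move=> t k k' k'0 k'k h c x c0 ck xk hx.
  apply: le_trans (h c x c0 (lt_le_trans ck k'k) (lt_le_trans xk k'k) hx).
  by rewrite ler_wpM2r ?exprn_ge0.
have [mu mu0 hmu] := fpos k k0.
(* [s] is the value of the signed coordinate function at the minimiser; it is nonnegative because
   the minimum is at most the value [0] taken at [z]. *)
have minim c t : 0 < c -> c < k -> c * M < mu -> exists2 s, k * s ^+ E <= c /\ 0 <= s &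
    forall y, box lo hi y -> c * (sgn t.2 * (y 0 t.1 - z 0 t.1) - s - peval V y) <= peval f y.
  case: t => i b /= c0 ck cmu.
  pose L : mpoly n R := sgn b *: (mpolyX R (mnm1 i) - mpolyC n (z 0 i)).
  have LE x : peval L x = sgn b * (x 0 i - z 0 i) by rewrite pevalZ pevalB pevalXU pevalC.
  pose H := f + c *: V - c *: L.
  have HE x : peval H x = peval f x + c * peval V x - c * (sgn b * (x 0 i - z 0 i)).
    by rewrite /H pevalB pevalD (pevalZ c V) (pevalZ c L) LE.
  have [x bx xmin] : exists2 x, box lo hi x & forall y, box lo hi y -> peval H x <= peval H y.
    have cpt := compact_boxI (lo := lo) (hi := hi) (@closedT 'rV[R]_n).
    have [x [bx _] hx] := compact_argmin (ex_intro _ z (conj bz I)) cpt (@peval_continuous _ _ H).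
    by exists x => // y by_; apply: hx.
  have Hz : peval H z = 0.
    rewrite HE fz subrr !mulr0 subr0 add0r VE big1 ?mulr0 // => j _.
    by rewrite subrr expr0n Dm.
  have xi : `|sgn b * (x 0 i - z 0 i)| = `|x 0 i - z 0 i|.
    by rewrite normrM /sgn normrX normrN1 expr1n mul1r.
  have xile : `|x 0 i - z 0 i| <= `|x - z| by have := coord_le_norm (x - z) i; rewrite !mxE.
  have le0 : peval f x + c * peval V x <= c * (sgn b * (x 0 i - z 0 i)).
    by have := xmin z bz; rewrite Hz HE; lra.
  have s0 : 0 <= sgn b * (x 0 i - z 0 i).
    rewrite -(pmulr_rge0 _ c0); apply: le_trans le0.
    by rewrite addr_ge0 ?f0 // mulr_ge0 // ltW.
  (* The root bound is local at [z]. At the minimiser [f] is at most [c M], too small for a point at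
     distance [k] or more. *)
  have xk : `|x - z| < k.
    rewrite ltNge; apply/negP => /(hmu _ bx) h.
    have : c * (sgn b * (x 0 i - z 0 i)) <= c * M.
      by rewrite ler_wpM2l ?(ltW c0) // (le_trans (ler_norm _)) // xi (le_trans xile) // bM.
    have : 0 <= c * peval V x by rewrite mulr_ge0 // ltW.
    by lra.
  exists (sgn b * (x 0 i - z 0 i)); last first.
    move=> y by_; have := xmin y by_; rewrite !HE => h.
    have : 0 <= peval f x + c * peval V x by rewrite addr_ge0 ?f0 // mulr_ge0 // ltW.
    rewrite !mulrBr; lra.
  split=> //.
  pose sg : {ffun 'I_n -> 'I_3} := [ffun j => if x 0 j == lo 0 j then 1 else if x 0 j == hi 0 j then inord 2 else 0].
  have := hk (i, b, sg) c x c0 ck (le_lt_trans xile xk).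
  rewrite /= -xi ger0_norm //; apply=> j; rewrite /eqn /fixed /= ffunE.
  have [e|nl] := eqVneq (x 0 j) (lo 0 j); first by rewrite /= e subrr.
  have [e|nu] := eqVneq (x 0 j) (hi 0 j).
    have i2 : (inord 2 : 'I_3) != 0 /\ (inord 2 : 'I_3) != 1 by split; rewrite -val_eqE /= inordK.
    by rewrite (negbTE i2.1) (negbTE i2.2) e subrr.
  rewrite eqxx; have [e e0 he] := box_vary bx nl nu.
  have := @slope_bound _ _ H x j 0 e (lexx _) e0.
  rewrite normr_le0 => /(_ _)/eqP <-.
    rewrite /H mderivB mderivD (mderivZ j c V) (mderivZ j c L) pevalB pevalD (pevalZ c (mderiv j V)) (pevalZ c (mderiv j L)) dV -mulrA; congr (_ - _ * _).
    rewrite /L mderivZ pevalZ mderivXB pevalC.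
    by [].
  by move=> h /he by_; rewrite mul0r subr0; exact: xmin.
(* Below [r1] the term [V] is at most a quarter of the distance, and the value of [c] chosen below
   is admissible for [minim]. *)
have [r1 r10 [r11 r1n r1mu]] : exists2 r1, 0 < r1 & [/\ r1 <= 1, r1 * n%:R <= 4^-1 & k * r1 * M < mu].
  have kM : 0 < 2 * (k * M + 1) by rewrite mulr_gt0 // ltr_wpDl // mulr_ge0 // ltW.
  have n4 : 0 < 4 * (n%:R + 1) :> R by rewrite mulr_gt0 // ltr_wpDl.
  exists (Order.min 1 (Order.min (4 * (n%:R + 1))^-1 (mu / (2 * (k * M + 1))))).
    by rewrite !lt_min ltr01 invr_gt0 n4 divr_gt0.
  set r1 := Order.min _ _.
  have r1n : r1 <= (4 * (n%:R + 1))^-1 by rewrite /r1 !ge_min lexx ?orbT.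
  have r1m : r1 <= mu / (2 * (k * M + 1)) by rewrite /r1 !ge_min lexx ?orbT.
  split; first by rewrite ge_min lexx.
    rewrite (le_trans (ler_wpM2r _ r1n)) // invfM -mulrA ler_piMr ?invr_ge0 //.
    by rewrite mulrC ler_pdivrMr ?mul1r ?lerDl // ltr_wpDl.
  have kM0 : 0 <= k * M by rewrite mulr_ge0 // ltW.
  have : k * r1 * M <= (k * M) * (mu / (2 * (k * M + 1))).
    by rewrite mulrAC ler_wpM2l.
  move=> /le_lt_trans; apply; rewrite mulrA ltr_pdivrMr // mulrC ltr_pM2l //.
  by lra.
have [c1 c10 hc1] := fpos r1 r10.
have M10 : 0 < (M + 1) ^+ E.+1 by rewrite exprn_gt0 // ltr_wpDl.
have k40 : 0 < k / (2 * 4 ^+ E) by rewrite divr_gt0 // mulr_gt0 // exprn_gt0.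
exists (Order.min (k / (2 * 4 ^+ E)) (c1 / (M + 1) ^+ E.+1)).
  by rewrite lt_min k40 divr_gt0.
move=> x bx; set rho := `|x - z|.
have rho0 : 0 <= rho by exact: normr_ge0.
have [e|xz] := eqVneq (x - z) 0.
  by rewrite /rho e normr0 expr0n mulr0 f0.
have rhop : 0 < rho by rewrite normr_gt0.
have [r1rho|rhor1] := leP r1 rho.
  apply: (le_trans _ (hc1 _ bx r1rho)).
  apply: (@le_trans _ _ (c1 / (M + 1) ^+ E.+1 * rho ^+ E.+1)).
    by rewrite ler_wpM2r ?exprn_ge0 // ge_min lexx orbT.
  rewrite mulrAC ler_pdivrMr // ler_wpM2l ?(ltW c10) // lerXn2r ?nnegrE ?addr_ge0 //.
  by rewrite (le_trans (bM _ bx)) // lerDl.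
have [i] := norm_coord_eq xz; rewrite -/rho !mxE => rhoE.
(* This [c] makes [s <= rho / 4]; together with [V <= rho / 4] half of [rho] is left in the lower
   bound of [minim]. *)
set b := x 0 i - z 0 i < 0; set c := k * (rho / 4) ^+ E.
have sE : sgn b * (x 0 i - z 0 i) = rho.
  rewrite rhoE /sgn /b; case: ltP => h; first by rewrite expr1 mulN1r ltr0_norm.
  by rewrite expr0 mul1r ger0_norm.
have rho4 : 0 < rho / 4 by rewrite divr_gt0.
have rho41 : rho / 4 < 1 by lra.
have c0 : 0 < c by rewrite mulr_gt0 // exprn_gt0.
have pE : (rho / 4) ^+ E <= rho / 4.
  by rewrite -(prednK E0) exprS ler_piMr ?(ltW rho4) // exprn_ile1 // ltW.
have ck : c < k by rewrite /c -[ltRHS]mulr1 ltr_pM2l // (le_lt_trans pE).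
have cmu : c * M < mu.
  apply: le_lt_trans r1mu; rewrite ler_wpM2r // /c ler_wpM2l ?(ltW k0) //.
  by rewrite (le_trans pE) //; lra.
have [s [sE' s0] hs] := minim c (i, b) c0 ck cmu.
have srho : s <= rho / 4.
  move: sE'; rewrite /c ler_pM2l // => h; rewrite -(@ler_pXn2r _ E) ?nnegrE //.
  exact: ltW.
have := hs x bx; rewrite /= sE => hf.
have Vr : peval V x <= rho / 4.
  have rle1 : rho <= 1 by lra.
  apply: (le_trans (Vle x rle1)); rewrite expr2 mulrA -/rho mulrC ler_wpM2l //.
  apply: (le_trans _ r1n); rewrite mulrC ler_wpM2r // ltW //.
apply: (le_trans _ hf).
apply: (@le_trans _ _ (c * (rho / 2))); last by rewrite ler_pM2l //; lra.
apply: (@le_trans _ _ (k / (2 * 4 ^+ E) * rho ^+ E.+1)).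
  by rewrite ler_wpM2r ?exprn_ge0 // ge_min lexx.
rewrite /c expr_div_n exprS le_eqVlt; apply/orP; left; apply/eqP.
have : (4 : R) ^+ E != 0 by rewrite expf_neq0 //.
by move=> h; field.
Qed.

(** * Elimination in the plane *)

Lemma msizeM_leD (R : realType) n (p q : mpoly n R) a b :
  (mmeasure mdeg p <= a.+1)%N -> (mmeasure mdeg q <= b.+1)%N ->
  (mmeasure mdeg (p * q) <= (a + b).+1)%N.
Proof.
move=> sp sq; have [->|p0] := eqVneq p 0; first by rewrite mul0r mmeasure0.
have [->|q0] := eqVneq q 0; first by rewrite mulr0 mmeasure0.
rewrite msizeM //; move: sp sq; rewrite (mpolySpred mdeg p0) (mpolySpred mdeg q0).
by lia.
Qed.

Lemma msizeX_le (R : realType) n (p : mpoly n R) a k :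
  (mmeasure mdeg p <= a.+1)%N -> (mmeasure mdeg (p ^+ k) <= (k * a).+1)%N.
Proof.
move=> sp; elim: k => [|k IH]; first by rewrite expr0 msize1.
by rewrite exprS mulSn; exact: msizeM_leD.
Qed.

(* Modulo [Q], polynomials of degree at most [M] in two variables form a space of
   dimension at most [e * (M + 1)], too small for the monomials in [x 0 i] and [f]
   of degree at most [D * e] in [x 0 i]. *)
Lemma plane_elimination (R : realType) (f Q : mpoly 2 R) D e (i : 'I_2) :
  (0 < D)%N -> Q != 0 -> (mmeasure mdeg Q <= e.+1)%N -> (mmeasure mdeg f <= D.+1)%N ->
  exists2 P : {poly {poly R}}, P != 0 /\ (size P <= (D * e).+1)%N &
  forall x, peval Q x = 0 -> bieval P (peval f x) (x 0 i) = 0.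
Proof.
move=> D0 Q0 sQ sf.
(* [J] is just large enough for [(D e + 1) (J + 1)] to exceed [e (M + 1)], the number of pairs of
   exponents at most [M] whose first entry is below [e]. The monomials divisible by [x_0 ^ e] are
   matched by the multiples of [Q]. *)
pose J := (D * (e * e) + e)%N; pose M := (D * e + D * J)%N.
have eM : (e <= M)%N by rewrite /M /J; nia.
pose B : finType := bmultinom 2 (M - e).+1.
(* Instead of passing to the quotient by [Q], the multiples of [Q] are adjoined to the family whose
   linear dependence is sought. *)
pose U : finType := ('I_(D * e).+1 * 'I_J.+1 + B)%type.
pose C : finType := (B + 'I_e * 'I_M.+1)%type.
pose p (u : U) : mpoly 2 R := match u with
  | inl ab => mpolyX R (mnm1 i) ^+ ab.1 * f ^+ ab.2
  | inr g => Q * mpolyX R (bmnm g) end.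
pose mono (c : C) : multinom 2 := match c with
  | inl g => mnm_add (mnm_muln (mnm1 ord0) e) (bmnm g)
  | inr ab => mnm_add (mnm_muln (mnm1 ord0) ab.1) (mnm_muln (mnm1 ord_max) ab.2) end.
pose W : 'M[R]_(#|U|, #|C|) := \matrix_(a, b) mcoeff (mono (enum_val b)) (p (enum_val a)).
have ltCU : (#|C| < #|U|)%N.
  rewrite !card_sum !card_prod !card_ord addnC ltn_add2r /M /J; nia.
have [v vW v0] : exists2 v : 'rV[R]_#|U|, v *m W = 0 & v != 0.
  have : kermx W != 0.
    rewrite kermx_eq0 /row_free neq_ltn (leq_ltn_trans (rank_leq_col W)) //.
  by move=> /rowV0Pn[v /sub_kermxP vW v0]; exists v.
have sp u : (mmeasure mdeg (p u) <= M.+1)%N.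
  case: u => [[a b]|g] /=.
    have h1 : (mmeasure mdeg (mpolyX R (mnm1 i) ^+ a) <= (a * 1).+1)%N.
      by apply: msizeX_le; rewrite msizeX mdeg1.
    have := msizeM_leD h1 (msizeX_le b sf) => /leq_trans; apply.
    have := ltn_ord a; have := ltn_ord b; rewrite /M /J; nia.
  have h1 : (mmeasure mdeg (mpolyX R (bmnm g)) <= (M - e).+1)%N.
    by rewrite msizeX bmdeg.
  by have := msizeM_leD sQ h1; rewrite subnKC.
pose S := \sum_(u : U) v 0 (enum_rank u) *: p u.
have S0 : S = 0.
  apply/mpolyP => mu; rewrite mcoeff0.
  have [big|small] := ltnP M (mdeg mu).
    rewrite /S raddf_sum big1 // => u _; rewrite /= mcoeffZ.
    by rewrite (_ : mcoeff mu (p u) = 0) ?mulr0 //; apply/eqP; rewrite mcoeff_eq0 msize_mdeg_ge // (leq_trans (sp u)).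
  have [c cE] : exists c, mono c = mu.
    have muE : mdeg mu = (mu ord0 + mu ord_max)%N by rewrite mdegE big_ord_recl big_ord1; congr (_ + mu _)%N; apply: val_inj.
    have [ge|lt] := leqP e (mu ord0).
      pose g := mnm_sub mu (mnm_muln (mnm1 ord0) e).
      have le : lem (mnm_muln (mnm1 ord0) e) mu.
        apply/mnm_lepP => k; rewrite mulmnE mnm1E; case: eqP => [<-|//]; by rewrite mul1n.
      have gE : mnm_add (mnm_muln (mnm1 ord0) e) g = mu by rewrite addmC submK.
      have gd : (mdeg g < (M - e).+1)%N.
        move: small; rewrite -{1}gE mdegD mdegMn mdeg1 mul1n; lia.
      by exists (inl (BMultinom gd)).
    have h2 : (mu ord_max < M.+1)%N by move: small; rewrite muE; lia.
    exists (inr (Ordinal lt, Ordinal h2)); apply/mnmP => k /=.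
    rewrite mnmDE !mulmnE !mnm1E; case: (unliftP ord0 k) => [k' ->|->] /=.
      by rewrite (ord1 k') mul0n add0n (_ : ord_max == _) ?mul1n //; congr (mu _); apply: val_inj.
    by rewrite mul1n mul0n addn0.
  have /matrixP/(_ 0 (enum_rank c)) := vW; rewrite !mxE => <-.
  rewrite /S raddf_sum /= (reindex (@enum_rank U)) /=; last first.
    by exists enum_val => ? _; rewrite ?enum_rankK ?enum_valK.
  by apply: eq_bigr => u _; rewrite mcoeffZ mxE !enum_rankK cE.
pose g a b := v 0 (enum_rank (inl (inord a, inord b) : U)).
pose P : {poly {poly R}} := \poly_(a < (D * e).+1) \poly_(b < J.+1) g a b.
exists P; last first.
  move=> x Qx; have := congr1 (fun q => peval q x) S0; rewrite peval0 /S pevalsum.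
  rewrite big_sumType /= [X in _ + X]big1 ?addr0; last first.
    by move=> u _; rewrite pevalZ pevalM Qx mul0r mulr0.
  move=> <-; rewrite /bieval /P horner_poly horner_sum.
  rewrite (eq_bigr (fun ab : 'I_(D * e).+1 * 'I_J.+1 =>
    v 0 (enum_rank (inl (ab.1, ab.2) : U)) * (x 0 i ^+ ab.1 * peval f x ^+ ab.2))); last first.
    by move=> [a b] _; rewrite pevalZ pevalM !pevalX pevalXU.
  rewrite -(pair_bigA _ (fun a b =>
     v 0 (enum_rank (inl (a, b) : U)) * (x 0 i ^+ a * peval f x ^+ b))) /=.
  apply: eq_bigr => a _; rewrite hornerM horner_exp hornerC horner_poly mulr_suml.
  by apply: eq_bigr => b _; rewrite /g !inord_val; ring.
split; last exact: size_poly.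
(* If [P] vanished, the relation would involve multiples of [Q] only, and cancelling [Q] would make
   it trivial. *)
apply/eqP => P0; move: v0; apply/negP; rewrite negbK.
have vl a b : v 0 (enum_rank (inl (a, b) : U)) = 0.
  have := congr1 (fun q : {poly {poly R}} => (q`_a)`_b) P0.
  by rewrite /P coef_poly ltn_ord coef_poly ltn_ord /g !inord_val !coef0.
have : Q * \sum_(g : B) v 0 (enum_rank (inr g : U)) *: mpolyX R (bmnm g) = 0.
  rewrite -[RHS]S0 /S big_sumType /= [X in _ = X + _]big1 ?add0r; last first.
    by move=> [a b] _; rewrite vl scale0r.
  by rewrite mulr_sumr; apply: eq_bigr => h _; rewrite scalerAr.
move/eqP; rewrite mulf_eq0 (negbTE Q0) /= => /eqP SB.
have vr h : v 0 (enum_rank (inr h : U)) = 0.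
  have := congr1 (mcoeff (bmnm h)) SB; rewrite mcoeff0 raddf_sum /= (bigD1 h) //= big1 ?addr0.
    by rewrite mcoeffZ mcoeffX eqxx mulr1.
  by move=> k kh; rewrite mcoeffZ mcoeffX -bmeqP (negbTE kh) mulr0.
apply/eqP/rowP => k; rewrite mxE -(enum_valK k).
by case: (enum_val k) => [[a b]|h].
Qed.

(** * Monotonicity of definable functions *)

Section Substitution.
Context {R : realType}.

Lemma polyfun_lsub n m k (psi : 'rV[R]_k -> 'rV[R]_(n + m)) (i : 'I_n) :
  (forall i, polyfun (fun w => psi w 0 i)) -> polyfun (fun w => lsubmx (psi w) 0 i).
Proof. by move=> h; apply: polyfun_ext (h (lshift m i)) => w; rewrite mxE. Qed.

Lemma polyfun_rsub n m k (psi : 'rV[R]_k -> 'rV[R]_(n + m)) (i : 'I_m) :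
  (forall i, polyfun (fun w => psi w 0 i)) -> polyfun (fun w => rsubmx (psi w) 0 i).
Proof. by move=> h; apply: polyfun_ext (h (rshift n i)) => w; rewrite mxE. Qed.

Lemma sa_rel2 k (G : R -> R -> Prop) (phi psi : 'rV[R]_k -> R) :
  sa (fun w : 'rV[R]_(1 + 1) => G (w 0 (lshift 1 0)) (w 0 (rshift 1 0))) ->
  polyfun phi -> polyfun psi -> sa (fun x => G (phi x) (psi x)).
Proof.
move=> hG hp hq.
have := @sa_comp _ _ k _ (fun x => row_mx (\row_(i < 1) phi x) (\row_(i < 1) psi x)) _ hG.
move=> h; apply: sa_ext (h _) => [x|i]; first by rewrite row_mxEl row_mxEr !mxE.
case: (split_ordP i) => j ->.
  by apply: polyfun_ext hp => x; rewrite row_mxEl mxE.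
by apply: polyfun_ext hq => x; rewrite row_mxEr mxE.
Qed.

Lemma sa_relv k n (G : R -> 'rV[R]_n -> Prop) (phi : 'rV[R]_k -> R) (psi : 'rV[R]_k -> 'rV[R]_n) :
  sa (fun w : 'rV[R]_(1 + n) => G (w 0 (lshift n 0)) (rsubmx w)) ->
  polyfun phi -> (forall i, polyfun (fun x => psi x 0 i)) -> sa (fun x => G (phi x) (psi x)).
Proof.
move=> hG hp hq.
have := @sa_comp _ _ k _ (fun x => row_mx (\row_(i < 1) phi x) (psi x)) _ hG.
move=> h; apply: sa_ext (h _) => [x|i]; first by rewrite row_mxEl row_mxKr !mxE.
case: (split_ordP i) => j ->.
  by apply: polyfun_ext hp => x; rewrite row_mxEl mxE.
by apply: polyfun_ext (hq j) => x; rewrite row_mxEr.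
Qed.

End Substitution.

Ltac polyfun_tac := repeat first
  [ progress intros | assumption | exact: polyfun_const | exact: polyfun_coord | exact: polyfun_peval
  | apply: polyfun_lsub => ? | apply: polyfun_rsub => ?
  | apply: polyfunD | apply: polyfunB | apply: polyfunN | apply: polyfunM | apply: polyfunX
  | apply: polyfun_sum => ? | apply: polyfun_prod => ? ].

Ltac sa_tac := repeat first
  [ apply: sa_and | apply: sa_or | apply: sa_not | apply: sa_imp | apply: sa_exR; cbv beta | apply: sa_allR; cbv beta
  | apply: sa_ex; cbv beta | apply: sa_all; cbv beta | apply: sa_allI => ? | apply: sa_not
  | apply: sa_lt | apply: sa_le | apply: sa_eq ]; polyfun_tac.

Ltac sa_graph H := repeat first
  [ apply: (sa_rel2 H); solve [polyfun_tac]
  | apply: sa_and | apply: sa_or | apply: sa_not | apply: sa_imp | apply: sa_exR; cbv beta | apply: sa_allR; cbv beta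
  | apply: sa_not | apply: sa_lt | apply: sa_le | apply: sa_eq ]; polyfun_tac.

Section Monotonicity.
Context {R : realType}.
Implicit Types (g : R -> R) (d : R).

(** A countable set is null, an interval is not. Local pathologies occurring at all small times are
    refuted by labelling each time with rational numbers. *)
Lemma not_injective_countable d (T : countType) (f : R -> T) : 0 < d ->
  ~ (forall s t, 0 < s -> s < t -> t < d -> f s <> f t).
Proof.
move=> d0 inj.
have cA : countable `]0, d[%classic.
  apply/countable_injP; exists (fun t => pickle (f t)) => s t.
  rewrite !inE /= !in_itv /= => /andP[s0 sd] /andP[t0 td] e.
  have {}e := pcan_inj (@pickleK T) e.
  have [st|ts|//] := ltgtP s t; first by case: (inj s t s0 st td e).
  by case: (inj t s t0 ts sd (esym e)).
have := countable_lebesgue_measure0 cA.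
by rewrite lebesgue_measure_itv /= lte_fin d0 oppr0 adde0 => -[e]; move: d0; rewrite e ltxx.
Qed.

Definition graphR d g (t u : R) : Prop := 0 < t /\ t < d /\ u = g t.

Definition def_on d g : Prop :=
  sa (fun w : 'rV[R]_(1 + 1) => graphR d g (w 0 (lshift 1 0)) (w 0 (rshift 1 0))).

Definition near_le (g : R -> R) (t : R) : Prop :=
  exists e, 0 < e /\ forall s, (t < s /\ s < t + e -> g t <= g s) /\ (t - e < s /\ s < t -> g s <= g t).

Definition near_min (g : R -> R) (t : R) : Prop :=
  exists e, 0 < e /\ forall s, t - e < s /\ s < t + e -> s <> t -> g t < g s.

(** Continuous induction: the part of [near_le] to the left of a point passes to the supremum of the
    good times, and the part to the right moves beyond it. No continuity of [g] is involved. *)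
Lemma local_mono T g : (forall t, 0 < t -> t <= T -> near_le g t) ->
  forall s t, 0 < s -> s <= t -> t <= T -> g s <= g t.
Proof.
move=> loc s t s0 st td.
pose S := [set b | s <= b /\ b <= t /\ forall c, s <= c -> c <= b -> g s <= g c].
have Ss : S s by split=> //; split=> // c sc cs; have -> : c = s by apply/eqP; rewrite eq_le cs.
have hS : has_sup S by split; [exists s|exists t => b [_ []]].
set b := sup S.
have sb : s <= b by apply: ub_le_sup => //; exact: hS.2.
have bt : b <= t by apply: ge_sup; [exists s|move=> c [_ []]].
have below c : s <= c -> c < b -> g s <= g c.
  move=> sc cb; have [c' [sc' [c't hc']] cc'] := sup_adherent (eps := b - c) ltac:(by rewrite subr_gt0) hS.
  by apply: hc' => //; rewrite ltW // (le_lt_trans _ cc') // opprB addrC subrK.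
have b0 : 0 < b by exact: lt_le_trans sb.
have [e [e0 he]] := loc b b0 (le_trans bt td).
have gb : g s <= g b.
  have [<-//|sb'] := eqVneq s b; have {sb'}sb' : s < b by rewrite lt_neqAle sb' sb.
  pose c := Order.max s (b - e / 2).
  have cb : c < b by rewrite gt_max sb' /=; lra.
  have sc : s <= c by rewrite le_max lexx.
  apply: (le_trans (below c sc cb)); apply: (he c).2; split=> //.
  by rewrite lt_max; apply/orP; right; lra.
have [e'|bt'] := eqVneq t b; first by rewrite e'.
have {bt'}bt' : b < t by rewrite lt_neqAle eq_sym bt' bt.
exfalso; pose b' := Order.min t (b + e / 2).
have bb' : b < b' by rewrite lt_min bt' /=; lra.
suff : S b' by move=> /(ub_le_sup hS.2); rewrite leNgt bb'.
split; first by rewrite (le_trans sb) // ltW.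
split=> [|c sc cb']; first by rewrite ge_min lexx.
have [cb|bc|e'] := ltgtP c b; [exact: below| |by rewrite e'].
apply: (le_trans gb); apply: (he c).1; split=> //; rewrite (le_lt_trans cb') //.
by rewrite gt_min; apply/orP; right; lra.
Qed.

Lemma def_onN d g : def_on d g -> def_on d (fun t => - g t).
Proof.
move=> h; apply: (@sa_ext _ _ (fun w : 'rV[R]_(1 + 1) =>
    graphR d g (w 0 (lshift 1 0)) (- w 0 (rshift 1 0)))).
  move=> w; rewrite /graphR; split=> -[t0 [td e]]; split=> //; split=> //.
    by rewrite -e opprK.
  by rewrite e opprK.
by apply: (sa_rel2 h); polyfun_tac.
Qed.

Lemma def_on_le d d' g : d' <= d -> def_on d g -> def_on d' g.
Proof.
move=> dd' h; apply: (@sa_ext _ _ (fun w : 'rV[R]_(1 + 1) =>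
    w 0 (lshift 1 0) < d' /\ graphR d g (w 0 (lshift 1 0)) (w 0 (rshift 1 0)))).
  move=> w; rewrite /graphR; split; first by move=> [? [? [? ?]]].
  by move=> [t0 [td' e]]; split=> //; split=> //; split=> //; exact: lt_le_trans dd'.
by apply: sa_and => //; sa_tac.
Qed.

(** The comparison of [g t] with the value at distance [h] on one side is a semialgebraic condition
    on [h], hence decided for small [h]. *)
Lemma tame_side d g t (sg : R) : def_on d g -> 0 < t -> t < d -> (sg = 1 \/ sg = -1) ->
  [\/ ev0 (fun h => g t < g (t + sg * h)), ev0 (fun h => g (t + sg * h) < g t) |
      ev0 (fun h => g (t + sg * h) = g t)].
Proof.
move=> dg t0 td sgE.
have inside : ev0 (fun h => 0 < t + sg * h /\ t + sg * h < d).
  exists (Order.min t (d - t)); first by rewrite lt_min t0 subr_gt0.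
  by move=> h h0; rewrite lt_min => /andP[ht hd]; case: sgE => ->; lra.
have T (B : R -> R -> Prop) : sa (fun w : 'rV[R]_(1 + 1) => B (w 0 (lshift 1 0)) (w 0 (rshift 1 0))) ->
    ev0 (fun h => B (g (t + sg * h)) (g t)) \/ ev0 (fun h => ~ B (g (t + sg * h)) (g t)).
  move=> hB.
  have [|h|h] := @sa_tame R (fun h => exists v, graphR d g (t + sg * h) v /\ B v (g t)).
  - apply: sa_exR; cbv beta; apply: sa_and.
      by apply: (sa_rel2 dg); polyfun_tac.
    by apply: (sa_rel2 hB); polyfun_tac.
  - by left; apply: ev0_imp h => h h0 [v [[_ [_ ->]]]].
  - right; apply: ev0_imp (ev0_and inside h) => h' h0 [[h1 h2] nv] b.
    by apply: nv; exists (g (t + sg * h')).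
have [|lt|ge] := T (fun u v => u < v); first by sa_tac.
  by constructor 2.
have [|gt|le] := T (fun u v => v < u); first by sa_tac.
  by constructor 1.
constructor 3; apply: ev0_imp (ev0_and le ge) => h h0 [/negP l /negP g'].
by apply/eqP; rewrite eq_le !leNgt l g'.
Qed.

(** The three outcomes on either side combine into nine cases; when the two sides do not agree to be
    strictly above or strictly below, [g] is weakly monotone at [t]. *)
Lemma tame_point d g t : def_on d g -> 0 < t -> t < d ->
  [\/ near_le g t, near_le (fun s => - g s) t, near_min g t | near_min (fun s => - g s) t].
Proof.
move=> dg t0 td.
have side (A B : R -> Prop) : ev0 (fun h => A (t + 1 * h)) -> ev0 (fun h => B (t + -1 * h)) ->
    exists e, 0 < e /\ forall s, (t < s /\ s < t + e -> A s) /\ (t - e < s /\ s < t -> B s).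
  move=> hA hB; have [e e0 he] := ev0_and hA hB; exists e; split=> // s; split=> -[h1 h2].
    have [||+ _] := he (s - t); [by rewrite subr_gt0|by rewrite ltrBlDl|].
    by rewrite mul1r addrC subrK.
  have [||_ +] := he (t - s); [by rewrite subr_gt0|by lra|].
  by rewrite (_ : t + -1 * (t - s) = s) //; ring.
have mk_min (f : R -> R) : ev0 (fun h => f t < f (t + 1 * h)) -> ev0 (fun h => f t < f (t + -1 * h)) ->
    near_min f t.
  move=> hA hB; have [e [e0 he]] := side (fun s => f t < f s) (fun s => f t < f s) hA hB.
  exists e; split=> // s [h1 h2] st; have [lt|gt|//] := ltgtP s t.
    by apply: (he s).2.
  by apply: (he s).1.
have mk_le (f : R -> R) : ev0 (fun h => f t <= f (t + 1 * h)) -> ev0 (fun h => f (t + -1 * h) <= f t) ->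
    near_le f t.
  by move=> hA hB; exact: side (fun s => f t <= f s) (fun s => f s <= f t) hA hB.
have lt1 : (1 : R) = 1 \/ (1 : R) = -1 by left.
have lt2 : (-1 : R) = 1 \/ (-1 : R) = -1 by right.
have [r|r|r] := tame_side dg t0 td lt1; have [l|l|l] := tame_side dg t0 td lt2.
- by constructor 3; exact: mk_min.
- by constructor 1; apply: mk_le; [apply: ev0_imp r|apply: ev0_imp l] => h _ /ltW.
- by constructor 1; apply: mk_le; [apply: ev0_imp r => h _ /ltW|apply: ev0_imp l => h _ ->].
- by constructor 2; apply: mk_le; [apply: ev0_imp r|apply: ev0_imp l] => h _ /ltW; rewrite lerN2.
- by constructor 4; apply: mk_min; [apply: ev0_imp r|apply: ev0_imp l] => h _; rewrite ltrN2.
- constructor 2; apply: mk_le; [apply: ev0_imp r => h _ /ltW|apply: ev0_imp l => h _ ->//].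
  by rewrite lerN2.
- constructor 2; apply: mk_le; [apply: ev0_imp r => h _ ->//|apply: ev0_imp l => h _ /ltW].
  by rewrite lerN2.
- by constructor 1; apply: mk_le; [apply: ev0_imp r => h _ ->|apply: ev0_imp l => h _ /ltW].
- by constructor 1; apply: mk_le; [apply: ev0_imp r => h _ ->|apply: ev0_imp l => h _ ->].
Qed.

(** The local conditions expressed through the graph, so that they are visibly semialgebraic in
    [t]. *)
Definition near_leG d g (t : R) : Prop := exists e, 0 < e /\ forall s u v,
  graphR d g t u -> graphR d g s v ->
  (t < s /\ s < t + e -> u <= v) /\ (t - e < s /\ s < t -> v <= u).

Definition near_minG d g (t : R) : Prop := exists e, 0 < e /\ forall s u v,
  graphR d g t u -> graphR d g s v ->
  t - e < s /\ s < t + e -> s <> t -> u < v.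

Lemma sa_near_le d g : def_on d g -> sa (fun x : 'rV[R]_1 => near_leG d g (x 0 0)).
Proof. by move=> dg; rewrite /near_leG; sa_graph dg. Qed.

Lemma sa_near_min d g : def_on d g -> sa (fun x : 'rV[R]_1 => near_minG d g (x 0 0)).
Proof. by move=> dg; rewrite /near_minG; sa_graph dg. Qed.

Lemma tame_near_le d g : 0 < d -> def_on d g -> tame (near_le g).
Proof.
move=> d0 dg; have h := @sa_tame R (near_leG d g) (sa_near_le dg).
have E : ev0 (fun t => near_leG d g t <-> near_le g t).
  exists d => // t t0 td; split=> -[e [e0 he]].
    exists (Order.min e (Order.min t (d - t))); split; first by rewrite !lt_min e0 t0 subr_gt0.
    move=> s; split=> -[h1 h2].
      have := he s (g t) (g s); case=> //.
      + split; first exact: lt_trans h1.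
        split=> //.
        by rewrite -(subrK t d) addrC (lt_le_trans h2) // lerD2l !ge_min lexx !orbT.
      + by move=> + _; apply; split=> //; rewrite (lt_le_trans h2) // lerD2l ge_min lexx.
    have : s > 0.
      have : t - Order.min e (Order.min t (d - t)) >= t - t.
        by rewrite lerB // !ge_min lexx !orbT.
      by move: h1; lra.
    move=> s0; have := he s (g t) (g s); case=> //; first by split=> //; split=> //; exact: lt_trans td.
    move=> _; apply; split=> //; apply: le_lt_trans h1; rewrite lerB // ge_min lexx //.
  by exists e; split=> // s u v [_ [_ ->]] [_ [_ ->]]; exact: he.
by case: h => h; [left|right]; apply: ev0_imp (ev0_and E h) => t _ [<-].
Qed.

Lemma tame_near_min d g : 0 < d -> def_on d g -> tame (fun t => exists e, 0 < e /\
  forall s, 0 < s -> s < d -> t - e < s /\ s < t + e -> s <> t -> g t < g s).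
Proof.
move=> d0 dg; have h := @sa_tame R (near_minG d g) (sa_near_min dg).
have E : ev0 (fun t => near_minG d g t <-> (exists e, 0 < e /\
  forall s, 0 < s -> s < d -> t - e < s /\ s < t + e -> s <> t -> g t < g s)).
  exists d => // t t0 td; split=> -[e [e0 he]]; exists e; split=> //.
    by move=> s s0 sd; apply: he.
  by move=> s u v [_ [_ ->]] [s0 [sd ->]]; exact: he.
by case: h => h; [left|right]; apply: ev0_imp (ev0_and E h) => t _ [<-].
Qed.

(** Each [t] is labelled by a rational interval on which [g] has its strict minimum at [t]. Two
    times with the same label would each have the smaller value. *)
Lemma no_local_minima d g : 0 < d -> ~ ev0 (fun t => exists e, 0 < e /\
  forall s, 0 < s -> s < d -> t - e < s /\ s < t + e -> s <> t -> g t < g s).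
Proof.
move=> d0 [d1 d10 h]; pose d2 := Order.min d d1.
have d20 : 0 < d2 by rewrite lt_min d0.
have Q t : exists pq : rat * rat, 0 < t -> t < d2 -> ratr pq.1 < t /\ t < ratr pq.2 /\
    forall s, 0 < s -> s < d -> ratr pq.1 < s -> s < ratr pq.2 -> s <> t -> g t < g s.
  have [[t0 td]|no] := pselect (0 < t /\ t < d2); last first.
    by exists (0, 0) => t0 td; case: no.
  move: td; rewrite lt_min => /andP[td td1].
  have [e [e0 he]] := h t t0 td1.
  have [p] : exists q, ratr q \in `](t - e), t[ by apply: rat_in_itvoo; lra.
  have [q] : exists q, ratr q \in `]t, (t + e)[ by apply: rat_in_itvoo; lra.
  rewrite !in_itv /= => /andP[q1 q2] /andP[p1 p2].
  exists (p, q) => _ _; split=> //; split=> // s s0 sd ps sq st; apply: he => //.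
  by split; [exact: lt_trans ps|exact: lt_trans sq _].
have [f hf] := choice Q.
apply: (@not_injective_countable d2 _ f d20) => s t s0 st td e.
have t0 : 0 < t by exact: lt_trans st.
have sd : s < d2 by exact: lt_trans td.
have d2d : d2 <= d by rewrite ge_min lexx.
have [s1 [s2 s3]] := hf s s0 sd; have [t1 [t2 t3]] := hf t t0 td.
have := s3 t t0 (lt_le_trans td d2d); rewrite e => /(_ t1 t2).
have := t3 s s0 (lt_le_trans sd d2d); rewrite -e => /(_ s1 s2).
move=> h1 h2; have := lt_trans (h1 _) (h2 _); rewrite ltxx; case=> // E; move: st; rewrite E ltxx //.
Qed.

(** By monotonicity a jump leaves a gap in the values on one side of [g t], and a rational number in
    the gap labels [t]. The value at the midpoint of two times separates their labels. *)
Lemma mono_jump d g : (forall s t, 0 < s -> s <= t -> t < d -> g s <= g t) -> 0 < d ->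
  ~ ev0 (fun t => exists e, 0 < e /\ forall h, 0 < h ->
     exists s, [/\ 0 < s, s < d, t - h < s, s < t + h & e <= `|g s - g t|]).
Proof.
move=> mono d0 [d1 d10 H]; pose d2 := Order.min d d1.
have d20 : 0 < d2 by rewrite lt_min d0.
have Q t : exists q : rat, 0 < t -> t < d2 ->
    (g t < ratr q /\ forall s, t < s -> s < d -> ratr q < g s) \/
    (ratr q < g t /\ forall s, 0 < s -> s < t -> g s < ratr q).
  have [[t0 td]|no] := pselect (0 < t /\ t < d2); last by exists 0 => t0 td; case: no.
  move: td; rewrite lt_min => /andP[td td1].
  have [e [e0 he]] := H t t0 td1.
  have [right|nright] := pselect (forall s, t < s -> s < d -> g t + e <= g s).
    have [q] : exists q, ratr q \in `](g t), (g t + e)[ by apply: rat_in_itvoo; lra.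
    rewrite in_itv /= => /andP[q1 q2]; exists q => _ _; left; split=> // s ts sd.
    by apply: lt_le_trans (right s ts sd).
  have [left|nleft] := pselect (forall s, 0 < s -> s < t -> g s <= g t - e).
    have [q] : exists q, ratr q \in `](g t - e), (g t)[ by apply: rat_in_itvoo; lra.
    rewrite in_itv /= => /andP[q1 q2]; exists q => _ _; right; split=> // s s0 st.
    by apply: le_lt_trans (left s s0 st) _.
  exfalso.
  have [r [tr [rd gr]]] : exists r, t < r /\ r < d /\ g r < g t + e.
    apply: contrapT => no; apply: nright => s ts sd; rewrite leNgt; apply/negP => lt.
    by apply: no; exists s.
  have [l [l0 [lt gl]]] : exists l, 0 < l /\ l < t /\ g t - e < g l.
    apply: contrapT => no; apply: nleft => s ts sd; rewrite leNgt; apply/negP => lt.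
    by apply: no; exists s.
  have [|s [s0 sd s1 s2 s3]] := he (Order.min (r - t) (t - l)); first by rewrite lt_min !subr_gt0 tr.
  have sr : s <= r.
    have : t + Order.min (r - t) (t - l) <= t + (r - t) by rewrite lerD2l ge_min lexx.
    by move: s2; lra.
  have ls : l <= s.
    have : t - Order.min (r - t) (t - l) >= t - (t - l) by rewrite lerB // ge_min lexx orbT.
    by move: s1; lra.
  have m1 := mono s r s0 sr rd; have m2 := mono l s l0 ls sd.
  move: s3; rewrite leNgt => /negP; apply; rewrite ltr_norml; apply/andP; split; lra.
have [f hf] := choice Q.
apply: (@not_injective_countable d2 _ f d20) => s t s0 st td e.
have t0 : 0 < t by exact: lt_trans st.
have sd : s < d2 by exact: lt_trans td.
have d2d : d2 <= d by rewrite ge_min lexx.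
pose u := (s + t) / 2.
have su : s < u by rewrite /u; lra.
have ut : u < t by rewrite /u; lra.
have ud : u < d by apply: lt_trans ut (lt_le_trans td d2d).
have u0 : 0 < u by exact: lt_trans su.
have m1 := mono s u s0 (ltW su) ud; have m2 := mono u t u0 (ltW ut) (lt_le_trans td d2d).
case: (hf s s0 sd) => [[a1 a2]|[a1 a2]]; case: (hf t t0 td) => [[b1 b2]|[b1 b2]]; rewrite e in a1 a2.
- by have := a2 u su ud; lra.
- have := a2 u su ud; have := b2 u u0 ut; lra.
- by lra.
- by have := b2 u u0 ut; lra.
Qed.

Definition mono_cont d g : Prop :=
  ((forall s t, 0 < s -> s <= t -> t < d -> g s <= g t) \/
   (forall s t, 0 < s -> s <= t -> t < d -> g t <= g s)) /\
  (forall t, 0 < t -> t < d -> forall e, 0 < e -> exists2 h, 0 < h &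
     forall s, 0 < s -> s < d -> t - h < s -> s < t + h -> `|g s - g t| < e).

Lemma definable_up d g : 0 < d -> def_on d g ->
  (forall s t, 0 < s -> s <= t -> t < d -> g s <= g t) ->
  exists2 d', 0 < d' /\ d' <= d & mono_cont d' g.
Proof.
move=> d0 dg mono.
have : tame (fun t => exists e, 0 < e /\ forall h, 0 < h -> exists s,
    [/\ 0 < s, s < d, t - h < s, s < t + h & e <= `|g s - g t|]).
  have [|h|h] := @sa_tame R (fun t => exists e, 0 < e /\ forall h, 0 < h -> exists s u v,
    graphR d g s u /\ graphR d g t v /\ t - h < s /\ s < t + h /\ (e <= u - v \/ e <= v - u)).
  - by sa_graph dg.
  - left; apply: ev0_imp h => t t0 [e [e0 he]]; exists e; split=> // h /he.
    move=> [s [u [v [[s0 [sd ->]] [[_ [_ ->]] [h1 [h2 h3]]]]]]]; exists s; split=> //.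
    by rewrite ler_normr opprB; apply/orP.
  - right; apply: ev0_imp (ev0_and (ev0_lt d0) h) => t t0 [td no] [e [e0 he]]; apply: no.
    exists e; split=> // h' /he[s [s0 sd h1 h2 h3]]; exists s, (g s), (g t).
    by split=> //; split=> //; split=> //; split=> //; apply/orP; move: h3; rewrite ler_normr opprB.
case=> [/(mono_jump mono d0)//|[d1 d10 h]].
exists (Order.min d d1); first by rewrite lt_min d0 d10 ge_min lexx.
split; first by left=> s t s0 st; rewrite lt_min => /andP[td _]; exact: mono.
move=> t t0; rewrite lt_min => /andP[td td1] e e0; apply: contrapT => no.
apply: (h t t0 td1); exists e; split=> // h' h'0; apply: contrapT => no'.
apply: no; exists h' => // s s0; rewrite lt_min => /andP[sd _] h1 h2.
by rewrite ltNge; apply/negP => h3; apply: no'; exists s.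
Qed.

(** The monotonicity theorem at [0]. Each alternative of [tame_point] either holds at all small
    times or fails at all of them; strict extrema cannot occur at all small times, so [g] or its
    opposite is locally, hence globally, increasing near [0]. *)
Lemma definable_mono_cont d g : 0 < d -> def_on d g ->
  exists2 d', 0 < d' /\ d' <= d & mono_cont d' g.
Proof.
move=> d0 dg; have dgN := def_onN dg.
have up f : def_on d f -> ev0 (near_le f) -> exists2 d', 0 < d' /\ d' <= d & mono_cont d' f.
  move=> df [e e0 he]; pose d1 := Order.min d e.
  have d10 : 0 < d1 by rewrite lt_min d0.
  have d1d : d1 <= d by rewrite ge_min lexx.
  have [|d' [d'0 d'1] h] := definable_up d10 (def_on_le d1d df).
    move=> s t s0 st; rewrite lt_min => /andP[_ te].
    by apply: (@local_mono t) => // r r0 rt; apply: he => //; exact: le_lt_trans te.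
  by exists d' => //; split=> //; exact: le_trans d1d.
have [h|h1] := tame_near_le d0 dg; first exact: up.
have [h|h2] := tame_near_le d0 dgN.
  have [d' hd' [m c]] := up _ dgN h; exists d' => //; split.
    by case: m => m; [right|left] => s t s0 st td; have := m s t s0 st td; rewrite lerN2.
  move=> t t0 td e e0; have [h' h'0 hh] := c t t0 td e e0; exists h' => // s s0 sd a b.
  by have := hh s s0 sd a b; rewrite -opprD normrN.
have [h|h3] := tame_near_min d0 dg; first by case: (no_local_minima d0 h).
have [h|h4] := tame_near_min d0 dgN; first by case: (no_local_minima d0 h).
exfalso; have [t t0 [[[[td n1] n2] n3] n4]] := ev0_ex (ev0_and (ev0_and (ev0_and (ev0_and (ev0_lt d0) h1) h2) h3) h4).
have [//|//|[e [e0 m]]|[e [e0 m]]] := tame_point dg t0 td.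
  by apply: n3; exists e; split=> // s _ _; exact: m.
by apply: n4; exists e; split=> // s _ _; exact: m.
Qed.

End Monotonicity.

(** * Definable curves *)

Lemma ev0_fin (R : realType) (T : finType) (A : T -> R -> Prop) :
  (forall i, ev0 (A i)) -> ev0 (fun t => forall i, A i t).
Proof.
move=> h; have [||d d0 hd] := @fin_unif R T (fun i d => forall t, 0 < t -> t < d -> A i t).
- by move=> i d d' d'0 d'd H t t0 td; apply: H => //; exact: lt_le_trans d'd.
- by move=> i; have [d d0 hd] := h i; exists d.
by exists d => // t t0 td i; exact: hd.
Qed.

Section Curves.
Context {R : realType} {n : nat}.
Implicit Types (M : R -> 'rV[R]_n -> Prop) (x : R -> 'rV[R]_n) (d : R).

Definition graphV d x (t : R) (v : 'rV[R]_n) : Prop := 0 < t /\ t < d /\ v = x t.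

Definition def_curve d x : Prop :=
  sa (fun w : 'rV[R]_(1 + n) => graphV d x (w 0 (lshift n 0)) (rsubmx w)).

Lemma def_on_curve d x (phi : 'rV[R]_n -> R) :
  def_curve d x -> polyfun phi -> def_on d (fun t => phi (x t)).
Proof.
move=> dx hp; apply: (@sa_ext _ _ (fun w : 'rV[R]_(1 + 1) => exists v,
    graphV d x (w 0 (lshift 1 0)) v /\ w 0 (rshift 1 0) = phi v)).
  move=> w; rewrite /graphR /graphV; split.
    by move=> [v [[t0 [td ->]] ->]].
  by move=> [t0 [td ->]]; exists (x (w 0 (lshift 1 0))).
apply: sa_ex; cbv beta; apply: sa_and.
  by apply: (sa_relv dx); polyfun_tac.
apply: sa_eq; polyfun_tac.
by apply: (@polyfun_comp _ _ _ phi (fun w : 'rV[R]_(1 + 1 + n) => rsubmx w)) => // i; polyfun_tac.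
Qed.

Definition lexle (u v : 'rV[R]_n) : Prop :=
  forall i : 'I_n, (forall j : 'I_n, (j < i)%N -> u 0 j = v 0 j) -> u 0 i <= v 0 i.

Lemma lexle_anti u v : lexle u v -> lexle v u -> u = v.
Proof.
move=> uv vu.
have H k : forall i : 'I_n, (i < k)%N -> u 0 i = v 0 i.
  elim: k => // k IH i; rewrite ltnS => ik.
  have h (j : 'I_n) : (j < i)%N -> u 0 j = v 0 j by move=> ji; apply: IH; exact: leq_trans ik.
  by apply/eqP; rewrite eq_le uv // vu // => j /h.
by apply/rowP => i; apply: (H n).
Qed.

(** The coordinates are minimised in turn. The set [S] after [k] steps is compact and contains every
    point of [A] that shares its first [k] coordinates with a point of [S]. *)
Lemma lexmin_compact (A : set 'rV[R]_n) : A !=set0 -> compact A ->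
  exists2 u, A u & forall v, A v -> lexle u v.
Proof.
move=> A0 cA.
have H k : exists S : set 'rV[R]_n, [/\ S !=set0, compact S, S `<=` A,
   (forall u v, S u -> A v -> (forall j : 'I_n, (j < k)%N -> u 0 j = v 0 j) -> S v) &
   (forall u v, S u -> A v -> forall i : 'I_n, (i < k)%N ->
     (forall j : 'I_n, (j < i)%N -> u 0 j = v 0 j) -> u 0 i <= v 0 i)].
  elim: k => [|k [S [S0 cS SA ext low]]]; first by exists A; split.
  have [kn|nk] := ltnP k n; last first.
    exists S; split=> //.
      by move=> u v Su Av h; apply: (ext u v Su Av) => j jk; apply: h; exact: ltnW.
    by move=> u v Su Av i _; apply: low => //; exact: leq_trans nk.
  pose o := Ordinal kn.
  have co : continuous (fun u : 'rV[R]_n => u 0 o) by exact: coord_continuous.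
  have [c Sc hc] := compact_argmin S0 cS co.
  exists (S `&` [set u | u 0 o <= c 0 o]); split.
  - by exists c; split=> //=.
  - apply: compact_closedI => //; apply: (closed_lefun co) => //.
    exact: cst_continuous.
  - by move=> u [/SA].
  - move=> u v [Su uc] Av h; split.
      by apply: (ext u v Su Av) => j jk; apply: h; exact: leqW.
    by rewrite /= -(h o) //=.
  - move=> u v [Su uc] Av i; rewrite ltnS leq_eqVlt => /orP[/eqP ik|ik] h; last exact: low.
    have io : i = o by apply: val_inj.
    have Sv : S v by apply: (ext u v Su Av) => j jk; apply: h; rewrite ik.
    by rewrite io (le_trans uc) // hc.
have [S [[u Su] _ SA _ low]] := H n; exists u; first exact: SA.
by move=> v Av i; apply: low.
Qed.

(** The lexicographic minimum of a compact fibre is a canonical choice given by a first-order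
    formula, so the selected curve is definable. *)
Lemma definable_choice d M : 0 < d ->
  sa (fun w : 'rV[R]_(1 + n) => M (w 0 (lshift n 0)) (rsubmx w)) ->
  (forall a, 0 < a -> a < d -> (exists v, M a v) /\ compact [set v | M a v]) ->
  exists2 x, def_curve d x & forall a, 0 < a -> a < d -> M a (x a).
Proof.
move=> d0 sM hM.
have C a : exists u, 0 < a -> a < d -> M a u /\ forall v, M a v -> lexle u v.
  have [[a0 ad]|no] := pselect (0 < a /\ a < d); last by exists 0 => a0 ad; case: no.
  have [ne cM] := hM a a0 ad; have [u Mu hu] := lexmin_compact ne cM.
  by exists u.
have [x hx] := choice C; exists x; last by move=> a a0 ad; exact: (hx a a0 ad).1.
apply: (@sa_ext _ _ (fun w : 'rV[R]_(1 + n) => (0 < w 0 (lshift n 0) /\ w 0 (lshift n 0) < d) /\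
    (M (w 0 (lshift n 0)) (rsubmx w) /\ forall v, M (w 0 (lshift n 0)) v -> lexle (rsubmx w) v))).
  move=> w; rewrite /graphV; split.
    move=> [[a0 ad] [Mw lw]]; split=> //; split=> //; have [Mx lx] := hx _ a0 ad.
    by apply: lexle_anti; [exact: lw|exact: lx].
  by move=> [a0 [ad ->]]; have [Mx lx] := hx _ a0 ad.
apply: sa_and; first by sa_tac.
apply: sa_and => //; apply: sa_all; cbv beta; apply: sa_imp.
  by apply: (sa_relv sM); polyfun_tac.
rewrite /lexle; apply: sa_allI => i; apply: sa_imp; last by sa_tac.
by apply: sa_allI => j; apply: sa_imp; [exact: sa_const|sa_tac].
Qed.

Definition tame_curve d x : Prop := forall i, mono_cont d (fun t => x t 0 i).

Lemma mono_cont_le d d' (g : R -> R) : 0 < d' -> d' <= d -> mono_cont d g -> mono_cont d' g.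
Proof.
move=> d'0 d'd [m c]; split.
  by case: m => m; [left|right] => s t s0 st td; apply: m => //; exact: lt_le_trans d'd.
move=> t t0 td e e0; have [h h0 hh] := c t t0 (lt_le_trans td d'd) e e0.
by exists h => // s s0 sd; apply: hh => //; exact: lt_le_trans d'd.
Qed.

Lemma def_curve_tame d x : 0 < d -> def_curve d x -> exists2 d', 0 < d' /\ d' <= d & tame_curve d' x.
Proof.
move=> d0 dx.
have [||d' d'0 h] := @fin_unif R 'I_n (fun i d' => d' <= d /\ mono_cont d' (fun t => x t 0 i)).
- move=> i e e' e'0 e'e [ed m]; split; first exact: le_trans ed.
  exact: mono_cont_le m.
- move=> i; have [d' [d'0 d'd] m] := definable_mono_cont d0 (def_on_curve dx (polyfun_coord i)).
  by exists d'.
exists (Order.min d d'); first by rewrite lt_min d0 d'0 ge_min lexx.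
move=> i; apply: mono_cont_le (h i).2; first by rewrite lt_min d0.
by rewrite ge_min lexx orbT.
Qed.

Lemma mono_limit d (g : R -> R) B : 0 < d -> (forall t, 0 < t -> t < d -> `|g t| <= B) ->
  mono_cont d g -> exists l, forall e, 0 < e -> ev0 (fun t => `|g t - l| < e).
Proof.
move=> d0 hB [m _].
have key (f : R -> R) : (forall t, 0 < t -> t < d -> `|f t| <= B) ->
    (forall s t, 0 < s -> s <= t -> t < d -> f s <= f t) ->
    exists l, forall e, 0 < e -> ev0 (fun t => `|f t - l| < e).
  move=> fB mf; pose S := [set y | exists t, [/\ 0 < t, t < d & y = f t]].
  have hS : has_inf S.
    split; first by exists (f (d / 2)), (d / 2); split=> //; lra.
    by exists (- B) => _ [t [t0 td ->]]; have := fB t t0 td; rewrite ler_norml => /andP[].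
  exists (inf S) => e e0; have [_ [t [t0 td ->]] ht] := inf_adherent e0 hS.
  exists t => // s s0 st.
  have h1 : inf S <= f s by apply: ge_inf; [exact: hS.2|exists s; split=> //; exact: lt_trans td].
  have h2 := mf s t s0 (ltW st) td.
  by rewrite ger0_norm; lra.
case: m => m; first exact: key.
have [l hl] := key (fun t => - g t) ltac:(by move=> t t0 td; rewrite normrN; exact: hB)
   ltac:(by move=> s t s0 st td; rewrite lerN2; exact: m).
by exists (- l) => e /hl; apply: ev0_imp => t _; rewrite -opprD normrN opprK.
Qed.

Lemma curve_limit d x B : 0 < d -> (forall t, 0 < t -> t < d -> `|x t| <= B) ->
  tame_curve d x -> exists x0 : 'rV[R]_n, forall e, 0 < e -> ev0 (fun t => `|x t - x0| < e).
Proof.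
move=> d0 hB tx.
have L i : exists l, forall e, 0 < e -> ev0 (fun t => `|x t 0 i - l| < e).
  apply: mono_limit d0 _ (tx i) => t t0 td.
  exact: le_trans (coord_le_norm _ _) (hB t t0 td).
have /fin_all_exists[l hl] := L.
exists (\row_i l i) => e e0.
have e2 : 0 < e / 2 by rewrite divr_gt0.
apply: ev0_imp (ev0_fin (fun i => hl i _ e2)) => t _ h.
apply: (@le_lt_trans _ _ (e / 2)); last by lra.
by apply: norm_le_coord => [|i]; [exact: ltW|rewrite !mxE ltW].
Qed.

Lemma limit_continuous x (x0 : 'rV[R]_n) (phi : 'rV[R]_n -> R) : continuous phi ->
  (forall e, 0 < e -> ev0 (fun t => `|x t - x0| < e)) ->
  forall e, 0 < e -> ev0 (fun t => `|phi (x t) - phi x0| < e).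
Proof.
move=> cp hx e e0.
have : nbhs (phi x0) (ball (phi x0) e) by exact: nbhsx_ballx.
move=> /(cp x0) /nbhs_ballP[r /= r0 hr].
apply: ev0_imp (hx r r0) => t _ h.
have := hr (x t); rewrite /preimage /= -ball_normE /= => /(_ _).
by rewrite [`|x0 - x t|]distrC => /(_ h); rewrite -ball_normE /= distrC.
Qed.

(* The curve is continuous with monotone coordinates, so its length between two
   times is comparable to the distance of the end points. *)
Lemma curve_variation d x (p : mpoly n R) (w T B : R) (I : pred 'I_n) :
  tame_curve d x -> T < d -> (forall t, 0 < t -> t < d -> `|x t| <= B) -> 0 <= w ->
  (forall i s t, 0 < s -> s < d -> 0 < t -> t < d -> ~~ I i -> x s 0 i = x t 0 i) ->
  (forall t i, 0 < t -> t <= T -> I i -> `|peval (mderiv i p) (x t)| <= w) ->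
  forall s t, 0 < s -> s <= t -> t <= T ->
    peval p (x t) - peval p (x s) <= w * \sum_i `|x t 0 i - x s 0 i|.
Proof.
move=> tx Td hB w0 fix_ hw s t s0 st tT.
have [C C0 hC] := taylor p B.
have /fin_all_exists[sg hsg] (i : 'I_n) : exists sg : R, (sg = 1 \/ sg = -1) /\
    forall s t, 0 < s -> s <= t -> t < d -> sg * (x t 0 i - x s 0 i) = `|x t 0 i - x s 0 i|.
  have [[m|m] _] := tx i; [exists 1; split; first by left|exists (-1); split; first by right] =>
    s' t' s'0 s't t'd; have := m s' t' s'0 s't t'd.
    by move=> h; rewrite mul1r ger0_norm // subr_ge0.
  by move=> h; rewrite mulN1r ler0_norm // subr_le0.
(* With the signs of monotonicity the increment of [S] is the sum of the coordinate distances, so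
   [S] acts as arc length. *)
pose S r := \sum_i sg i * x r 0 i.
have SE a b : 0 < a -> a <= b -> b < d -> S b - S a = \sum_i `|x b 0 i - x a 0 i|.
  move=> a0 ab bd; rewrite /S -sumrB; apply: eq_bigr => i _.
  by rewrite -mulrBr (hsg i).2.
have sumnorm (v : 'rV[R]_n) : `|v| <= \sum_i `|v 0 i|.
  apply: norm_le_coord => [|i]; first exact: sumr_ge0.
  by rewrite (bigD1 i) //= lerDl sumr_ge0.
have step e b r : 0 < b -> b <= T -> 0 < r -> r < d -> C * `|x r - x b| <= e ->
    `|peval p (x r) - peval p (x b)| <= (w + e) * \sum_i `|x r 0 i - x b 0 i|.
  move=> b0 bT r0 rd small.
  have [_ _ _ h] := hC (x b) (x r) (hB b b0 (le_lt_trans bT Td)) (hB r r0 rd).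
  have hd : `|dpeval p (x b) (x r)| <= w * \sum_i `|x r 0 i - x b 0 i|.
    rewrite /dpeval (le_trans (ler_norm_sum _ _ _)) // mulr_sumr; apply: ler_sum => i _.
    rewrite normrM; have [Ii|nIi] := boolP (I i); first by rewrite ler_wpM2r // hw.
    by rewrite (fix_ i r b) // ?subrr ?normr0 ?mulr0 //; exact: le_lt_trans Td.
  have h2 : C * `|x r - x b| ^+ 2 <= e * \sum_i `|x r 0 i - x b 0 i|.
    rewrite expr2 mulrA (le_trans (ler_wpM2r _ small)) // ler_wpM2l //.
      by apply: le_trans small; rewrite mulr_ge0.
    by rewrite (le_trans (sumnorm _)) // le_eqVlt (eq_bigr (fun i => `|x r 0 i - x b 0 i|)) ?eqxx // => i _; rewrite !mxE.
  have := ler_normD (peval p (x r) - peval p (x b) - dpeval p (x b) (x r)) (dpeval p (x b) (x r)).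
  rewrite subrK => h3; rewrite mulrDl (le_trans h3) // addrC lerD // (le_trans h) //.
have main e : 0 < e -> peval p (x t) - peval p (x s) <= (w + e) * \sum_i `|x t 0 i - x s 0 i|.
  (* It suffices that [H] is locally increasing; the slope [w] is relaxed by [e] to absorb the
     quadratic Taylor remainder, and [e] is sent to [0] at the end. *)
  move=> e0; pose H r := (w + e) * S r - peval p (x r).
  suff : H s <= H t.
    by rewrite /H -SE // ?(le_lt_trans tT) // mulrBr; lra.
  apply: (@local_mono _ T) => // b b0 bT.
  have bd : b < d by exact: le_lt_trans Td.
  have e1 : 0 < e / (C + 1) by rewrite divr_gt0 // ltr_wpDl.
  have /fin_unif[|h h0 hh] (i : 'I_n) : exists2 h, 0 < h & forall r, 0 < r -> r < d -> b - h < r ->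
      r < b + h -> `|x r 0 i - x b 0 i| < e / (C + 1) by exact: (tx i).2.
    move=> i k k' k'0 k'k hk r r0 rd r1 r2; apply: hk => //.
      by apply: le_lt_trans r1; rewrite lerB.
    by rewrite (lt_le_trans r2) // lerD2l.
  exists (Order.min h (Order.min b (d - b))); split.
    by rewrite !lt_min h0 b0 subr_gt0.
  move=> r.
  have local : 0 < r -> r < d -> b - h < r -> r < b + h -> C * `|x r - x b| <= e.
    move=> r0 rd r1 r2; have nb : `|x r - x b| <= e / (C + 1).
      by apply: norm_le_coord => [|i]; [exact: ltW|rewrite !mxE ltW // hh].
    have : C * `|x r - x b| <= (C + 1) * (e / (C + 1)) by rewrite ler_pM // lerDl.
    by rewrite [X in _ <= X]mulrC divfK // gt_eqF // ltr_wpDl.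
  have m1 : Order.min h (Order.min b (d - b)) <= h by rewrite ge_min lexx.
  have m2 : Order.min h (Order.min b (d - b)) <= b by rewrite !ge_min lexx !orbT.
  have m3 : Order.min h (Order.min b (d - b)) <= d - b by rewrite !ge_min lexx !orbT.
  split=> -[r1 r2].
    have r0 : 0 < r by exact: lt_trans r1.
    have rd : r < d by lra.
    have := step e b r b0 bT r0 rd (local r0 rd ltac:(lra) ltac:(lra)).
    rewrite -(SE b r b0 (ltW r1) rd) ler_norml => /andP[_]; rewrite /H mulrBr; lra.
  have r0 : 0 < r by lra.
  have rd : r < d by lra.
  have := step e b r b0 bT r0 rd (local r0 rd ltac:(lra) ltac:(lra)).
  rewrite (eq_bigr (fun i => `|x b 0 i - x r 0 i|)); last by move=> i _; rewrite distrC.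
  rewrite -(SE r b r0 (ltW r2) bd) ler_norml => /andP[+ _]; rewrite /H mulrBr; lra.
set Y := \sum_i _; have Y0 : 0 <= Y by apply: sumr_ge0.
rewrite leNgt; apply/negP => lt.
set D := peval p (x t) - peval p (x s) - w * Y.
have D0 : 0 < D by rewrite subr_gt0.
have Y1 : 0 < Y + 1 by rewrite ltr_wpDl.
have := main (D / (2 * (Y + 1))) ltac:(by rewrite divr_gt0 // mulr_gt0).
rewrite -/Y mulrDl.
have : D / (2 * (Y + 1)) * Y <= D / 2.
  rewrite mulrAC ler_pdivrMr ?mulr_gt0 //.
  by rewrite (_ : D / 2 * (2 * (Y + 1)) = D * Y + D); [lra|field].
by rewrite /D; move: D0; rewrite /D; lra.
Qed.

End Curves.

(** * Gradient inequality on a box *)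

(** Restricted to the free coordinates [I], so that one statement serves every face of a box. *)
Definition gradsq (R : realType) n (I : pred 'I_n) (f : mpoly n R) : mpoly n R :=
  \sum_(i < n | I i) mderiv i f ^+ 2.

Section Gradient.
Context {R : realType} {n : nat}.
Implicit Types (x y : 'rV[R]_n) (f : mpoly n R) (lo hi : 'rV[R]_n) (I : pred 'I_n).

Lemma gradsqE I f x : peval (gradsq I f) x = \sum_(i < n | I i) peval (mderiv i f) x ^+ 2.
Proof. by rewrite /gradsq /peval raddf_sum; apply: eq_bigr => i _ /=; exact: pevalX. Qed.

Lemma gradsq_ge0 I f x : 0 <= peval (gradsq I f) x.
Proof. by rewrite gradsqE sumr_ge0 // => i _; rewrite sqr_ge0. Qed.

Lemma gradsq_ge I f x i : I i -> peval (mderiv i f) x ^+ 2 <= peval (gradsq I f) x.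
Proof.
move=> Ii; rewrite gradsqE (bigD1 i) //= lerDl sumr_ge0 // => j _; exact: sqr_ge0.
Qed.

Lemma sa_box k lo hi (psi : 'rV[R]_k -> 'rV[R]_n) :
  (forall i, polyfun (fun w => psi w 0 i)) -> sa (fun w => box lo hi (psi w)).
Proof.
move=> h; apply: sa_allI => i; apply: sa_and; apply: sa_le; try exact: polyfun_const; exact: h.
Qed.

Lemma polyfun_pevalv k f (psi : 'rV[R]_k -> 'rV[R]_n) :
  (forall i, polyfun (fun w => psi w 0 i)) -> polyfun (fun w => peval f (psi w)).
Proof. by move=> h; apply: (polyfun_comp h); exact: polyfun_peval. Qed.

(* Along a definable curve of critical points with value [t] at time [t] the value
   would have zero variation. *)
Lemma box_sard lo hi I f : (forall i, ~~ I i -> lo 0 i = hi 0 i) ->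
  exists2 t0, 0 < t0 & forall x, box lo hi x -> 0 < peval f x -> peval f x < t0 ->
    0 < peval (gradsq I f) x.
Proof.
move=> hI; pose M t x := box lo hi x /\ (peval f x = t /\ peval (gradsq I f) x = 0).
have sM : sa (fun w : 'rV[R]_(1 + n) => M (w 0 (lshift n 0)) (rsubmx w)).
  apply: sa_and; first by apply: sa_box => i; polyfun_tac.
  by apply: sa_and; apply: sa_eq; polyfun_tac; apply: polyfun_pevalv => i; polyfun_tac.
have [|ev|ev] := @sa_tame R (fun t => exists x, M t x).
- apply: sa_ex; apply: (@sa_relv _ _ _ M _ _ sM); polyfun_tac.
- exfalso; have [d d0 hd] := ev.
  have [|x dx hx] := @definable_choice _ _ d M d0 sM.
    move=> a a0 ad; split; first exact: hd.
    apply: compact_boxI; apply: closedI; apply: closed_eqfun; try exact: peval_continuous; exact: cst_continuous.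
  have [d' [d'0 d'd] tx] := def_curve_tame d0 dx.
  have xM t : 0 < t -> t < d' -> M t (x t) by move=> t0 td; apply: hx => //; exact: lt_le_trans d'd.
  have T0 : 0 < d' / 2 by rewrite divr_gt0.
  have Td : d' / 2 < d' by lra.
  have := @curve_variation _ _ d' x f 0 (d' / 2) (`|lo| + `|hi|) I tx Td _ (lexx _) _ _ (d' / 2 / 2) (d' / 2).
  have h1 t : 0 < t -> t < d' -> `|x t| <= `|lo| + `|hi| by move=> t0 td; have [/box_norm] := xM t t0 td.
  have h2 i s t : 0 < s -> s < d' -> 0 < t -> t < d' -> ~~ I i -> x s 0 i = x t 0 i.
    move=> s0 sd t0 td nI; have [/(_ i)[a1 a2] _] := xM s s0 sd; have [/(_ i)[b1 b2] _] := xM t t0 td.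
    by apply/eqP; rewrite eq_le; move: a1 a2 b1 b2; rewrite (hI i nI) => a1 a2 b1 b2; apply/andP; split; lra.
  have h3 t i : 0 < t -> t <= d' / 2 -> I i -> `|peval (mderiv i f) (x t)| <= 0.
    move=> t0 td Ii; have [_ [_ e]] := xM t t0 (le_lt_trans td Td).
    have := gradsq_ge f (x t) Ii; rewrite e => h; have := sqr_ge0 (peval (mderiv i f) (x t)) => h'.
    by rewrite normr_le0 -sqrf_eq0 eq_le h h'.
  move=> /(_ h1 h2 h3); rewrite mul0r.
  have [_ [-> _]] := xM (d' / 2) T0 Td.
  have [_ [-> _]] := xM (d' / 2 / 2) ltac:(by rewrite divr_gt0) ltac:(lra).
  by move=> /(_ ltac:(lra) ltac:(lra) (lexx _)); lra.
- have [d d0 hd] := ev; exists d => // x bx f0 fd.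
  rewrite lt_neqAle gradsq_ge0 andbT eq_sym; apply/eqP => e.
  by apply: (hd _ f0 fd); exists x.
Qed.

End Gradient.

Lemma small_all (R : realType) (a b : R) : 0 <= b -> (forall e, 0 < e -> a <= b * e) -> a <= 0.
Proof.
move=> b0 h; rewrite leNgt; apply/negP => a0.
have b1 : 0 < 2 * (b + 1) by rewrite mulr_gt0 // ltr_wpDl.
have := h (a / (2 * (b + 1))) ltac:(by rewrite divr_gt0).
have : b * (a / (2 * (b + 1))) <= a / 2.
  rewrite mulrA ler_pdivrMr // (_ : a / 2 * (2 * (b + 1)) = b * a + a); last by field.
  by lra.
by lra.
Qed.

Lemma ev0_small (R : realType) (e : R) : 0 < e -> ev0 (fun t => t < e).
Proof. by exists e. Qed.

Section GradientCurve.
Context {R : realType} {n : nat}.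
Implicit Types (x y : 'rV[R]_n) (f v : mpoly n R) (lo hi : 'rV[R]_n) (I : pred 'I_n).

Lemma peval_near f x (T : R) : peval f x < T ->
  exists2 e, 0 < e & forall i h, `|h| < e -> peval f (upd x i (x 0 i + h)) < T.
Proof.
move=> fT; have : nbhs (peval f x) (ball (peval f x) (T - peval f x)).
  by apply: nbhsx_ballx; rewrite subr_gt0.
move=> /(@peval_continuous _ _ f x) /nbhs_ballP[e /= e0 he]; exists e => // i h hh.
have := he (upd x i (x 0 i + h)); rewrite /preimage /= -ball_normE /= => /(_ _).
rewrite [`|x - _|]distrC => /(_ (le_lt_trans (upd_dist _ _ _) hh)).
rewrite -ball_normE /= distrC => h'; have := ler_norm (peval f (upd x i (x 0 i + h)) - peval f x).
by lra.
Qed.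

Lemma box_critical p lo hi x i (T : R) f : box lo hi x -> peval f x < T ->
  (forall y, box lo hi y -> peval f y <= T -> peval p y <= peval p x) ->
  [\/ x 0 i = lo 0 i, x 0 i = hi 0 i | peval (mderiv i p) x = 0].
Proof.
move=> bx fT hmax; have [e|nl] := eqVneq (x 0 i) (lo 0 i); first by constructor 1.
have [e|nu] := eqVneq (x 0 i) (hi 0 i); first by constructor 2.
constructor 3; have [e e0 he] := box_vary bx nl nu; have [e' e'0 he'] := peval_near fT.
have := @slope_bound _ _ (- p) x i 0 (Order.min e e') (lexx _) ltac:(by rewrite lt_min e0).
rewrite normr_le0 => /(_ _)/eqP h; apply/eqP; rewrite -oppr_eq0 -pevalN -mderivN; apply/eqP/h.
move=> k; rewrite lt_min => /andP[k1 k2].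
by rewrite mul0r subr0 !pevalN lerN2; apply: hmax; [exact: he|exact/ltW/he'].
Qed.

(** The interface between elimination and analysis. Elimination of all coordinates yields the first
    alternative, a bound by the parameter [a]; in the plane the second one arises, a bound by the
    value of [f]. *)
Definition critical_bound f v lo hi I (l : nat) x0 : Prop := exists C d, [/\ 0 <= C, 0 < d &
  forall a x, 0 < a -> a < d -> box lo hi x -> `|x - x0| < d -> 0 < peval f x -> peval f x < d ->
    0 < peval (gradsq I f) x ->
    (forall i, [\/ x 0 i = lo 0 i, x 0 i = hi 0 i |
      peval (mderiv i (a *: f - gradsq I f - a ^+ 4 *: v)) x = 0]) ->
    `|x - x0| ^+ l <= C * a \/ `|x - x0| ^+ l.+2 <= C * peval f x].

(* The maximisers [x a] of [a f - |grad f|^2 - a^4 v] form a curve ending at a zero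
   of [f] along which [f] varies no faster than [|grad f|] allows. *)
Lemma gradient_curve f v lo hi I (l : nat) (t0 T0 : R) : (0 < l)%N -> T0 < t0 -> 0 < T0 ->
  (forall i, ~~ I i -> lo 0 i = hi 0 i) -> (forall x, box lo hi x -> 0 <= peval f x) ->
  (forall x, box lo hi x -> 0 < peval f x -> peval f x < t0 -> 0 < peval (gradsq I f) x) ->
  (forall x0, critical_bound f v lo hi I l x0) ->
  (forall a, 0 < a -> exists x, [/\ box lo hi x, peval f x <= T0 & peval (gradsq I f) x < a * peval f x]) ->
  exists C B d, [/\ 0 <= C, 0 <= B, 0 < d & forall a, 0 < a -> a < d ->
    exists2 t, 0 <= t /\ t ^+ l <= C * a ^+ l.+2 &
      forall y, box lo hi y -> peval f y <= T0 ->
        a * peval f y - peval (gradsq I f) y <= a * t + 2 * B * a ^+ 4].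
Proof.
move=> l0 Tt T00 hI fpos sard fo nA; have l3 : (l.+2 <= 3 * l)%N by lia.
set u := gradsq I f.
pose h a : mpoly n R := a *: f - u - a ^+ 4 *: v.
have hE a x : peval (h a) x = a * peval f x - peval u x - a ^+ 4 * peval v x.
  by rewrite /h !pevalB (pevalZ a f) (pevalZ (a ^+ 4) v).
pose M a x := (box lo hi x /\ peval f x <= T0) /\
  forall y, box lo hi y /\ peval f y <= T0 ->
    a * peval f y - peval u y - a ^+ 4 * peval v y <= a * peval f x - peval u x - a ^+ 4 * peval v x.
have sM : sa (fun w : 'rV[R]_(1 + n) => M (w 0 (lshift n 0)) (rsubmx w)).
  rewrite /M; apply: sa_and.
    apply: sa_and; first by apply: sa_box => i; polyfun_tac.
    by apply: sa_le; polyfun_tac; apply: polyfun_pevalv => i; polyfun_tac.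
  apply: sa_all; cbv beta; apply: sa_imp.
    apply: sa_and; first by apply: sa_box => i; polyfun_tac.
    by apply: sa_le; polyfun_tac; apply: polyfun_pevalv => i; polyfun_tac.
  by apply: sa_le; polyfun_tac; apply: polyfun_pevalv => i; polyfun_tac.
have [B B0 hB'] := taylor v (`|lo| + `|hi|).
have hB x : box lo hi x -> `|peval v x| <= B.
  by move=> /box_norm bx; have [] := hB' x x bx bx.
have clT : closed [set x | peval f x <= T0].
  by apply: closed_lefun; [exact: peval_continuous|exact: cst_continuous].
have [z [bz fz _]] := nA 1 ltr01.
have [x dx hx] : exists2 x, def_curve 1 x & forall a, 0 < a -> a < 1 -> M a (x a).
  apply: definable_choice => // a a0 a1; split.
    have [c [bc fc] hc] := compact_argmin (ex_intro _ z (conj bz fz)) (compact_boxI (lo := lo) (hi := hi) clT)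
      (@peval_continuous _ _ (- h a)).
    exists c; split=> // y [by_ fy]; have := hc y (conj by_ fy).
    by rewrite !pevalN lerN2 !hE.
  have -> : [set v | M a v] = [set x | box lo hi x] `&` ([set x | peval f x <= T0] `&`
    [set x | forall y, box lo hi y /\ peval f y <= T0 -> peval (h a) y <= peval (h a) x]).
    apply/seteqP; split=> y /=; rewrite /M; first by move=> [[? ?] k]; split=> //; split=> // w kw; rewrite !hE k.
    by move=> [? [? k]]; split=> // w kw; rewrite -!hE k.
  apply: compact_boxI; apply: closedI => //.
  apply: (@closed_forall _ _ _ (fun y => [set x | box lo hi y /\ peval f y <= T0 -> peval (h a) y <= peval (h a) x])) => y.
  have [ky|nky] := pselect (box lo hi y /\ peval f y <= T0).
    rewrite (_ : [set x | _] = [set x | peval (h a) y <= peval (h a) x]).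
      by apply: closed_lefun; [exact: cst_continuous|exact: peval_continuous].
    by apply/seteqP; split=> w /=; [exact|].
  rewrite (_ : [set x | _] = setT); first exact: closedT.
  by apply/seteqP; split=> w /=; [|move=> _ /nky].
have [d1 [d10 d11] tx] := def_curve_tame ltr01 dx.
have [d2 [d20 d21] [um _]] := definable_mono_cont ltr01 (def_on_curve dx (polyfun_peval u)).
have xbox t : 0 < t -> t < 1 -> box lo hi (x t) by move=> a0 a1; exact: (hx t a0 a1).1.1.
have xT t : 0 < t -> t < 1 -> peval f (x t) <= T0 by move=> a0 a1; exact: (hx t a0 a1).1.2.
(* By [nA] some point makes [t f - u] positive, and the maximiser does at least as well up to the
   perturbation. *)
have u_le t : 0 < t -> t < 1 -> peval u (x t) <= t * peval f (x t) + 2 * B * t ^+ 4.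
  move=> a0 a1; have [w [bw fw uw]] := nA t a0; have := (hx t a0 a1).2 w (conj bw fw).
  have := hB _ bw; have := hB _ (xbox t a0 a1); rewrite !ler_norml => /andP[b1 _] /andP[_ b2].
  have t4 : 0 <= t ^+ 4 by rewrite exprn_ge0 // ltW.
  have := ler_wpM2l t4 b1; have := ler_wpM2l t4 b2; rewrite -/u in uw *; rewrite mulrN; lra.
have u0 := gradsq_ge0 I f : forall x, 0 <= peval u x.
have xn t : 0 < t -> t < d1 -> `|x t| <= `|lo| + `|hi|.
  by move=> a0 a1; apply: box_norm; apply: xbox => //; exact: lt_le_trans d11.
have [x0 hx0] := curve_limit d10 xn tx.
have ev1 : ev0 (fun t : R => t < 1) by exact: ev0_small.
have evu e : 0 < e -> ev0 (fun t => peval u (x t) < e).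
  move=> e0; have c0 : 0 < T0 + 2 * B + 1 by rewrite ltr_wpDl // addr_ge0 ?(ltW T00) // mulr_ge0.
  have := ev0_and ev1 (ev0_small (divr_gt0 e0 c0)); apply: ev0_imp => t a0 [a1].
  rewrite ltr_pdivlMr // => te; apply: le_lt_trans (u_le t a0 a1) _; apply: le_lt_trans te.
  have t4 : t ^+ 4 <= t by rewrite exprS ler_piMr ?(ltW a0) // exprn_ile1 // ltW.
  have := ler_wpM2l (ltW a0) (xT t a0 a1); have := ler_wpM2l B0 t4; lra.
have limu := limit_continuous (@peval_continuous _ _ u) hx0.
have limf := limit_continuous (@peval_continuous _ _ f) hx0.
have bx0 : box lo hi x0.
  have k i e : 0 < e -> lo 0 i - e <= x0 0 i /\ x0 0 i <= hi 0 i + e.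
    move=> e0; have [t a0 [a1 ht]] := ev0_ex (ev0_and ev1 (hx0 e e0)).
    have [b1 b2] := xbox t a0 a1 i; have := le_lt_trans (coord_le_norm (x t - x0) i) ht.
    by rewrite !mxE ltr_norml => /andP[c1 c2]; split; lra.
  move=> i; split; rewrite -subr_le0; apply: (@small_all _ _ 1) => // e /(k i)[k1 k2]; lra.
have ux0 : peval u x0 <= 0.
  apply: (@small_all _ _ 2) => // e e0; have [t a0 [ht1 ht2]] := ev0_ex (ev0_and (evu e e0) (limu e e0)).
  by move: ht2; rewrite ltr_norml => /andP[]; lra.
have fx0T : peval f x0 <= T0.
  rewrite -subr_le0; apply: (@small_all _ _ 1) => // e e0.
  have [t a0 [a1 ht2]] := ev0_ex (ev0_and ev1 (limf e e0)).
  by have := xT t a0 a1; move: ht2; rewrite ltr_norml => /andP[]; lra.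
have fx0 : peval f x0 = 0.
  apply/eqP; rewrite eq_le fpos // andbT leNgt; apply/negP => fp.
  by have := sard _ bx0 fp (le_lt_trans fx0T Tt); rewrite ltNge ux0.
(* Along the curve [u] is monotone, nonnegative and tends to [0]; were it decreasing in [t], it
   would vanish identically. *)
have umono s t : 0 < s -> s <= t -> t < d2 -> peval u (x s) <= peval u (x t).
  case: um => um s0 st td; first exact: um.
  apply: le_trans (u0 _); apply: (@small_all _ _ 1) => // e e0; rewrite mul1r.
  have [r r0 [r1 r2]] := ev0_ex (ev0_and (evu e e0) (ev0_small s0)).
  by apply: ltW; apply: le_lt_trans r1; apply: um => //; [exact: ltW|exact: le_lt_trans td].
pose dd := Order.min d1 d2.
have dd0 : 0 < dd by rewrite lt_min d10.
have ddle : dd <= d1 /\ dd <= d2 by rewrite /dd !ge_min !lexx orbT.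
(* Up to time [t] every free derivative of [f] is bounded by the square root of [u] at time [t],
   since [u] increases along the curve; the variation of [f] is measured from its zero [x0]. *)
have flen t : 0 < t -> t < dd -> peval f (x t) <= Num.sqrt (peval u (x t)) * (n%:R * `|x t - x0|).
  move=> a0 ad; have td1 : t < d1 by exact: lt_le_trans ddle.1.
  have td2 : t < d2 by exact: lt_le_trans ddle.2.
  have xfix i s r : 0 < s -> s < d1 -> 0 < r -> r < d1 -> ~~ I i -> x s 0 i = x r 0 i.
    move=> s0 sd r0 rd nI.
    have [a1 a2] := xbox s s0 (lt_le_trans sd d11) i; have [b1 b2] := xbox r r0 (lt_le_trans rd d11) i.
    by apply/eqP; rewrite eq_le; move: a1 a2 b1 b2; rewrite (hI i nI) => a1 a2 b1 b2; apply/andP; split; lra.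
  have slope s i : 0 < s -> s <= t -> I i -> `|peval (mderiv i f) (x s)| <= Num.sqrt (peval u (x t)).
    move=> s0 st Ii; rewrite -sqrtr_sqr ler_wsqrtr //.
    by apply: le_trans (gradsq_ge f (x s) Ii) _; exact: umono.
  have var := curve_variation tx td1 xn (sqrtr_ge0 (peval u (x t))) xfix slope.
  set r := Num.sqrt _ in var *; have r0 : 0 <= r by exact: sqrtr_ge0.
  rewrite -subr_le0; apply: (@small_all _ _ (1 + r * n%:R)); first by rewrite addr_ge0 // mulr_ge0.
  move=> e e0; have [s s0 [[hs1 hs2] st]] := ev0_ex (ev0_and (ev0_and (limf e e0) (hx0 e e0)) (ev0_small a0)).
  have := var s t s0 (ltW st) (lexx _).
  have : r * \sum_i `|x t 0 i - x s 0 i| <= r * (n%:R * (`|x t - x0| + e)).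
    rewrite ler_wpM2l // -[X in X%:R]card_ord -sum1_card natr_sum mulr_suml; apply: ler_sum => i _.
    rewrite mul1r (_ : x t 0 i - x s 0 i = (x t - x0 - (x s - x0)) 0 i); last by rewrite !mxE; ring.
    rewrite (le_trans (coord_le_norm _ _)) // (le_trans (ler_normB _ _)) // lerD2l; exact: ltW.
  rewrite fx0 subr0 in hs1; have := le_lt_trans (ler_norm _) hs1; rewrite mulrDr; lra.
have [C2 [d3 [C20 d30 hfo]]] := fo x0.
pose C1 := (1 + 2 * B) * n%:R ^+ 2; have C10 : 0 <= C1 by rewrite mulr_ge0 ?exprn_ge0 // addr_ge0 // mulr_ge0.
have evd : ev0 (fun t => t < dd /\ t < 1) by apply: ev0_and => //; exact: ev0_small.
have evf : ev0 (fun t => (`|peval f (x t) - peval f x0| < d3 /\ `|peval f (x t) - peval f x0| < T0) /\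
    (`|x t - x0| < d3 /\ t < d3)).
  apply: ev0_and; apply: ev0_and; [exact: limf|exact: limf|exact: hx0|exact: ev0_small].
have [d d0 hd] := ev0_and evd evf.
have P1 : 0 <= C1 ^+ l * C2 ^+ 2 by rewrite mulr_ge0 ?exprn_ge0.
have P2 : 0 <= C1 ^+ l.+2 * C2 ^+ 2 by rewrite mulr_ge0 ?exprn_ge0.
exists (1 + C1 ^+ l * C2 ^+ 2 + C1 ^+ l.+2 * C2 ^+ 2), B, d; split=> //; first by rewrite !addr_ge0.
move=> t a0 ad; have [[tdd t1] [[fd3 fT0] [xd3 td3]]] := hd t a0 ad.
have bxt := xbox t a0 t1; have f0 := fpos _ bxt.
exists (peval f (x t)); last first.
  move=> y by_ fy; have := (hx t a0 t1).2 y (conj by_ fy).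
  have := hB _ by_; have := hB _ bxt; rewrite !ler_norml => /andP[b1 _] /andP[_ b2].
  have t4 : 0 <= t ^+ 4 by rewrite exprn_ge0 // ltW.
  have := ler_wpM2l t4 b1; have := ler_wpM2l t4 b2; have := u0 (x t); rewrite mulrN; lra.
split=> //; set F := peval f (x t) in f0 *; set D := `|x t - x0| in xd3.
rewrite fx0 subr0 -/F ger0_norm // in fd3; rewrite fx0 subr0 -/F ger0_norm // in fT0.
have D0 : 0 <= D by exact: normr_ge0.
have tl : 0 <= t ^+ l.+2 by rewrite exprn_ge0 // ltW.
rewrite mulrDl mulrDl mul1r.
have A1 : 0 <= C1 ^+ l * C2 ^+ 2 * t ^+ l.+2 by exact: mulr_ge0.
have A2 : 0 <= C1 ^+ l.+2 * C2 ^+ 2 * t ^+ l.+2 by exact: mulr_ge0.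
(* If [F <= t ^ 3] the claim holds because [l + 2 <= 3 l]. Otherwise the perturbation is absorbed:
   [t ^ 4 < t F]. *)
have [Ft|tF] := leP F (t ^+ 3).
  apply: (@le_trans _ _ (t ^+ l.+2)); last by lra.
  apply: (@le_trans _ _ ((t ^+ 3) ^+ l)); first by rewrite lerXn2r ?nnegrE // exprn_ge0 // ltW.
  by rewrite -exprM ler_wiXn2l ?(ltW a0) ?(ltW t1).
have F0 : 0 < F by apply: lt_trans tF; rewrite exprn_gt0.
have uF : peval u (x t) <= (1 + 2 * B) * (t * F).
  apply: le_trans (u_le t a0 t1) _; rewrite -/F.
  rewrite (_ : (1 + 2 * B) * (t * F) = t * F + 2 * B * (t * F)); last by ring.
  have t4 : t ^+ 4 <= t * F by rewrite exprS ler_wpM2l ?(ltW a0) ?(ltW tF).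
  by apply: lerD => //; apply: ler_wpM2l t4; rewrite mulr_ge0.
(* Squaring [flen], inserting [u <= (1 + 2 B) t F] and dividing by [F]. Either alternative for [D]
   then turns this into a bound of [F ^ l] by [t ^ (l + 2)], after division by [F ^ 2] in the
   second. *)
have FC : F <= C1 * t * D ^+ 2.
  rewrite -(ler_pM2r F0); have := flen t a0 tdd; rewrite -/F -/D => hF.
  have : F ^+ 2 <= (Num.sqrt (peval u (x t)) * (n%:R * D)) ^+ 2.
    by rewrite lerXn2r ?nnegrE // mulr_ge0 ?sqrtr_ge0 // mulr_ge0.
  rewrite exprMn sqr_sqrtr // -expr2 => /le_trans; apply.
  have := ler_wpM2r (sqr_ge0 (n%:R * D)) uF; move=> /le_trans; apply.
  by rewrite /C1 le_eqVlt; apply/orP; left; apply/eqP; ring.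
clearbody C1; have CtD : 0 <= C1 * t * D ^+ 2 by exact: le_trans FC.
have crit i : [\/ x t 0 i = lo 0 i, x t 0 i = hi 0 i | peval (mderiv i (h t)) (x t) = 0].
  apply: (box_critical i bxt fT0) => y by_ fy; rewrite !hE; exact: (hx t a0 t1).2.
have powE k : (C1 * t * D ^+ 2) ^+ k = C1 ^+ k * t ^+ k * (D ^+ k) ^+ 2.
  by rewrite exprMn exprMn exprAC.
case: (hfo t (x t) a0 td3 bxt xd3 F0 fd3 (sard _ bxt F0 (lt_trans fT0 Tt)) crit); rewrite -/D -/F => HD.
  apply: (@le_trans _ _ (C1 ^+ l * C2 ^+ 2 * t ^+ l.+2)); last by lra.
  apply: (@le_trans _ _ ((C1 * t * D ^+ 2) ^+ l)); first by rewrite lerXn2r ?nnegrE.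
  rewrite powE (_ : C1 ^+ l * C2 ^+ 2 * t ^+ l.+2 = C1 ^+ l * t ^+ l * (C2 * t) ^+ 2); last first.
    by rewrite (_ : t ^+ l.+2 = t ^+ l * t ^+ 2); [ring|rewrite -exprD addn2].
  rewrite ler_wpM2l ?mulr_ge0 ?exprn_ge0 ?(ltW a0) // lerXn2r ?nnegrE ?exprn_ge0 //.
  by rewrite mulr_ge0 // ltW.
apply: (@le_trans _ _ (C1 ^+ l.+2 * C2 ^+ 2 * t ^+ l.+2)); last by lra.
rewrite -(ler_pM2r (exprn_gt0 2 F0)) -exprD addn2.
apply: (@le_trans _ _ ((C1 * t * D ^+ 2) ^+ l.+2)); first by rewrite lerXn2r ?nnegrE.
rewrite powE (_ : C1 ^+ l.+2 * C2 ^+ 2 * t ^+ l.+2 * F ^+ 2 = C1 ^+ l.+2 * t ^+ l.+2 * (C2 * F) ^+ 2); last by ring.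
apply: ler_wpM2l; first by rewrite mulr_ge0 ?exprn_ge0 ?(ltW a0).
have DF : 0 <= D ^+ l.+2 /\ 0 <= C2 * F by split; [exact: exprn_ge0|exact: mulr_ge0].
by rewrite lerXn2r ?nnegrE ?DF.1 ?DF.2.
Qed.

End GradientCurve.

Section GradientInequality.
Context {R : realType} {n : nat}.
Implicit Types (x y : 'rV[R]_n) (f v : mpoly n R) (lo hi : 'rV[R]_n) (I : pred 'I_n).

(** Here [q] is the root of [f] of order [l + 2], so this bounds the gradient below by [f] to the
    power [1 - 1 / (l + 2)]. The estimate for the maximum of [a f - |grad f| ^ 2] is applied at each
    point with its own value of [a]. *)
Lemma gradient_inequality f v lo hi I (l : nat) : (0 < l)%N ->
  (forall i, ~~ I i -> lo 0 i = hi 0 i) -> (forall x, box lo hi x -> 0 <= peval f x) ->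
  (forall x0, critical_bound f v lo hi I l x0) ->
  exists2 c, 0 < c & forall x q, box lo hi x -> 0 <= q -> peval f x = q ^+ l.+2 -> 0 < peval f x ->
    peval f x < c -> c * q ^+ (2 * l.+1) <= peval (gradsq I f) x.
Proof.
move=> l0 hI fpos fo; have l3 : (l.+2 <= 3 * l)%N by lia.
have l2 : (l.+2 <= 2 * l.+1)%N by lia.
have l22 : (2 * l.+1 = l + l.+2)%N by lia.
have [t0 t00 sard] := box_sard f hI.
pose T0 := t0 / 2; have T00 : 0 < T0 by rewrite divr_gt0.
have Tt : T0 < t0 by rewrite /T0; lra.
have q01 (q : R) : 0 <= q -> q ^+ l.+2 < 1 -> q < 1.
  by move=> q0; rewrite expr_lt1.
(* Either some fixed multiple of [f] bounds the squared gradient below, which is more than enough,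
   or the failure for every [a] is the last hypothesis of [gradient_curve]. *)
have [[a [a0 ha]]|nA] := pselect (exists a, 0 < a /\ forall x, box lo hi x -> peval f x <= T0 ->
    a * peval f x <= peval (gradsq I f) x).
  exists (Order.min a (Order.min 1 T0)); first by rewrite !lt_min a0 ltr01.
  move=> x q bx q0 fq f0; rewrite !lt_min => /and3P[_ f1 fT].
  apply: le_trans (ha _ bx (ltW fT)); apply: ler_pM; rewrite ?exprn_ge0 ?ge_min ?lexx //.
    by rewrite !le_min (ltW a0) ler01 ltW.
  by rewrite fq ler_wiXn2l // ltW // q01 // -fq.
have [|C [B [d [C0 B0 d0 H]]]] := @gradient_curve _ _ f v lo hi I l t0 T0 l0 Tt T00 hI fpos sard fo.
  move=> a a0; apply/not_existsP => no; apply: nA; exists a; split=> // x bx fT.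
  by rewrite leNgt; apply/negP => lt; apply: (no x).
have p4 : 0 < (4^-1 : R) ^+ l by rewrite exprn_gt0.
(* [kC] keeps the value of [f] on the curve below a quarter of [q ^ (l + 2)] and [kB] does the same
   for the perturbation divided by [a], which leaves half of [a f] for the gradient. *)
pose k := Order.min (d / 2) (Order.min 1 (Order.min (4^-1 ^+ l / (C + 1)) (1 / (8 * (B + 1))))).
have k0 : 0 < k by rewrite !lt_min ltr01 !divr_gt0 // ?mulr_gt0 // ltr_wpDl.
have kd : k < d by apply: (@le_lt_trans _ _ (d / 2)); [rewrite ge_min lexx|lra].
have k1 : k <= 1 by rewrite /k !ge_min lexx !orbT.
have kC : C * k <= 4^-1 ^+ l.
  have : k <= 4^-1 ^+ l / (C + 1) by rewrite /k !ge_min lexx !orbT.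
  rewrite ler_pdivlMr ?ltr_wpDl // => h; apply: le_trans h.
  by rewrite mulrC ler_wpM2l ?(ltW k0) // lerDl.
have kB : 2 * B * k <= 4^-1.
  have : k <= 1 / (8 * (B + 1)) by rewrite /k !ge_min lexx !orbT.
  rewrite ler_pdivlMr ?mulr_gt0 ?ltr_wpDl //; lra.
clearbody k; exists (Order.min (k / 2) (Order.min 1 T0)).
  by rewrite !lt_min ltr01 divr_gt0.
move=> x q bx q0 fq f0; rewrite !lt_min => /and3P[_ f1 fT].
have qp : 0 < q.
  by rewrite lt_neqAle q0 andbT eq_sym; apply/eqP => e; move: f0; rewrite fq e expr0n ltxx.
have q1 : q < 1 by apply: q01 => //; rewrite -fq.
(* With this [a] the bound [C a ^ (l + 2)] is the [l]-th power of [q ^ (l + 2)] up to a constant.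
   The perturbation is small because [q ^ (3 l) <= q ^ (l + 2)], which relies on the power
   [a ^ 4]. *)
pose a := k * q ^+ l.
have a0 : 0 < a by rewrite mulr_gt0 // exprn_gt0.
have ad : a < d by apply: le_lt_trans kd; rewrite ler_piMr ?(ltW k0) // exprn_ile1 // ltW.
have [t [tp ht] hy] := H a a0 ad.
have s0 : 0 <= q ^+ l.+2 by rewrite exprn_ge0.
have t4 : t <= 4^-1 * q ^+ l.+2.
  have r0 : 0 <= 4^-1 * q ^+ l.+2 by rewrite mulr_ge0 ?invr_ge0.
  rewrite -(ler_pXn2r l0) ?nnegrE //; apply: (le_trans ht).
  have -> : C * a ^+ l.+2 = C * k ^+ l.+2 * (q ^+ l.+2) ^+ l by rewrite /a exprMn mulrA exprAC.
  rewrite [X in _ <= X]exprMn; apply: ler_wpM2r; first by rewrite exprn_ge0.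
  by apply: le_trans kC; rewrite ler_wpM2l // exprS ler_piMr ?(ltW k0) // exprn_ile1 //; exact: ltW.
have Ba : 2 * B * a ^+ 4 <= a * (4^-1 * q ^+ l.+2).
  have -> : 2 * B * a ^+ 4 = a * (2 * B * k ^+ 3 * (q ^+ l) ^+ 3).
    by rewrite exprS /a; ring.
  apply: ler_wpM2l; first exact: ltW.
  apply: ler_pM; rewrite ?exprn_ge0 // ?mulr_ge0 ?exprn_ge0 ?(ltW k0) //.
    by apply: le_trans kB; rewrite ler_wpM2l ?mulr_ge0 // exprS ler_piMr ?(ltW k0) // exprn_ile1 //; exact: ltW.
  by rewrite -exprM ler_wiXn2l ?(ltW q1) // mulnC.
have := hy x bx (ltW fT); rewrite fq => h.
have at4 := ler_wpM2l (ltW a0) t4.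
apply: (@le_trans _ _ (a * (q ^+ l.+2 / 2))); last by lra.
have -> : a * (q ^+ l.+2 / 2) = k / 2 * q ^+ (2 * l.+1).
  by rewrite l22 exprD /a; ring.
by rewrite ler_wpM2r ?exprn_ge0 // ge_min lexx.
Qed.

Definition side lo hi (s : 'I_3) (j : 'I_n) : R := if s == 1 then lo 0 j else hi 0 j.

Lemma side_pattern lo hi x (P : 'I_n -> Prop) :
  (forall i, [\/ x 0 i = lo 0 i, x 0 i = hi 0 i | P i]) ->
  exists s : {ffun 'I_n -> 'I_3}, forall i, if s i == 0 then P i else x 0 i = side lo hi (s i) i.
Proof.
move=> h; exists [ffun i => if x 0 i == lo 0 i then 1 else if x 0 i == hi 0 i then inord 2 else 0].
have i2 : (inord 2 : 'I_3) != 0 /\ (inord 2 : 'I_3) != 1 by split; rewrite -val_eqE /= inordK.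
move=> i; rewrite ffunE /side; have [e|nl] := eqVneq (x 0 i) (lo 0 i); first by rewrite /= e.
have [e|nu] := eqVneq (x 0 i) (hi 0 i); first by rewrite (negbTE i2.1) (negbTE i2.2) e.
by rewrite eqxx; case: (h i) => // e; [move: nl|move: nu]; rewrite e eqxx.
Qed.

(** Fixes the face and one coordinate: both range over finite sets, and the maximum norm is attained
    at a coordinate. *)
Lemma critical_bound_sides f v lo hi I l x0 : (0 < l)%N ->
  (forall (s : {ffun 'I_n -> 'I_3}) i, exists2 k, 0 < k & forall a x, 0 < a -> a < k ->
    `|x - x0| < k -> 0 < peval f x -> peval f x < k -> 0 < peval (gradsq I f) x ->
    (forall j, if s j == 0 then peval (mderiv j (a *: f - gradsq I f - a ^+ 4 *: v)) x = 0
               else x 0 j = side lo hi (s j) j) ->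
    k * `|x 0 i - x0 0 i| ^+ l <= a \/ k * `|x 0 i - x0 0 i| ^+ l.+2 <= peval f x) ->
  critical_bound f v lo hi I l x0.
Proof.
move=> l0 H.
have [||k k0 hk] := @fin_unif R ({ffun 'I_n -> 'I_3} * 'I_n)%type (fun si k => forall a x, 0 < a -> a < k ->
    `|x - x0| < k -> 0 < peval f x -> peval f x < k -> 0 < peval (gradsq I f) x ->
    (forall j, if si.1 j == 0 then peval (mderiv j (a *: f - gradsq I f - a ^+ 4 *: v)) x = 0
               else x 0 j = side lo hi (si.1 j) j) ->
    k * `|x 0 si.2 - x0 0 si.2| ^+ l <= a \/ k * `|x 0 si.2 - x0 0 si.2| ^+ l.+2 <= peval f x).
- move=> [s i] k k' k'0 k'k h a x a0 ak xk fp fk up c.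
  have kk (r : R) : 0 <= r -> k' * r <= k * r by move=> r0; exact: ler_wpM2r.
  case: (h a x a0 (lt_le_trans ak k'k) (lt_le_trans xk k'k) fp (lt_le_trans fk k'k) up c) => e; [left|right].
    by apply: le_trans e; apply: kk; rewrite exprn_ge0.
  by apply: le_trans e; apply: kk; rewrite exprn_ge0.
- by move=> [s i]; exact: H.
exists k^-1, k; split=> //; first by rewrite invr_ge0 ltW.
move=> a x a0 ak bx xk fp fk up /side_pattern[s hs].
have [e|ne] := eqVneq (x - x0) 0.
  by left; rewrite e normr0 expr0n gtn_eqF // mulr_ge0 ?invr_ge0 // ltW.
have [i] := norm_coord_eq ne; rewrite !mxE => ->.
case: (hk (s, i) a x a0 ak xk fp fk up hs) => /= e; [left|right].
  by rewrite mulrC ler_pdivlMr // mulrC.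
by rewrite mulrC ler_pdivlMr // mulrC.
Qed.

Lemma msize_gradsq I f D : (mmeasure mdeg f <= D.+1)%N ->
  (mmeasure mdeg (gradsq I f) <= (2 * D.-1).+1)%N.
Proof.
move=> sf; apply: leq_trans (mmeasure_sum _ _ _ _) _; apply/bigmax_leqP => i _.
by apply: msizeX_le; exact: msize_mderiv.
Qed.

(** The partial derivatives of [v] are the pure powers of degree [m = 2 D - 3], the degree bound for
    those of [|grad f| ^ 2]. Up to sign the critical equations have the shape required by
    elimination with [q = 4]. As [v] is centred at the origin, it serves every limit point [x0]. *)
Lemma critical_bound_high f lo hi I x0 D l : (1 < D)%N -> (mmeasure mdeg f <= D.+1)%N ->
  ((2 * D - 3) ^ n <= l)%N ->
  critical_bound f ((2 * D - 2)%:R^-1 *: \sum_(j < n) mpolyX R (mnm1 j) ^+ (2 * D - 2)) lo hi I l x0.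
Proof.
move=> D1 sf lE; set v := _ *: _; set m := (2 * D - 3)%N in lE *.
have m0 : (0 < m)%N by rewrite /m; lia.
have mE : (2 * D - 2)%N = m.+1 by rewrite /m; lia.
have l0 : (0 < l)%N by apply: leq_trans lE; rewrite expn_gt0 m0.
have dv x j : peval (mderiv j v) x = x 0 j ^+ m.
  rewrite mderivZ pevalZ mderiv_sum pevalsum (bigD1 j) //= big1 ?addr0.
    rewrite mderivXn mderivXU eqxx pevalZ pevalM pevalX pevalXU pevalC mE /=.
    by rewrite mulr1 mulrA mulVf ?mul1r // pnatr_eq0.
  move=> k kj; rewrite mderivXn mderivXU eq_sym (negbTE kj).
  by rewrite mpolyC0 mulr0 scaler0 peval0.
apply: critical_bound_sides => // s i.
pose phi0 j x := if s j == 0 then peval (mderiv j (gradsq I f)) x else 0.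
pose phi1 j x := if s j == 0 then - peval (mderiv j f) x else 0.
pose phi2 j x := if s j == 0 then 0 else (x 0 j - side lo hi (s j) j) ^+ m - x 0 j ^+ m.
have [||||P [P0 sP] hP] := @elimination_real R n m 4 phi0 phi1 phi2 m0 isT _ _ _ _ i.
- move=> j; rewrite /phi0; case: eqP => _; last exact: pfun_const.
  by apply: pfun_le (pfun_mderiv j (msize_gradsq I sf)); rewrite /m; lia.
- move=> j; rewrite /phi1; case: eqP => _; last exact: pfun_const.
  by apply: pfunN; apply: pfun_le (pfun_mderiv j sf); rewrite /m; lia.
- by move=> j; rewrite /phi2; case: eqP => _; [exact: pfun_const|exact: pfun_powB].
- by [].
have [k k0 hk] := newton_bound1 (x0 0 i) P0 sP.
exists (Order.min k 1); first by rewrite lt_min k0 ltr01.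
move=> a x a0; rewrite lt_min => /andP[ak _]; rewrite lt_min => /andP[xk x1] _ _ _ hs; left.
have xi : `|x 0 i - x0 0 i| <= `|x - x0| by have := coord_le_norm (x - x0) i; rewrite !mxE.
apply: (@le_trans _ _ (k * `|x 0 i - x0 0 i| ^+ (m ^ n))).
  apply: ler_pM; rewrite ?exprn_ge0 ?ge_min ?lexx ?le_min ?ler01 ?(ltW k0) //.
  by rewrite ler_wiXn2l // (le_trans xi) // ltW.
apply: hk => //; first exact: le_lt_trans xk.
apply: hP => j; have := hs j; rewrite /phi0 /phi1 /phi2; case: eqP => _.
  rewrite mderivB mderivB (mderivZ j a f) (mderivZ j _ v) pevalB pevalB.
  rewrite (pevalZ a (mderiv j f)) (pevalZ _ (mderiv j v)) dv => e.
  by rewrite -[LHS]opprK -[RHS]oppr0; congr (- _); rewrite -[RHS]e; ring.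
move=> e; rewrite (_ : _ + _ = a ^+ 4 * (x 0 j - side lo hi (s j) j) ^+ m); last by ring.
by rewrite e subrr expr0n gtn_eqF // mulr0.
Qed.

End GradientInequality.

(* Where both partial derivatives of [a f - |grad f|^2 - a^4 v] vanish, so does the
   Jacobian of [f] and [|grad f|^2 + a^4 v]. *)
Lemma critical_bound_plane (R : realType) (f : mpoly 2 R) lo hi I D l : (1 < D)%N ->
  (mmeasure mdeg f <= D.+1)%N -> (l.+2 = D * (3 * D - 3))%N ->
  exists v, forall x0, critical_bound f v lo hi I l x0.
Proof.
(* The Jacobian has degree at most [(2 D - 3) + (D - 1)], one less than [e]. *)
move=> D1 sf lE; set e := (3 * D - 3)%N in lE.
pose i0 : 'I_2 := ord0; pose i1 : 'I_2 := ord_max.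
have l0 : (0 < l)%N by have : (1 < D * e.-1)%N; rewrite /e in lE *; nia.
set u := gradsq I f.
have su : (mmeasure mdeg u <= (2 * D.-1).+1)%N by exact: msize_gradsq.
have sd i : (mmeasure mdeg (mderiv i f) <= e.+1)%N.
  by apply: leq_trans (msize_mderiv i sf) _; rewrite /e; lia.
have sM i j : (mmeasure mdeg (mderiv i u * mderiv j f) <= e.+1)%N.
  apply: leq_trans (msizeM_leD (msize_mderiv i su) (msize_mderiv j sf)) _; rewrite /e; lia.
pose J := mderiv i0 u * mderiv i1 f - mderiv i1 u * mderiv i0 f.
have sJ : (mmeasure mdeg J <= e.+1)%N.
  by apply: leq_trans (mmeasureD_le _ _ _) _; rewrite geq_max mmeasureN !sM.
(* If the Jacobian [J] is nonzero, [v = 0] will do. If it vanishes identically, perturbing by one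
   coordinate forces the derivative of [f] in the other coordinate to vanish at critical points. If
   both derivatives are zero, [u] is zero and no point satisfies the hypotheses. *)
have [vQ hvQ] : exists v, (forall x, peval u x = 0) \/ exists Q : mpoly 2 R, [/\ Q != 0, (mmeasure mdeg Q <= e.+1)%N &
    forall a x, 0 < a -> (forall j, peval (mderiv j (a *: f - u - a ^+ 4 *: v)) x = 0) -> peval Q x = 0].
  have dE v a x j : peval (mderiv j (a *: f - u - a ^+ 4 *: v)) x =
      a * peval (mderiv j f) x - peval (mderiv j u) x - a ^+ 4 * peval (mderiv j v) x.
    by rewrite mderivB mderivB (mderivZ j a f) (mderivZ j _ v) pevalB pevalB (pevalZ a (mderiv j f)) (pevalZ _ (mderiv j v)).
  have JE x : peval J x = peval (mderiv i0 u) x * peval (mderiv i1 f) x - peval (mderiv i1 u) x * peval (mderiv i0 f) x.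
    by rewrite /J pevalB !pevalM.
  have [J0|J0] := eqVneq J 0; last first.
    exists 0; right; exists J; split=> // a x a0 h.
    have := h i0; have := h i1; rewrite !dE !raddf0 !peval0 mulr0 !subr0 JE => /eqP; rewrite subr_eq0 => /eqP <- /eqP.
    by rewrite subr_eq0 => /eqP <-; ring.
  have JE0 x : peval (mderiv i0 u) x * peval (mderiv i1 f) x = peval (mderiv i1 u) x * peval (mderiv i0 f) x.
    by apply/eqP; rewrite -subr_eq0 -JE J0 peval0.
  have an4 (a : R) : 0 < a -> a ^+ 4 != 0 by move=> a0; rewrite expf_neq0 // gt_eqF.
  have [f1|f1] := eqVneq (mderiv i1 f) 0; last first.
    exists (mpolyX R (mnm1 i0)); right; exists (mderiv i1 f); split=> // a x a0 h.
    have := h i0; have := h i1; rewrite !dE !mderivXU !pevalC eqxx /= mulr0 mulr1 subr0 => h1 h0.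
    apply: (mulfI (an4 a a0)); rewrite mulr0; have := JE0 x.
    have -> : peval (mderiv i0 u) x = a * peval (mderiv i0 f) x - a ^+ 4 by lra.
    have -> : peval (mderiv i1 u) x = a * peval (mderiv i1 f) x by lra.
    by clear -R; move=> h'; lra.
  have [f0|f0] := eqVneq (mderiv i0 f) 0; last first.
    exists (mpolyX R (mnm1 i1)); right; exists (mderiv i0 f); split=> // a x a0 h.
    have := h i0; have := h i1; rewrite !dE !mderivXU !pevalC eqxx /= mulr0 mulr1 subr0 => h1 h0.
    apply: (mulfI (an4 a a0)); rewrite mulr0; have := JE0 x.
    have -> : peval (mderiv i0 u) x = a * peval (mderiv i0 f) x by lra.
    have -> : peval (mderiv i1 u) x = a * peval (mderiv i1 f) x - a ^+ 4 by lra.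
    by clear -R; move=> h'; lra.
  exists 0; left => x; rewrite gradsqE big1 // => i _.
  have [->|->] : i = i0 \/ i = i1 by case: i => -[|[|//]] p; [left|right]; exact: val_inj.
    by rewrite f0 peval0 expr0n.
  by rewrite f1 peval0 expr0n.
exists vQ => x0; apply: critical_bound_sides => // s i.
case: hvQ => [u0|[Q [Q0 sQ hQ]]].
  by exists 1 => // a x _ _ _ _ _; rewrite -/u u0 ltxx.
(* On a proper face the equation of one fixed coordinate replaces [Q]. *)
have [Q' [Q'0 sQ' hQ']] : exists Q' : mpoly 2 R, [/\ Q' != 0, (mmeasure mdeg Q' <= e.+1)%N &
    forall a x, 0 < a -> (forall j, if s j == 0 then peval (mderiv j (a *: f - u - a ^+ 4 *: vQ)) x = 0
               else x 0 j = side lo hi (s j) j) -> peval Q' x = 0].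
  have [j sj|all0] := pickP (fun j => s j != 0); last first.
    exists Q; split=> // a x a0 h; apply: (hQ a) => // j.
    by have := h j; have := all0 j => /= /negbFE ->.
  exists (mpolyX R (mnm1 j) - mpolyC 2 (side lo hi (s j) j)); split.
  - apply/eqP => /(congr1 (fun p => peval p (\row_k (side lo hi (s j) j + 1)))).
    rewrite pevalB pevalXU pevalC peval0 mxE; lra.
  - apply: leq_trans (mmeasureD_le _ _ _) _; rewrite geq_max mmeasureN msizeX mdeg1 msizeC.
    by rewrite /e; case: (_ == 0); lia.
  - by move=> a x _ /(_ j); rewrite (negbTE sj) pevalB pevalXU pevalC => ->; rewrite subrr.
have [P [P0 sP] hP] := plane_elimination i (ltnW D1) Q'0 sQ' sf.
have [k k0 hk] := newton_bound1 (x0 0 i) P0 sP.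
exists k => // a x a0 _ xk fp fk _ hs; right; rewrite lE; apply: hk => //.
  by apply: le_lt_trans xk; have := coord_le_norm (x - x0) i; rewrite !mxE.
by apply: hP; exact: hQ' hs.
Qed.

(** * Distance to the zeros on a box *)

(** Converts a slope bound for the root of [f] into one for [f] itself. *)
Lemma bernoulli_le (R : realFieldType) (q b : R) L : 0 <= b -> b <= q ->
  q ^+ L.+1 - L.+1%:R * b * q ^+ L <= (q - b) ^+ L.+1.
Proof.
move=> b0 bq; have q0 : 0 <= q by exact: le_trans bq.
elim: L => [|L IH]; first by rewrite !expr1 expr0 mulr1 mul1r.
have qb : 0 <= q - b by rewrite subr_ge0.
rewrite [X in _ <= X]exprS; apply: le_trans (ler_wpM2l qb IH).
have : 0 <= L.+1%:R * (b ^+ 2 * q ^+ L) by rewrite !mulr_ge0 // exprn_ge0.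
rewrite -[L.+2%:R]natr1; set c := L.+1%:R; rewrite !exprS expr0 mulr1; lra.
Qed.

Section Root.
Context {R : realType}.
Implicit Types (s : R).

(** The positive root of order [L.+1] for [s > 0]; the shift keeps the order nonzero. *)
Definition rootR L s : R := expR (L.+1%:R^-1 * ln s).

Lemma rootRX L s : 0 < s -> rootR L s ^+ L.+1 = s.
Proof.
move=> s0; rewrite /rootR -expRM_natl mulrA divff ?mul1r ?pnatr_eq0 //.
by rewrite lnK // posrE.
Qed.

Lemma rootR_gt0 L s : 0 < rootR L s. Proof. exact: expR_gt0. Qed.

Lemma continuous_rootR L s : 0 < s -> {for s, continuous (rootR L)}.
Proof.
move=> s0; apply: continuous_comp; last exact: continuous_expR.
apply: continuousM; [exact: cst_continuous|exact: continuous_ln].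
Qed.

End Root.

Section BoxInequality.
Context {R : realType} {n : nat}.
Implicit Types (x y z : 'rV[R]_n) (f v : mpoly n R) (lo hi : 'rV[R]_n).

(* Ekeland's principle for the root of [f], penalised by the distance to [x]. *)
Lemma box_lojasiewicz_critical f lo hi (l : nat) : (0 < l)%N ->
  (forall x, box lo hi x -> 0 <= peval f x) ->
  (exists z, box lo hi z /\ peval f z = 0) ->
  (forall lo' hi' I, exists v, forall x0, critical_bound f v lo' hi' I l x0) ->
  exists2 C, 0 < C & forall x, box lo hi x ->
    exists z, [/\ box lo hi z, peval f z = 0 & C * `|x - z| ^+ l.+2 <= peval f x].
Proof.
move=> l0 fpos [z0 [bz0 fz0]] crit.
(* Both sides of the box are collapsed in the coordinates fixed by the face. *)
pose fix_ (lh : 'rV[R]_n) (y : {ffun 'I_n -> 'I_3}) : 'rV[R]_n :=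
  \row_j (if y j == 0 then lh 0 j else side lo hi (y j) j).
have [||c c0 hc] := @fin_unif R {ffun 'I_n -> 'I_3} (fun s c => forall x q,
    box (fix_ lo s) (fix_ hi s) x -> 0 <= q -> peval f x = q ^+ l.+2 -> 0 < peval f x ->
    peval f x < c -> c * q ^+ (2 * l.+1) <= peval (gradsq (fun j => s j == 0) f) x).
- move=> s c c' c'0 c'c h x q bx q0 e fp fc.
  apply: le_trans (h x q bx q0 e fp (lt_le_trans fc c'c)); apply: ler_wpM2r => //.
  exact: exprn_ge0.
- move=> s; have [v hv] := crit (fix_ lo s) (fix_ hi s) (fun j => s j == 0).
  apply: (gradient_inequality l0 _ _ hv).
    by move=> i /negbTE si; rewrite !mxE si.
  move=> x bx; apply: fpos => i; have := bx i; rewrite !mxE; case: eqP => // _.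
  by have := bz0 i; rewrite /side; case: eqP => _ [a1 a2] [b1 b2]; split; lra.
pose L : R := l.+2%:R.
have L0 : 0 <= L by [].
have nL : 0 < n%:R * L ^+ 2 + 1 by rewrite ltr_wpDl // mulr_ge0 // exprn_ge0.
(* The slope [k] of the penalty is so small that a gradient it allows violates the gradient
   inequality with constant [c]. *)
pose k := Order.min 1 (c / (2 * (n%:R * L ^+ 2 + 1))).
have k0 : 0 < k by rewrite lt_min ltr01 divr_gt0 // mulr_gt0.
have k1 : k <= 1 by rewrite /k ge_min lexx.
have kc : n%:R * (L * k) ^+ 2 < c.
  have : k <= c / (2 * (n%:R * L ^+ 2 + 1)) by rewrite /k ge_min lexx orbT.
  rewrite ler_pdivlMr ?mulr_gt0 // => h.
  have kk : k ^+ 2 <= k by rewrite expr2 ler_piMr // ltW.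
  have := ler_wpM2l (mulr_ge0 (ler0n R n) (exprn_ge0 2 L0)) kk; rewrite exprMn; lra.
clearbody k.
pose M := `|lo| + `|hi| + `|z0| + 1.
have M0 : 0 < M by rewrite /M ltr_wpDl // !addr_ge0.
exists (Order.min (k ^+ l.+2) (c / M ^+ l.+2)).
  by rewrite lt_min exprn_gt0 // divr_gt0 // exprn_gt0.
move=> x bx; have [cf|fc] := leP c (peval f x).
  exists z0; split=> //; apply: (le_trans _ cf).
  apply: (@le_trans _ _ (c / M ^+ l.+2 * M ^+ l.+2)); last by rewrite divfK // gt_eqF // exprn_gt0.
  apply: ler_pM; rewrite ?le_min ?exprn_ge0 ?divr_ge0 ?(ltW c0) ?(ltW k0) ?(ltW M0) ?exprn_ge0 ?(ltW M0) //.
    by rewrite ge_min lexx orbT.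
  rewrite lerXn2r ?nnegrE ?(ltW M0) // (le_trans (ler_normB _ _)) // /M.
  by have := box_norm bx; lra.
have [fx0|fx0] := eqVneq (peval f x) 0.
  by exists x; split=> //; rewrite subrr normr0 expr0n mulr0 fpos.
have {fx0}fx0 : 0 < peval f x by rewrite lt_neqAle eq_sym fx0 fpos.
apply/not_existsP => none.
(* The negated conclusion: no zero lies within distance [q0 / k] of [x]. *)
have far z : box lo hi z -> peval f z = 0 -> rootR l.+1 (peval f x) < k * `|z - x|.
  move=> bz fz; rewrite ltNge ; apply/negP => h; apply: (none z); split=> //.
  rewrite -[leRHS](rootRX l.+1 fx0); apply: (@le_trans _ _ ((k * `|z - x|) ^+ l.+2)).
    by rewrite exprMn distrC ler_wpM2r ?exprn_ge0 // ge_min lexx.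
  by rewrite lerXn2r ?nnegrE ?mulr_ge0 ?(ltW k0) // ltW // rootR_gt0.
set q0 := rootR l.+1 (peval f x) in far.
have cnorm : continuous (fun y => k * `|y - x|).
  move=> y; apply: (@continuous_comp _ _ _ (fun y => `|y - x|) (fun r => k * r)).
    exact: normB_continuous.
  exact: mulrl_continuous.
have cA : closed [set y | k * `|y - x| <= q0].
  by apply: closed_lefun => //; exact: cst_continuous.
(* On [A] there is no zero, so the root of [f] is continuous there and has a penalised minimiser. *)
pose A : set 'rV[R]_n := [set y | box lo hi y] `&` [set y | k * `|y - x| <= q0].
have Ax : A x by split=> //=; rewrite subrr normr0 mulr0 ltW // rootR_gt0.
have Apos y : A y -> 0 < peval f y.
  move=> [by_ /= ky]; rewrite lt_neqAle fpos // andbT eq_sym; apply/eqP => e.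
  by have := far y by_ e; rewrite ltNge ky.
have [y Ay ymin] : exists2 y, A y & forall w, A w ->
    rootR l.+1 (peval f y) + k * `|y - x| <= rootR l.+1 (peval f w) + k * `|w - x|.
  have [|y yA hy] := @EVT_min_rV R n (fun y => rootR l.+1 (peval f y) + k * `|y - x|) A
      (ex_intro _ x Ax) (compact_boxI cA).
    apply: continuous_in_subspaceT => w; rewrite inE => Aw.
    have c1 : {for w, continuous (rootR l.+1 \o peval f)}.
      apply: continuous_comp; first exact: peval_continuous.
      exact/continuous_rootR/Apos.
    exact: (continuousD c1 (cnorm w)).
  exists y; first by rewrite inE in yA.
  by move=> w Aw; apply: hy; rewrite inE.
have [by_ ky] := Ay; have fy := Apos y Ay; set q := rootR l.+1 (peval f y) in ymin.
have q0' : 0 < q by exact: rootR_gt0.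
have := ymin x Ax; rewrite subrr normr0 mulr0 addr0 -/q0 => qle.
have qE : peval f y = q ^+ l.+2 by rewrite rootRX.
have fyx : peval f y < c.
  apply: le_lt_trans fc; rewrite qE -[leRHS](rootRX l.+1 fx0) lerXn2r ?nnegrE ?(ltW q0') ?(ltW (rootR_gt0 _ _)) //.
  by rewrite -/q0; have := mulr_ge0 (ltW k0) (normr_ge0 (y - x)); lra.
have [s hs] : exists s : {ffun 'I_n -> 'I_3}, forall i,
    if s i == 0 then (y 0 i != lo 0 i /\ y 0 i != hi 0 i) else y 0 i = side lo hi (s i) i.
  apply: side_pattern => i; have [e|nl] := eqVneq (y 0 i) (lo 0 i); first by constructor 1.
  by have [e|nu] := eqVneq (y 0 i) (hi 0 i); [constructor 2|constructor 3].
have bs : box (fix_ lo s) (fix_ hi s) y.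
  move=> i; have := hs i; have := by_ i; rewrite !mxE; case: eqP => // _ _ ->.
  by split.
(* The gradient inequality on the face of [y] is contradicted by the slope bound in its free
   coordinates. *)
have := hc s y q bs (ltW q0') qE fy fyx; rewrite leNgt => /negP; apply.
have Lk0 : 0 <= L * k * q ^+ l.+1 by rewrite mulr_ge0 ?mulr_ge0 ?exprn_ge0 ?(ltW k0) ?(ltW q0').
rewrite gradsqE; apply: (@le_lt_trans _ _ (n%:R * (L * k * q ^+ l.+1) ^+ 2)).
  apply: (@le_trans _ _ (\sum_(i < n) (L * k * q ^+ l.+1) ^+ 2)); last first.
    by rewrite sumr_const card_ord mulr_natl.
  rewrite [X in _ <= X](bigID (fun j => s j == 0)) /= -[X in X <= _]addr0 lerD ?sumr_ge0 //.
    apply: ler_sum => i si; rewrite -real_normK ?num_real // lerXn2r ?nnegrE //.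
    have := hs i; rewrite si => -[nl nu]; have [e e0 he] := box_vary by_ nl nu.
    apply: (@slope_bound _ _ f y i _ (Order.min e (q / k))) => //; first by rewrite lt_min e0 divr_gt0.
    move=> h; rewrite lt_min ltr_pdivlMr // => /andP[h1 h2].
    have kh0 : 0 <= k * `|h| by rewrite mulr_ge0 // ltW.
    have kh : k * `|h| <= q by rewrite mulrC ltW.
    have dist : k * `|upd y i (y 0 i + h) - x| <= k * `|y - x| + k * `|h|.
      rewrite -mulrDr ler_wpM2l ?(ltW k0) // (_ : _ - x = (y - x) + (upd y i (y 0 i + h) - y)); last by rewrite [RHS]addrC addrA subrK.
      by rewrite (le_trans (ler_normD _ _)) // lerD2l upd_dist.
    (* Since [q + k |y - x| <= q0], a move of length below [q / k] stays in [A]: the constraint is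
       inactive at the minimiser. *)
    have Au : A (upd y i (y 0 i + h)).
      by split; [exact: he|rewrite /=; lra].
    have := ymin _ Au => hm.
    have := Apos _ Au => fu.
    have : rootR l.+1 (peval f (upd y i (y 0 i + h))) ^+ l.+2 = peval f (upd y i (y 0 i + h)) by exact: rootRX.
    move=> <-; have := bernoulli_le l.+1 kh0 kh; rewrite -qE -/L.
    rewrite (_ : L * k * q ^+ l.+1 * `|h| = L * (k * `|h|) * q ^+ l.+1); last by ring.
    move=> /le_trans; apply; rewrite lerXn2r ?nnegrE ?subr_ge0 ?(ltW (rootR_gt0 _ _)) //.
    by lra.
  by move=> i _; exact: exprn_ge0.
rewrite exprMn mulrA (mulnC 2%N) exprM ltr_pM2r //.
by rewrite !exprn_gt0.
Qed.

End BoxInequality.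

(** Induction on the degree, splitting off a zero [z] in the interval. If the cofactor has a zero
    there as well, the nearer of [z] and the zero supplied by induction is used; otherwise the
    cofactor is bounded below on the interval. *)
Lemma poly_lojasiewicz (R : realType) D (p : {poly R}) (a b : R) :
  (size p <= D.+2)%N -> (exists z, [/\ a <= z, z <= b & p.[z] = 0]) ->
  exists2 C, 0 < C & forall s, a <= s -> s <= b ->
    exists z, [/\ a <= z, z <= b, p.[z] = 0 & C * `|s - z| ^+ D.+1 <= `|p.[s]|].
Proof.
elim: D p => [|D IH] p sp [z [az zb pz]].
all: have [->|p0] := eqVneq p 0; first by exists 1 => // s as_ sb; exists s; split=> //; rewrite ?horner0 // subrr normr0 expr0n mulr0.
all: have /factor_theorem[g gE] : root p z by apply/rootP.
all: have g0 : g != 0 by apply: contra_neq p0 => g0; rewrite gE g0 mul0r.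
all: have sg : size p = (size g).+1 by rewrite gE size_Mmonic ?monicXsubC // size_XsubC addn2.
  have /size_poly1P[c c0 ge] : size g == 1%N.
    by rewrite eqn_leq -ltnS -sg sp /= lt0n size_poly_eq0.
  exists `|c|; first by rewrite normr_gt0.
  by move=> s _ _; exists z; split=> //; rewrite gE hornerM ge hornerC hornerXsubC normrM expr1.
have [gz|ng] := pselect (exists z, [/\ a <= z, z <= b & g.[z] = 0]).
  have [|C C0 hC] := IH g _ gz; first by rewrite -ltnS -sg.
  have pg w : g.[w] = 0 -> p.[w] = 0 by move=> e; rewrite gE hornerM e mul0r.
  exists C => // s as_ sb; have [w [aw wb gw hw]] := hC s as_ sb.
  have ps : `|p.[s]| = `|g.[s]| * `|s - z| by rewrite gE hornerM normrM hornerXsubC.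
  have [le|lt] := leP `|s - z| `|s - w|.
    exists z; split=> //; rewrite ps exprSr mulrA ler_wpM2r //.
    by apply: le_trans hw; rewrite ler_wpM2l ?(ltW C0) // lerXn2r ?nnegrE.
  exists w; split=> //; first exact: pg.
  by rewrite ps exprSr mulrA ler_pM ?mulr_ge0 ?exprn_ge0 ?(ltW C0) // ltW.
have ab : a <= b by exact: le_trans zb.
have [m [mab mmin]] : exists m, m \in `[a, b] /\ forall s, s \in `[a, b] -> `|g.[m]| <= `|g.[s]|.
  have [|m mab hm] := @EVT_min R (fun s => `|g.[s]|) a b ab; last by exists m; split.
  apply: continuous_subspaceT => s; apply: (@continuous_comp _ _ _ (fun s => g.[s]) (fun r => `|r|)).
    exact: continuous_horner.
  exact: norm_continuous.
have gm : 0 < `|g.[m]|.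
  rewrite normr_gt0; apply/eqP => e; apply: ng; exists m.
  by move: mab; rewrite in_itv /= => /andP[].
have ba : 0 < `|b - a| + 1 by rewrite ltr_wpDl.
exists (`|g.[m]| / (`|b - a| + 1) ^+ D.+1); first by rewrite divr_gt0 // exprn_gt0.
move=> s as_ sb; exists z; split=> //.
rewrite gE hornerM normrM hornerXsubC [`|s - z| ^+ _]exprSr mulrA ler_wpM2r //.
apply: (@le_trans _ _ `|g.[m]|); last by apply: mmin; rewrite in_itv /= as_.
rewrite mulrAC ler_pdivrMr ?exprn_gt0 // ler_wpM2l // lerXn2r ?nnegrE ?(ltW ba) //.
have : `|s - z| <= b - a by rewrite ler_norml; apply/andP; split; lra.
by have := ler_norm (b - a); lra.
Qed.

Lemma box_lojasiewicz_line (R : realType) (f : mpoly 1 R) D (lo hi : 'rV[R]_1) :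
  (0 < D)%N -> (mmeasure mdeg f <= D.+1)%N ->
  (forall x, box lo hi x -> 0 <= peval f x) ->
  (exists z, box lo hi z /\ peval f z = 0) ->
  exists2 C, 0 < C & forall x, box lo hi x ->
    exists z, [/\ box lo hi z, peval f z = 0 & C * `|x - z| ^+ D <= peval f x].
Proof.
case: D => // D _ sf fpos [z0 [bz0 fz0]].
pose p : {poly R} := \sum_(mu <- msupp f) mcoeff mu f *: 'X^(mu ord0).
have pE (x : 'rV[R]_1) : p.[x 0 0] = peval f x.
  rewrite peval_sum horner_sum; apply: eq_bigr => mu _.
  by rewrite hornerZ hornerXn big_ord1.
have sp : (size p <= D.+2)%N.
  apply: (leq_trans (size_sum _ _ _)); apply/bigmax_leqP_seq => mu mup _.
  apply: (leq_trans (size_scale_leq _ _)); rewrite size_polyXn.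
  by have := msize_mdeg_lt mup; rewrite mdegE big_ord1 => /leq_trans; apply.
have rowE (s : R) : (\row_(i < 1) s) 0 0 = s by rewrite mxE.
have bE (x : 'rV[R]_1) : box lo hi x <-> lo 0 0 <= x 0 0 /\ x 0 0 <= hi 0 0.
  by split=> [/(_ 0)//|h i]; rewrite (ord1 i).
have [|C C0 hC] := @poly_lojasiewicz _ D p (lo 0 0) (hi 0 0) sp.
  by exists (z0 0 0); have /bE[? ?] := bz0; split=> //; rewrite pE.
exists C => // x bx; have /bE[l h] := bx; have [z [lz zh pz hz]] := hC _ l h.
exists (\row_(i < 1) z); split; first by apply/bE; rewrite rowE.
  by rewrite -pE rowE.
move: hz; rewrite pE [X in _ <= X -> _]ger0_norm ?fpos // => hz; apply: le_trans hz.
rewrite ler_wpM2l ?(ltW C0) // lerXn2r ?nnegrE //.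
by apply: norm_le_coord => // i; rewrite (ord1 i) !mxE.
Qed.

(** For [n = 2] the inequality fails from [D = 8] on, since [13 ^ 2 + 2 > 8 * 21]. *)
Lemma exponent_le n D : (2 < n)%N -> (1 < D)%N -> ((2 * D - 3) ^ n + 2 <= D * (3 * D - 3) ^ n.-1)%N.
Proof.
move=> n2 D1; rewrite -(subnK n2); elim: (n - 3)%N => [|k IH].
  rewrite add0n /= -(subnK D1); set m := (D - 2)%N.
  rewrite (_ : (2 * (m + 2) - 3 = 2 * m + 1)%N); last by lia.
  rewrite (_ : (3 * (m + 2) - 3 = 3 * m + 3)%N); last by lia.
  rewrite !expnS !expn0; nia.
rewrite addSn /=; have -> : ((k + 3) = (k + 3).-1.+1)%N by lia.
rewrite -[X in ((2 * D - 3) ^ X.+1)%N]addn0 in IH *; rewrite ?addn0 in IH *.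
move: IH; set a := ((k + 3).-1)%N; have -> : (k + 3 = a.+1)%N by rewrite /a; lia.
rewrite /= !expnS; set A := ((2 * D - 3) ^ a)%N; set B := ((3 * D - 3) ^ a)%N.
set u := (2 * D - 3)%N; set v := (3 * D - 3)%N => IH.
have uv : (u < v)%N by rewrite /u /v; lia.
have v2 : (1 < v)%N by rewrite /v; lia.
nia.
Qed.

(** The number of variables decides: factoring on the line, the Jacobian in the plane, elimination
    of all coordinates from three variables on. *)
Lemma box_lojasiewicz (R : realType) n (f : mpoly n R) D (lo hi : 'rV[R]_n) :
  (0 < n)%N -> (1 < D)%N -> (mmeasure mdeg f <= D.+1)%N ->
  (forall x, box lo hi x -> 0 <= peval f x) ->
  (exists z, box lo hi z /\ peval f z = 0) ->
  exists2 C, 0 < C & forall x, box lo hi x ->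
    exists z, [/\ box lo hi z, peval f z = 0 & C * `|x - z| ^+ (D * (3 * D - 3) ^ n.-1) <= peval f x].
Proof.
case: n f lo hi => [//|[|n]] f lo hi _ D1 sf fpos hz.
  by rewrite expn0 muln1; apply: box_lojasiewicz_line => //; exact: ltnW.
have [l l0 lE] : exists2 l, (0 < l)%N & l.+2 = (D * (3 * D - 3) ^ n.+1)%N.
  exists (D * (3 * D - 3) ^ n.+1 - 2)%N.
    rewrite subn_gt0; have p : (0 < (3 * D - 3) ^ n)%N by rewrite expn_gt0; lia.
    rewrite expnS; have : (3 <= 3 * D - 3)%N by lia.
    set a := (3 * D - 3)%N; set b := (_ ^ n)%N in p *; nia.
  rewrite -addn2 subnK //; have p : (0 < (3 * D - 3) ^ n.+1)%N by rewrite expn_gt0; lia.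
  by set b := (_ ^ _)%N in p *; nia.
rewrite /= -lE; apply: (box_lojasiewicz_critical l0 fpos hz).
case: n f lo hi sf fpos hz lE => [|n] f lo hi sf fpos hz lE lo' hi' I.
  by apply: (critical_bound_plane _ _ _ D1 sf); rewrite lE expn1.
eexists => x0; apply: (@critical_bound_high _ _ f lo' hi' I x0 D l D1 sf).
by have := @exponent_le n.+3 D isT D1; rewrite /= -lE; lia.
Qed.

(** * Closed basic decompositions *)

(** A uniquely determined [y] is a root of one of finitely many polynomials in [t] and [y], and a
    positive root cannot tend to [0] faster than a power of [t]. *)
Lemma definable_lower (R : realType) (A : R -> R -> Prop) :
  sa (fun w : 'rV[R]_(1 + 1) => A (w 0 (lshift 1 0)) (w 0 (rshift 1 0))) ->
  exists E : nat, exists2 d, 0 < d & forall t y, 0 < t -> t < d -> 0 < y ->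
    (forall y', A t y' <-> y' = y) -> d * t ^+ E <= y.
Proof.
move=> sA; have [|L hL] := @sa_root R 1 (fun x y => A (x 0 0) y).
  by apply: sa_ext sA => w; rewrite mxE.
pose pt y t : 'rV[R]_(1 + 1) := row_mx (\row_(i < 1) t) (\row_(i < 1) y).
have /fin_all_exists[P hP] (j : 'I_(size L)) : exists P : {poly {poly R}},
    forall y t, peval (nth 0 L j) (pt y t) = bieval P y t.
  apply: polyfun_bipoly (polyfun_peval _) _ => i; case: (split_ordP i) => k ->.
    by exists 'X => y t; rewrite /pt row_mxEl mxE /bieval hornerX hornerC.
  by exists ('X%:P) => y t; rewrite /pt row_mxEr mxE /bieval hornerC hornerX.
pose E := (\sum_j size (P j))%N.
have [||d d0 hd] := @fin_unif R 'I_(size L) (fun j d => d <= 1 /\ (P j != 0 -> forall y t, 0 < t -> t < d -> 0 < y ->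
    bieval (P j) y t = 0 -> d * t ^+ E <= y)).
- move=> j d d' d'0 d'd [d1 h]; split=> [|P0 y t t0 td y0 e]; first exact: le_trans d1.
  apply: le_trans (h P0 y t t0 (lt_le_trans td d'd) y0 e).
  by rewrite ler_wpM2r // exprn_ge0 // ltW.
- move=> j; have [P0|P0] := eqVneq (P j) 0; first by exists 1.
  (* The root [y] takes the place of the small parameter, and [t] that of the variable close to
     [0]. *)
  have [C [d [C0 d0 hd]]] := newton_bound 0 P0.
  pose d' := Order.min 1 (Order.min d C^-1).
  have d'0 : 0 < d' by rewrite !lt_min ltr01 d0 invr_gt0.
  have d'1 : d' <= 1 by rewrite ge_min lexx.
  have d'd : d' <= d by rewrite /d' !ge_min lexx !orbT.
  have d'C : d' * C <= 1.
    by rewrite -ler_pdivlMr // div1r /d' !ge_min lexx !orbT.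
  exists d' => //; split=> // _ y t t0 td y0 e.
  have t1 : t <= 1 by apply: ltW; exact: lt_le_trans d'1.
  have [dy|yd] := leP d y.
    apply: (le_trans _ (le_trans d'd dy)); rewrite ler_piMr ?(ltW d'0) // exprn_ile1 //; exact: ltW.
  have := hd y t y0 yd _ e; rewrite subr0 gtr0_norm // => /(_ (lt_le_trans td d'd)) h.
  apply: (@le_trans _ _ (d' * t ^+ (size (P j)).-1)).
    rewrite ler_wpM2l ?(ltW d'0) // ler_wiXn2l ?(ltW t0) //.
    by rewrite /E (bigD1 j) //= (leq_trans (leq_pred _)) // leq_addr.
  apply: (le_trans (ler_wpM2l (ltW d'0) h)).
  by rewrite mulrA ler_piMl // ltW.
exists E, d => // t y t0 td y0 hy.
have [|q [/(nthP 0)[j jL <-] q0 [y' q1]]] := hL (\row_i t) y.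
  by move=> y'; rewrite mxE; exact: hy.
pose jj := Ordinal jL; have [_] := hd jj; apply=> //; last by rewrite -hP.
by apply/eqP => e; apply: q1; rewrite -/(pt y' t) (hP jj) e /bieval !horner0.
Qed.

Lemma pevalprod (R : realType) n (s : seq (mpoly n R)) x :
  peval (\prod_(p <- s) p) x = \prod_(p <- s) peval p x.
Proof. by rewrite /peval rmorph_prod. Qed.

Section Finiteness.
Context {R : realType} {n : nat}.
Implicit Types (x y : 'rV[R]_n) (X : set 'rV[R]_n).

Definition basic_union X : Prop :=
  exists bs : seq (description R n), X = [set x | exists2 b, b \in bs & basic_set b x].

Lemma basic_unionU X Y : basic_union X -> basic_union Y -> basic_union (X `|` Y).
Proof.
move=> [bs ->] [cs ->]; exists (bs ++ cs); apply/seteqP; split=> x /=.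
  by move=> [[b bb h]|[b bb h]]; exists b => //; rewrite mem_cat bb ?orbT.
by move=> [b]; rewrite mem_cat => /orP[bb|bb] h; [left|right]; exists b.
Qed.

Lemma basic_unionI X Y : basic_union X -> basic_union Y -> basic_union (X `&` Y).
Proof.
move=> [bs ->] [cs ->]; exists [seq (b.1 ++ c.1, b.2 ++ c.2) | b <- bs, c <- cs].
have key (b c : description R n) x : basic_set (b.1 ++ c.1, b.2 ++ c.2) x <-> basic_set b x /\ basic_set c x.
  rewrite /basic_set /=; split.
    move=> [h1 h2]; split; split=> p pb; [apply: h1|apply: h2|apply: h1|apply: h2];
      by rewrite mem_cat pb ?orbT.
  by move=> [[h1 h2] [h3 h4]]; split=> p; rewrite mem_cat => /orP[]; auto.
apply/seteqP; split=> x /=.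
  move=> [[b bb hb] [c cc hc]]; exists (b.1 ++ c.1, b.2 ++ c.2); last exact/key.
  by apply/allpairsP; exists (b, c).
by move=> [_ /allpairsP[[b c] [/= bb cc ->]] /key[hb hc]]; split; [exists b|exists c].
Qed.

Lemma basic_union_ge0 (p : mpoly n R) : basic_union [set x | 0 <= peval p x].
Proof.
exists [:: ([:: p], [::])]; apply/seteqP; split=> x /=.
  move=> h; exists ([:: p], [::]); first by rewrite inE.
  by split=> // q; rewrite inE => /eqP ->.
by move=> [b]; rewrite inE => /eqP -> [h _]; apply: h; rewrite inE.
Qed.

Lemma basic_unionT : basic_union setT.
Proof.
exists [:: ([::], [::])]; apply/seteqP; split=> x //= _; exists ([::], [::]) => //.
Qed.

Lemma basic_union0 : basic_union set0.
Proof. by exists [::]; apply/seteqP; split=> x //= [b]. Qed.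

Lemma norm_le_sumsq x : `|x| <= 1 + \sum_i x 0 i ^+ 2.
Proof.
have s0 : 0 <= \sum_i x 0 i ^+ 2 by apply: sumr_ge0 => i _; exact: sqr_ge0.
apply: norm_le_coord => [|i]; first by rewrite addr_ge0.
rewrite (bigD1 i) //=; have : 0 <= \sum_(j | j != i) x 0 j ^+ 2 by apply: sumr_ge0 => j _; exact: sqr_ge0.
have := sqr_ge0 (`|x 0 i| - 1); rewrite -[x 0 i ^+ 2]real_normK ?num_real //; nra.
Qed.

Definition sumsq (s : seq (mpoly n R)) : mpoly n R := \sum_(h <- s) h ^+ 2.

Lemma sumsqE s x : peval (sumsq s) x = \sum_(h <- s) peval h x ^+ 2.
Proof. by rewrite /sumsq pevalsum; apply: eq_bigr => h _; rewrite pevalX. Qed.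

Lemma sumsq_ge0 s x : 0 <= peval (sumsq s) x.
Proof. by rewrite sumsqE sumr_ge0 // => h _; rewrite sqr_ge0. Qed.

Lemma sumsq_eq0 s x : peval (sumsq s) x = 0 <-> forall h, h \in s -> peval h x = 0.
Proof.
rewrite sumsqE; split.
  elim: s => [//|p s IH]; rewrite big_cons => e.
  have s0 : 0 <= \sum_(h <- s) peval h x ^+ 2 by rewrite sumr_ge0 // => h _; rewrite sqr_ge0.
  have p0 := sqr_ge0 (peval p x).
  move=> h; rewrite inE => /orP[/eqP ->|hs]; last by apply: IH => //; lra.
  by apply/eqP; rewrite -sqrf_eq0; apply/eqP; lra.
by move=> h; rewrite big1_seq // => p /andP[_ ps]; rewrite h // expr0n.
Qed.

(** A Lojasiewicz inequality between the product [G] of the strict inequalities and the sum of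
    squares of the equations. The factor built from [1 + |x| ^ 2] and [1 + G] makes it global on a
    set that need not be bounded. *)
Lemma closed_lojasiewicz X (b : description R n) : closed X -> semialgebraic X ->
  (forall x, X x -> ~ sign_set b x) ->
  exists C e, 0 < C /\ forall x, X x -> (forall g, g \in b.1 -> 0 < peval g x) ->
    (\prod_(g <- b.1) peval g x) ^+ e <=
    C * ((1 + \sum_i x 0 i ^+ 2) * (1 + \prod_(g <- b.1) peval g x)) ^+ e * peval (sumsq b.2) x.
Proof.
move=> cX sX disj; pose G := \prod_(g <- b.1) g; pose f := sumsq b.2.
pose N : mpoly n R := 1 + \sum_i mpolyX R (mnm1 i) ^+ 2.
have NE x : peval N x = 1 + \sum_i x 0 i ^+ 2.
  rewrite pevalD pevalsum -mpolyC1 pevalC; congr (_ + _).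
  by apply: eq_bigr => i _; rewrite pevalX pevalXU.
have N1 x : 1 <= peval N x by rewrite NE lerDl sumr_ge0 // => i _; exact: sqr_ge0.
(* These compact sets exhaust the points where all [g] are positive as [t] tends to [0], and the sum
   of squares is positive on each. Its minimum is definable in [t], hence at least a power of
   [t]. *)
pose K t x := (X x /\ forall g, g \in b.1 -> 0 <= peval g x) /\ (t * peval N x <= 1 /\ t <= peval G x).
have fpos t x : 0 < t -> K t x -> 0 < peval f x.
  move=> t0 [[Xx gx] [_ tG]]; rewrite lt_neqAle sumsq_ge0 andbT eq_sym; apply/eqP => e.
  apply: (disj x Xx); split; last exact/sumsq_eq0.
  move=> g gb; rewrite lt_neqAle gx // andbT eq_sym; apply/eqP => e'.
  move: tG; rewrite pevalprod (big_rem g) //= e' mul0r leNgt t0 //.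
have cK t : 0 < t -> compact [set x | K t x].
  move=> t0; apply: (@compact_box _ _ _ t^-1).
    rewrite (_ : [set x | _] = (X `&` [set x | forall g, g \in b.1 -> 0 <= peval g x]) `&`
      ([set x | t * peval N x <= 1] `&` [set x | t <= peval G x])) //.
    apply: closedI; apply: closedI => //.
    - apply: (@closed_forall _ _ _ (fun g => [set x | g \in b.1 -> 0 <= peval g x])) => g.
      case: (g \in b.1).
        rewrite (_ : [set x | _] = [set x | 0 <= peval g x]).
          by apply: closed_lefun; [exact: cst_continuous|exact: peval_continuous].
        by apply/seteqP; split=> w /= h; [exact: h|move=> _].
      rewrite (_ : [set x | _] = setT); first exact: closedT.
      by apply/seteqP; split.
    - apply: (@closed_lefun _ _ (fun x => t * peval N x) (fun=> 1)); last exact: cst_continuous.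
      by apply: polyfun_continuous; polyfun_tac.
    - by apply: closed_lefun; [exact: cst_continuous|exact: peval_continuous].
  move=> x [_ [tN _]]; apply: (le_trans (norm_le_sumsq x)); rewrite -NE.
  by rewrite -[t^-1]mul1r ler_pdivlMr // mulrC.
have [|E [d d0 hd]] := @definable_lower R (fun t (y : R) => exists x, K t x /\ (peval f x = y /\ forall x', K t x' -> y <= peval f x')).
  have sK k (phi : 'rV[R]_k -> R) (psi : 'rV[R]_k -> 'rV[R]_n) : polyfun phi ->
      (forall i, polyfun (fun w => psi w 0 i)) -> sa (fun w => K (phi w) (psi w)).
    move=> hphi hpsi; apply: sa_and; apply: sa_and.
    - by apply: (@sa_comp _ _ _ X psi) => //; rewrite /sa.
    - apply: sa_bigand => g; apply: sa_le; [exact: polyfun_const|exact: polyfun_pevalv].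
    - apply: sa_le; [apply: polyfunM => //; exact: polyfun_pevalv|exact: polyfun_const].
    - apply: sa_le => //; exact: polyfun_pevalv.
  apply: sa_ex; cbv beta; apply: sa_and; first by apply: sK; polyfun_tac.
  apply: sa_and; first by apply: sa_eq; polyfun_tac; apply: polyfun_pevalv => i; polyfun_tac.
  apply: sa_all; cbv beta; apply: sa_imp; first by apply: sK; polyfun_tac.
  by apply: sa_le; polyfun_tac; apply: polyfun_pevalv => i; polyfun_tac.
pose l := Order.min 1 (d / 2).
have l0 : 0 < l by rewrite lt_min ltr01 divr_gt0.
have l1 : l <= 1 by rewrite ge_min lexx.
have ld : l < d by apply: (@le_lt_trans _ _ (d / 2)); [rewrite ge_min lexx orbT|lra].
exists (d * l ^+ E)^-1, E; split; first by rewrite invr_gt0 mulr_gt0 // exprn_gt0.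
move=> x Xx gx; rewrite -/f -NE -pevalprod -/G; set g := peval G x; set m := peval N x.
have g0 : 0 < g by rewrite /g pevalprod big_seq; apply: prodr_gt0 => p pb; exact: gx.
have m1 : 1 <= m by exact: N1.
have m0 : 0 < m by exact: lt_le_trans m1.
have mg : 0 < m * (1 + g) by rewrite mulr_gt0 // addr_gt0.
(* The parameter fitted to [x]: at most [g], at most [1 / m], and below the range [d] of the lower
   bound. *)
pose t := l * g / (m * (1 + g)).
have t0 : 0 < t by rewrite divr_gt0 // mulr_gt0.
have tm : t * m <= l.
  rewrite /t mulrAC ler_pdivrMr // -!mulrA ler_pM2l // mulrC ler_pM2l //; lra.
have tl : t <= l by apply: le_trans tm; rewrite ler_peMr // ltW.
have tg : t <= g.
  rewrite /t ler_pdivrMr //; apply: (@le_trans _ _ (1 * g)); first by rewrite ler_wpM2r // ltW.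
  rewrite mulrC ler_wpM2l ?(ltW g0) //; apply: (le_trans m1); rewrite ler_peMr ?(ltW m0) //; lra.
have Kx : K t x.
  by split; split=> //; [move=> p pb; exact/ltW/gx|exact: le_trans l1].
have [y Ky hy] := compact_argmin (ex_intro _ x Kx) (cK t t0) (@peval_continuous _ _ f).
have h := hd t (peval f y) t0 (le_lt_trans tl ld) (fpos t y t0 Ky) _.
have {h}h : d * t ^+ E <= peval f y.
  apply: h => y'; split=> [[w [Kw [<- hw]]]|->]; last by exists y.
  by apply/eqP; rewrite eq_le hw // hy.
have {h}h := le_trans h (hy x Kx).
rewrite -mulrA ler_pdivlMl ?mulr_gt0 ?exprn_gt0 // mulrC.
have -> : g ^+ E * (d * l ^+ E) = d * t ^+ E * (m * (1 + g)) ^+ E.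
  rewrite /t; move: mg; set M := m * (1 + g) => mg.
  by rewrite expr_div_n -[RHS]mulrA divfK ?(exprMn _ l g); [ring|rewrite gt_eqF // exprn_gt0].
by rewrite mulrC ler_wpM2l // exprn_ge0 // ltW.
Qed.

(** The finiteness theorem. For each piece of the complement, the set where some strict inequality
    fails weakly or the preceding inequality holds is a finite union of closed basic sets; it
    contains [X] and misses the piece. [X] is the intersection of these sets. *)
Lemma closed_basic_union X : closed X -> semialgebraic X -> basic_union X.
Proof.
move=> cX sX; have /saP[bs hbs] : sa (fun x => ~ X x) by apply: sa_not.
have B b : exists S : set 'rV[R]_n, [/\ basic_union S, (b \in bs -> X `<=` S) & (forall x, sign_set b x -> ~ S x)].
  have [bbs|nb] := boolP (b \in bs); last by exists set0; split=> //; [exact: basic_union0|move=> x _ []].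
  have [|C [e [C0 h]]] := @closed_lojasiewicz X b cX sX.
    by move=> x Xx sb; have /hbs : exists2 b, b \in bs & sign_set b x by exists b.
  pose G := \prod_(g <- b.1) g.
  (* Nonnegative on [X] where all [g] are positive, but equal to [- G ^ e < 0] on the piece, where
     the equations hold. *)
  pose p : mpoly n R := mpolyC n C * ((1 + \sum_i mpolyX R (mnm1 i) ^+ 2) * (1 + G)) ^+ e * sumsq b.2 - G ^+ e.
  have pE x : peval p x = C * ((1 + \sum_i x 0 i ^+ 2) * (1 + \prod_(g <- b.1) peval g x)) ^+ e * peval (sumsq b.2) x
      - (\prod_(g <- b.1) peval g x) ^+ e.
    rewrite /p pevalB !pevalM !pevalX pevalM !pevalD pevalsum -mpolyC1 !pevalC pevalprod.
    by congr (_ * (_ * _) ^+ _ * _ - _); congr (_ + _); apply: eq_bigr => i _; rewrite pevalX pevalXU.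
  exists ([set x | exists2 g, g \in b.1 & 0 <= peval (- g) x] `|` [set x | 0 <= peval p x]); split.
  - apply: basic_unionU; last exact: basic_union_ge0.
    elim: (b.1) => [|g s IH].
      by rewrite (_ : [set x | _] = set0); [exact: basic_union0|apply/seteqP; split=> x //= [g]].
    rewrite (_ : [set x | _] = [set x | 0 <= peval (- g) x] `|` [set x | exists2 g, g \in s & 0 <= peval (- g) x]).
      by apply: basic_unionU => //; exact: basic_union_ge0.
    apply/seteqP; split=> x /=.
      by move=> [k]; rewrite inE => /orP[/eqP ->|ks] hk; [left|right; exists k].
    move=> [hg|[k ks hk]]; first by exists g => //; rewrite inE eqxx.
    by exists k => //; rewrite inE ks orbT.
  - move=> _ x Xx; have [[g gb g0]|ng] := pselect (exists2 g, g \in b.1 & peval g x <= 0).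
      by left; exists g => //; rewrite pevalN oppr_ge0.
    right; rewrite /= pE subr_ge0; apply: h => // g gb.
    by rewrite ltNge; apply/negP => g0; apply: ng; exists g.
  - move=> x [gx hx] [[g gb]|/=]; first by rewrite pevalN oppr_ge0 leNgt gx.
    have -> : 0 <= peval p x = (0 <= - (\prod_(g <- b.1) peval g x) ^+ e).
      by rewrite pE (sumsq_eq0 b.2 x).2 // mulr0 sub0r.
    by rewrite oppr_ge0 leNgt exprn_gt0 // big_seq; apply: prodr_gt0 => g gb; exact: gx.
have [S hS] := choice B.
have -> : X = [set x | forall b, b \in bs -> S b x].
  apply/seteqP; split=> x /=; first by move=> Xx b bb; have [_ h _] := hS b; exact: h.
  by move=> h; apply: contrapT => /hbs[b bb sb]; have [_ _ k] := hS b; exact: (k x sb (h b bb)).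
elim: bs {hbs B hS} (fun b => let: And3 h _ _ := hS b in h) => [|b s IH] hS.
  by rewrite (_ : [set x | _] = setT); [exact: basic_unionT|apply/seteqP; split].
rewrite (_ : [set x | _] = S b `&` [set x | forall c, c \in s -> S c x]).
  by apply: basic_unionI => //; exact: IH.
apply/seteqP; split=> x /=.
  by move=> h; split=> [|c cs]; apply: h; rewrite inE ?eqxx // cs orbT.
by move=> [h1 h2] c; rewrite inE => /orP[/eqP ->|/h2].
Qed.

Lemma minimal_description_exists (b : description R n) :
  exists b', basic_set b' = basic_set b /\ minimal_description b'.
Proof.
have [m] := ubnP (size b.1); elim: m b => // m IH b bm.
have [mb|nmb] := pselect (minimal_description b); first by exists b.
have [b' [e lt]] : exists b', basic_set b' = basic_set b /\ (size b'.1 < size b.1)%N.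
  apply: contrapT => no; apply: nmb => b' e; rewrite leqNgt; apply/negP => lt.
  by apply: no; exists b'.
have [|c [ce cm]] := IH b'; first by apply: leq_trans lt _; rewrite -ltnS.
by exists c; rewrite ce e.
Qed.

Lemma decomposition_exists X : closed X -> semialgebraic X -> exists bs, decomposition X bs.
Proof.
move=> cX sX; have [bs XE] := closed_basic_union cX sX.
have [m hm] := choice minimal_description_exists.
exists (map m bs); split; last by move=> _ /mapP[b bb ->]; exact: (hm b).2.
rewrite XE; apply/seteqP; split=> x /=.
  by move=> [b bb hb]; exists (m b); [exact: map_f|rewrite (hm b).1].
by move=> [_ /mapP[b bb ->]]; rewrite (hm b).1 => hb; exists b.
Qed.

End Finiteness.

(** * The smallest exponent *)

Section NewtonGap.
Context {R : realType}.
Implicit Types (t y : R).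

Lemma powR_exp t y k : 0 < t -> (t `^ y) ^+ k = t `^ (y * k%:R).
Proof. by move=> t0; rewrite powRrM powR_mulrn // powR_ge0. Qed.

Lemma expr_powR t i y : 0 < t -> t ^+ i * t `^ y = t `^ (i%:R + y).
Proof.
by move=> t0; rewrite powRD ?(gt_eqF t0) ?implybT // powR_mulrn // ltW.
Qed.

(** A larger power of [y] is controlled by the upper curve and the weights at [al], a smaller one by
    the lower curve and the weights at [be]; for equal powers of [y] the powers of [t] decide. *)
Lemma monomial_gap (al be C ka : R) (i j i0 j0 : nat) : 0 < C -> 0 < ka ->
  (j = j0 -> (i0 < i)%N) -> i0%:R + j0%:R * al <= i%:R + j%:R * al ->
  i0%:R + j0%:R * be < i%:R + j%:R * be ->
  exists2 d, 0 < d & forall t y, 0 < t -> t < d -> 0 < y -> C * t `^ be <= y -> y <= d * t `^ al ->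
    t ^+ i * y ^+ j <= ka * (t ^+ i0 * y ^+ j0).
Proof.
move=> C0 ka0 hj ha hb; have [e|jj|jj] := ltngtP j0 j; last 1 first.
- subst j0; have ii := hj erefl; exists (Order.min 1 ka); first by rewrite lt_min ltr01.
  move=> t y t0; rewrite lt_min => /andP[t1 tk] y0 _ _.
  rewrite mulrA ler_wpM2r ?exprn_ge0 ?(ltW y0) // -(subnK ii) -addSnnS exprD ler_wpM2r ?exprn_ge0 ?(ltW t0) //.
  by apply: le_trans (ltW tk); rewrite exprS ler_piMr ?(ltW t0) // exprn_ile1 // ltW.
- pose k := (j - j0)%N; have jE : (j = j0 + k)%N by rewrite /k subnKC // ltnW.
  have k0 : (0 < k)%N by rewrite /k subn_gt0.
  exists (Order.min 1 ka); first by rewrite lt_min ltr01.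
  set d := Order.min 1 ka; have d0 : 0 < d by rewrite lt_min ltr01.
  have d1 : d <= 1 by rewrite ge_min lexx.
  move=> t y t0 td y0 _ yl; rewrite jE exprD.
  rewrite (_ : t ^+ i * (y ^+ j0 * y ^+ k) = y ^+ j0 * (t ^+ i * y ^+ k)); last by ring.
  rewrite (_ : ka * (t ^+ i0 * y ^+ j0) = y ^+ j0 * (ka * t ^+ i0)); last by ring.
  rewrite ler_wpM2l ?exprn_ge0 ?(ltW y0) //.
  have yk : y ^+ k <= (d * t `^ al) ^+ k by rewrite lerXn2r ?nnegrE ?(ltW y0) // mulr_ge0 ?powR_ge0 // ltW.
  apply: (le_trans (ler_wpM2l (exprn_ge0 i (ltW t0)) yk)).
  rewrite exprMn mulrCA powR_exp // expr_powR //; apply: ler_pM; rewrite ?exprn_ge0 ?powR_ge0 ?(ltW d0) //.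
    rewrite -(prednK k0) exprS (le_trans _ (_ : d <= ka)) ?ge_min ?lexx ?orbT //.
    by rewrite ler_piMr ?(ltW d0) // exprn_ile1 // ltW.
  rewrite -[t ^+ i0]powR_mulrn ?(ltW t0) //; apply: ger_powR.
    by rewrite t0 ltW // (lt_le_trans td).
  by move: ha; rewrite jE natrD mulrDl; lra.
pose k := (j0 - j)%N; have jE : (j0 = j + k)%N by rewrite /k subnKC // ltnW.
pose rho := i%:R - i0%:R - be * k%:R.
have rho0 : 0 < rho by move: hb; rewrite /rho jE natrD mulrDl; lra.
have kC : 0 < ka * C ^+ k by rewrite mulr_gt0 // exprn_gt0.
pose d := Order.min 1 ((ka * C ^+ k) `^ rho^-1).
exists d; first by rewrite lt_min ltr01 powR_gt0.
move=> t y t0 td y0 yl _.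
have t1 : t <= 1 by apply: ltW; apply: (lt_le_trans td); rewrite ge_min lexx.
rewrite (_ : ka * (t ^+ i0 * y ^+ j0) = y ^+ j * (ka * t ^+ i0 * y ^+ k)); last by rewrite jE exprD; ring.
rewrite mulrC ler_wpM2l ?exprn_ge0 ?(ltW y0) //.
have yk : (C * t `^ be) ^+ k <= y ^+ k.
  by rewrite lerXn2r ?nnegrE ?(ltW y0) // mulr_ge0 ?powR_ge0 // ltW.
have := ler_wpM2l (mulr_ge0 (ltW ka0) (exprn_ge0 i0 (ltW t0))) yk; rewrite -mulrA => h.
apply: le_trans h; rewrite exprMn powR_exp //.
rewrite (_ : ka * (t ^+ i0 * (C ^+ k * t `^ (be * k%:R))) = ka * C ^+ k * (t ^+ i0 * t `^ (be * k%:R))); last by ring.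
rewrite expr_powR // -[t ^+ i]powR_mulrn ?(ltW t0) //.
rewrite (_ : i%:R = rho + (i0%:R + be * k%:R)); last by rewrite /rho; ring.
rewrite powRD ?(gt_eqF t0) ?implybT // ler_wpM2r ?powR_ge0 //.
have : t <= (ka * C ^+ k) `^ rho^-1 by apply: ltW; apply: (lt_le_trans td); rewrite ge_min lexx orbT.
move=> /(ge0_ler_powR (ltW rho0)); rewrite !nnegrE => /(_ (ltW t0) (powR_ge0 _ _)).
by rewrite -powRrM mulVf ?gt_eqF // powRr1 // ltW.
Qed.

(* Between the curves [C t^be] and [t^al] one monomial dominates when no edge of the
   Newton polygon has its slope in [(al, be]]. *)
Lemma newton_gap N (a : 'I_N -> 'I_N -> R) (al be C : R) : 0 < C -> al < be ->
  (exists i j, a i j != 0) ->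
  (forall (i i' j j' : 'I_N) th, al < th -> th <= be ->
    i%:R + j%:R * th = i'%:R + j'%:R * th -> j = j') ->
  exists2 d, 0 < d & forall t y, 0 < t -> t < d -> C * t `^ be <= y -> y <= d * t `^ al ->
    \sum_i \sum_j a i j * (t ^+ i * y ^+ j) != 0.
Proof.
move=> C0 ab [i1 [j1 a1]] slope.
pose w (p : 'I_N * 'I_N) := p.1%:R + p.2%:R * be.
case: (@arg_minP _ _ _ (i1, j1) (fun p => a p.1 p.2 != 0) w a1) => -[i0 j0] /= a0 hmin.
have lt_be (p : 'I_N * 'I_N) : a p.1 p.2 != 0 -> p <> (i0, j0) -> w (i0, j0) < w p.
  move=> ap ne; rewrite lt_neqAle hmin // andbT; apply/eqP => e.
  have jj := slope _ _ _ _ be ab (lexx _) e; apply: ne; rewrite [p]surjective_pairing; congr (_, _) => //.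
  move: e; rewrite /w -jj /= => /addIr /eqP; rewrite eqr_nat => /eqP e; apply/esym; exact: val_inj.
(* The monomial of least weight at [be] also has least weight at [al]: otherwise two weights would
   cross strictly after [al] and at [be] at the latest. *)
have le_al (p : 'I_N * 'I_N) : a p.1 p.2 != 0 -> i0%:R + j0%:R * al <= p.1%:R + p.2%:R * al.
  move=> ap; rewrite leNgt; apply/negP => lt; have := hmin p ap; rewrite /w /= => le.
  pose B : R := p.2%:R - j0%:R; pose A : R := p.1%:R - i0%:R.
  have A1 : A + B * al < 0 by rewrite /A /B; lra.
  have A2 : 0 <= A + B * be by rewrite /A /B; lra.
  have B0 : 0 < B.
    have : 0 < B * (be - al) by lra.
    by rewrite pmulr_lgt0 // subr_gt0.
  have jj : p.2 = j0.
    apply: (slope p.1 i0 p.2 j0 (- A / B)); first by rewrite ltr_pdivlMr //; lra.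
      by rewrite ler_pdivrMr //; lra.
    suff : A + B * (- A / B) = 0 by rewrite /A /B; lra.
    by field; rewrite gt_eqF.
  by move: B0; rewrite /B jj subrr ltxx.
pose Aa := \sum_p `|a p.1 p.2|.
have Aa0 : 0 <= Aa by apply: sumr_ge0.
pose ka := `|a i0 j0| / (2 * (Aa + 1)).
have na0 : 0 < `|a i0 j0| by rewrite normr_gt0.
have ka0 : 0 < ka by rewrite divr_gt0 // mulr_gt0 // ltr_wpDl.
have [||d d0 hd] := @fin_unif R ('I_N * 'I_N)%type (fun p d => a p.1 p.2 != 0 -> p <> (i0, j0) ->
    forall t y, 0 < t -> t < d -> 0 < y -> C * t `^ be <= y -> y <= d * t `^ al ->
    t ^+ p.1 * y ^+ p.2 <= ka * (t ^+ i0 * y ^+ j0)).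
- move=> p d d' d'0 d'd h ap ne t y t0 td y0 yl yu; apply: h => //; first exact: lt_le_trans d'd.
  by apply: (le_trans yu); rewrite ler_wpM2r // powR_ge0.
- move=> p; have [ap|ap] := eqVneq (a p.1 p.2) 0; first by exists 1.
  have [->|ne] := eqVneq p (i0, j0); first by exists 1.
  have [|d d0 hd] := @monomial_gap al be C ka p.1 p.2 i0 j0 C0 ka0 _ (le_al p ap) (lt_be p ap (elimN eqP ne)).
    move=> jj; have := lt_be p ap (elimN eqP ne); rewrite /w /= jj ltrD2r ltr_nat //.
  by exists d => // _ _.
exists d => // t y t0 td yl yu.
have y0 : 0 < y by apply: lt_le_trans yl; rewrite mulr_gt0 // powR_gt0.
rewrite pair_big /= (bigD1 (i0, j0)) //=; set m0 := t ^+ i0 * y ^+ j0.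
have m00 : 0 < m0 by rewrite mulr_gt0 // exprn_gt0.
set S := \sum_(p | _) _.
have hS : `|S| <= `|a i0 j0| / 2 * m0.
  apply: (@le_trans _ _ (Aa * (ka * m0))).
    apply: (le_trans (ler_norm_sum _ _ _)); rewrite /Aa mulr_suml.
    rewrite [X in _ <= X](bigD1 (i0, j0)) //= -[X in X <= _]add0r lerD //.
      by rewrite mulr_ge0 // mulr_ge0 // ltW.
    apply: ler_sum => p ne; rewrite normrM; have [->|ap] := eqVneq (a p.1 p.2) 0.
      by rewrite normr0 !mul0r.
    rewrite ler_wpM2l // ger0_norm; last by rewrite mulr_ge0 // exprn_ge0 // ltW.
    by apply: hd => //; exact/eqP.
  rewrite mulrA ler_wpM2r ?(ltW m00) // /ka mulrA ler_pdivrMr ?mulr_gt0 ?ltr_wpDl //.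
  by rewrite mulrC -mulrA ler_wpM2l ?(ltW na0) //; lra.
apply/eqP => e; have : `|a i0 j0 * m0| <= `|a i0 j0| / 2 * m0.
  by rewrite (_ : a i0 j0 * m0 = - S) ?normrN //; apply/eqP; rewrite -subr_eq0 opprK e.
rewrite normrM (gtr0_norm m00) ler_pM2r //; lra.
Qed.

End NewtonGap.

(** * Euclidean norm and distance to the zeros *)

Section EuclideanNorm.
Context {R : realType} {n : nat}.
Implicit Types (x y z : 'rV[R]_n) (A : set 'rV[R]_n).

Lemma enorm_ge0 x : 0 <= enorm x. Proof. exact: sqrtr_ge0. Qed.

Lemma enormX2 x : enorm x ^+ 2 = \sum_i x 0 i ^+ 2.
Proof. by rewrite sqr_sqrtr // sumr_ge0 // => i _; rewrite sqr_ge0. Qed.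

Lemma enorm0 : enorm (0 : 'rV[R]_n) = 0.
Proof. by rewrite /enorm big1 ?sqrtr0 // => i _; rewrite mxE expr0n. Qed.

Lemma norm_le_enorm x : `|x| <= enorm x.
Proof.
apply: norm_le_coord => [|i]; first exact: enorm_ge0.
rewrite -(@ler_pXn2r _ 2) ?nnegrE ?enorm_ge0 // enormX2 real_normK ?num_real //.
by rewrite (bigD1 i) //= lerDl sumr_ge0 // => j _; exact: sqr_ge0.
Qed.

Lemma enorm_le x : enorm x <= n%:R * `|x|.
Proof.
rewrite -(@ler_pXn2r _ 2) ?nnegrE ?enorm_ge0 ?mulr_ge0 // enormX2.
apply: (@le_trans _ _ (n%:R * `|x| ^+ 2)).
  rewrite -[X in X%:R]card_ord -sum1_card natr_sum mulr_suml; apply: ler_sum => i _.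
  by rewrite mul1r -[x 0 i ^+ 2]real_normK ?num_real // lerXn2r ?nnegrE // coord_le_norm.
rewrite exprMn ler_wpM2r ?exprn_ge0 // expr2 -natrM ler_nat; case: (n) => // k.
by rewrite leq_pmulr.
Qed.

Lemma edist_le x A z : A z -> Defs.edist x A <= enorm (x - z).
Proof.
move=> Az; apply: ge_inf; last by exists z.
by exists 0 => _ [y _ <-]; exact: enorm_ge0.
Qed.

Lemma le_edist x A t : A !=set0 -> (forall z, A z -> t <= enorm (x - z)) -> t <= Defs.edist x A.
Proof.
move=> [z Az] h; apply: lb_le_inf; first by exists (enorm (x - z)), z.
by move=> _ [y Ay <-]; exact: h.
Qed.

Lemma edist_set_ge0 x A : A !=set0 -> 0 <= Defs.edist x A.
Proof. by move=> A0; apply: le_edist => // z _; exact: enorm_ge0. Qed.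

Lemma edist_mem x A : A x -> Defs.edist x A = 0.
Proof.
move=> Ax; apply/eqP; rewrite eq_le edist_set_ge0 ?andbT; last by exists x.
by apply: le_trans (edist_le x Ax) _; rewrite subrr enorm0.
Qed.

End EuclideanNorm.

Section Germ.
Context {R : realType} {N m : nat} {X : set 'rV[R]_N} {F : 'rV[R]_N -> 'rV[R]_m}.
Context (cX : closed X) (cF : {within X, continuous F}) (X0 : X 0) (F0 : F 0 = 0).
Implicit Types (x y z : 'rV[R]_N).

Let Z := zeros X F.

Lemma within_near x e : X x -> 0 < e ->
  exists2 d, 0 < d & forall y, X y -> `|y - x| < d -> `|F y - F x| < e.
Proof.
move=> Xx e0; move/subspace_continuousP: cF => /(_ x Xx) h.
have : nbhs x [set y | X y -> ball (F x) e (F y)] := h _ (nbhsx_ballx _ _ e0).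
move=> /nbhs_ballP[d /= d0 hd].
exists d => // y Xy yd; have := hd y; rewrite -ball_normE /= distrC => /(_ yd Xy).
by rewrite -ball_normE /= distrC.
Qed.

Lemma zeros0 : Z 0. Proof. by split. Qed.

Lemma edist_le_enorm x : Defs.edist x Z <= enorm x.
Proof. by have := edist_le x zeros0; rewrite subr0. Qed.

Lemma edist_gt0 x : X x -> ~ Z x -> 0 < Defs.edist x Z.
Proof.
move=> Xx nZ; have Fx : 0 < `|F x| by rewrite normr_gt0; apply/eqP => e; apply: nZ; split.
have [d d0 hd] := within_near Xx Fx; apply: (lt_le_trans d0).
apply: le_edist; [by exists 0; exact: zeros0|move=> z [Xz Fz]].
apply: le_trans (norm_le_enorm _); rewrite leNgt; apply/negP; rewrite distrC => /(hd z Xz).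
by rewrite Fz sub0r normrN ltxx.
Qed.

(* The inequality off the zero set, where no power of zero occurs. *)
Definition inequality_off (eta : R) : Prop := exists C eps : R, [/\ 0 < C, 0 < eps &
  forall x, X x -> ~ Z x -> enorm x < eps -> C * Defs.edist x Z `^ eta <= enorm (F x)].

(** Near the origin distances to the zeros are at most [1], so an exponent [eta <= 0] would keep
    [|F|] above [C], against continuity at [0]. *)
Lemma inequality_off_gt0 eta : limit_point (X `\` Z) 0 -> inequality_off eta -> 0 < eta.
Proof.
move=> lim [C [eps [C0 eps0 h]]]; rewrite ltNge; apply/negP => eta0.
have m1 : 0 < m%:R + 1 :> R by rewrite ltr_wpDl.
have n1 : 0 < N%:R + 1 :> R by rewrite ltr_wpDl.
have [d d0 hd] := within_near X0 (divr_gt0 C0 m1).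
pose r := Order.min d (Order.min (eps / (N%:R + 1)) (1 / (N%:R + 1))).
have r0 : 0 < r by rewrite !lt_min d0 !divr_gt0.
have [y [y0 [Xy nZy] yr]] : exists y, [/\ y != 0, (X `\` Z) y & ball 0 r y].
  by have [y] := lim (ball 0 r) (nbhsx_ballx _ _ r0); exists y.
move: yr; rewrite -ball_normE /= sub0r normrN /r !lt_min => /and3P[yd ye y1].
have ny (u : R) : `|y| < u / (N%:R + 1) -> enorm y < u.
  rewrite ltr_pdivlMr // => hu; apply: le_lt_trans (enorm_le y) _; apply: le_lt_trans hu.
  by rewrite mulrC ler_wpM2l // lerDl.
have dy : 0 < Defs.edist y Z <= 1.
  by rewrite edist_gt0 //= (le_trans (edist_le_enorm y)) // ltW // ny.
have := h y Xy nZy (ny _ ye); apply/negP; rewrite -ltNge.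
apply: (@lt_le_trans _ _ C).
  have := hd y Xy; rewrite subr0 F0 subr0 => /(_ yd); rewrite ltr_pdivlMr // => hF.
  apply: le_lt_trans (enorm_le _) _; apply: le_lt_trans hF.
  by rewrite mulrC ler_wpM2l // lerDl.
by rewrite ler_peMr ?(ltW C0) // -[1](powRr0 (Defs.edist y Z)); exact: ger_powR.
Qed.

Lemma lojasiewicz_off eta : lojasiewicz_inequality X F eta -> inequality_off eta.
Proof. by move=> [C [eps [C0 e0 h]]]; exists C, eps; split=> // x Xx _; exact: h. Qed.

Lemma off_lojasiewicz eta : 0 < eta -> inequality_off eta -> lojasiewicz_inequality X F eta.
Proof.
move=> eta0 [C [eps [C0 e0 h]]]; exists C, eps; split=> // x Xx xe.
have [Zx|nZ] := pselect (Z x); last exact: h.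
by rewrite edist_mem // powR0 ?gt_eqF // mulr0 enorm_ge0.
Qed.

Lemma graph_onE (w : 'rV[R]_(N + m)) : graph_on X F w <-> X (lsubmx w) /\ F (lsubmx w) = rsubmx w.
Proof.
split; first by move=> [x Xx <-]; rewrite row_mxKl row_mxKr.
by move=> [Xw e]; exists (lsubmx w); rewrite // e hsubmxK.
Qed.

Lemma closed_graph_on : closed (graph_on X F).
Proof.
move=> w cw; have nl (v : 'rV[R]_(N + m)) : `|lsubmx v| <= `|v|.
  by apply: norm_le_coord => // i; rewrite mxE coord_le_norm.
have nr (v : 'rV[R]_(N + m)) : `|rsubmx v| <= `|v|.
  by apply: norm_le_coord => // i; rewrite mxE coord_le_norm.
have near e : 0 < e -> exists w', [/\ graph_on X F w', `|lsubmx w' - lsubmx w| < e & `|rsubmx w' - rsubmx w| < e].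
  move=> e0; have [w' [gw']] := cw _ (nbhsx_ballx w e e0).
  rewrite -ball_normE /= distrC => h; exists w'; split=> //.
    by rewrite -linearB /=; exact: le_lt_trans (nl _) h.
  by rewrite -linearB /=; exact: le_lt_trans (nr _) h.
have Xw : X (lsubmx w).
  apply: cX => B /nbhs_ballP[e /= e0 hB]; have [w' [/graph_onE[Xw' _] h _]] := near e e0.
  by exists (lsubmx w'); split=> //; apply: hB; rewrite -ball_normE /= distrC.
apply/graph_onE; split=> //; apply/eqP; rewrite -subr_eq0 -normr_le0.
apply: (@small_all _ _ 2) => // e e0; have [d d0 hd] := within_near Xw e0.
have [w' [/graph_onE[Xw' Fw'] h1 h2]] := near (Order.min d e) ltac:(by rewrite lt_min d0).
move: h1 h2; rewrite !lt_min => /andP[/(hd _ Xw') h1 _] /andP[_]; rewrite -Fw' => h2.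
have := ler_normB (F (lsubmx w') - rsubmx w) (F (lsubmx w') - F (lsubmx w)).
by rewrite opprB addrC addrA subrK; lra.
Qed.

Lemma zeros_graph z : Z z <-> graph_on X F (row_mx z 0).
Proof. by rewrite graph_onE row_mxKl row_mxKr. Qed.

(** [|x| <= e] and distance at least [t] to the zeros, in squares and through the graph, which makes
    it a first-order condition in [e], [t] and [x]. *)
Definition far (e t : R) x : Prop := \sum_i x 0 i ^+ 2 <= e ^+ 2 /\
  forall z, graph_on X F (row_mx z 0) -> t ^+ 2 <= \sum_i (x 0 i - z 0 i) ^+ 2.

Lemma sqr_leE (a b : R) : 0 <= a -> 0 <= b -> (a ^+ 2 <= b ^+ 2) = (a <= b).
Proof. by move=> a0 b0; rewrite ler_pXn2r ?nnegrE. Qed.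

Lemma farP e t x : 0 <= e -> 0 <= t -> far e t x <-> enorm x <= e /\ t <= Defs.edist x Z.
Proof.
move=> e0 t0; have sE z : \sum_i (x 0 i - z 0 i) ^+ 2 = enorm (x - z) ^+ 2.
  by rewrite enormX2; apply: eq_bigr => i _; rewrite !mxE.
rewrite /far -enormX2 sqr_leE ?enorm_ge0 //; split=> -[h1 h2]; split=> //.
  apply: le_edist; first by exists 0; exact: zeros0.
  by move=> z /zeros_graph/h2; rewrite sE sqr_leE ?enorm_ge0.
move=> z /zeros_graph Zz; rewrite sE sqr_leE ?enorm_ge0 //.
exact: le_trans (edist_le x Zz).
Qed.

Definition min_sq (u : 'rV[R]_2) (y : R) : Prop := exists w : 'rV[R]_(N + m),
  (graph_on X F w /\ far (u 0 ord0) (u 0 ord_max) (lsubmx w)) /\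
  (\sum_i rsubmx w 0 i ^+ 2 = y /\ forall w' : 'rV[R]_(N + m),
    graph_on X F w' /\ far (u 0 ord0) (u 0 ord_max) (lsubmx w') -> y <= \sum_i rsubmx w' 0 i ^+ 2).

Lemma sa_min_sq : semialgebraic (graph_on X F) ->
  sa (fun w : 'rV[R]_(2 + 1) => min_sq (lsubmx w) (w 0 (rshift 2 0))).
Proof.
move=> sG.
have sg k (psi : 'rV[R]_k -> 'rV[R]_(N + m)) : (forall i, polyfun (fun w => psi w 0 i)) ->
    sa (fun w => graph_on X F (psi w)).
  by move=> h; apply: (@sa_comp _ _ k (graph_on X F) psi) => //; rewrite /sa.
have sfar k (e t : 'rV[R]_k -> R) (psi : 'rV[R]_k -> 'rV[R]_N) : polyfun e -> polyfun t ->
    (forall i, polyfun (fun w => psi w 0 i)) -> sa (fun w => far (e w) (t w) (psi w)).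
  move=> pe pt ppsi; apply: sa_and; first by apply: sa_le; polyfun_tac; exact: ppsi.
  apply: sa_all; cbv beta; apply: sa_imp.
    apply: sg => i; case: (split_ordP i) => j ->.
      by apply: (@polyfun_ext _ _ (fun w : 'rV[R]_(k + N) => rsubmx w 0 j)) => [w|]; [rewrite row_mxEl|polyfun_tac].
    by apply: (@polyfun_ext _ _ (fun w : 'rV[R]_(k + N) => 0)) => [w|]; [rewrite row_mxEr mxE|polyfun_tac].
  have lift (phi : 'rV[R]_k -> R) : polyfun phi -> polyfun (fun w : 'rV[R]_(k + N) => phi (lsubmx w)).
    by move=> hphi; apply: (polyfun_comp _ hphi) => i; polyfun_tac.
  apply: sa_le; first by apply: polyfunX; exact: lift.
  by polyfun_tac; apply: (lift (fun w => psi w 0 _)); exact: ppsi.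
rewrite /min_sq; apply: sa_ex; cbv beta; apply: sa_and.
  by apply: sa_and; [apply: sg; polyfun_tac|apply: sfar; polyfun_tac].
apply: sa_and; first by apply: sa_eq; polyfun_tac.
apply: sa_all; cbv beta; apply: sa_imp.
  by apply: sa_and; [apply: sg; polyfun_tac|apply: sfar; polyfun_tac].
by apply: sa_le; polyfun_tac.
Qed.

Lemma min_sq_exists (u : 'rV[R]_2) x : X x -> far (u 0 ord0) (u 0 ord_max) x ->
  0 <= u 0 ord0 -> exists2 y, y <= enorm (F x) ^+ 2 & min_sq u y.
Proof.
move=> Xx fx u0; set e := u 0 ord0 in fx u0 *; set t := u 0 ord_max in fx *.
pose A : set 'rV[R]_N := X `&` [set x | far e t x].
have cA : compact A.
  apply: (@compact_box _ _ _ e).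
    apply: closedI => //.
    have -> : [set x | far e t x] = [set x | \sum_i x 0 i ^+ 2 <= e ^+ 2] `&`
      [set x | forall z, graph_on X F (row_mx z 0) -> t ^+ 2 <= \sum_i (x 0 i - z 0 i) ^+ 2] by [].
    apply: closedI.
      apply: (@closed_lefun _ _ (fun x => \sum_i x 0 i ^+ 2) (fun=> e ^+ 2)); last exact: cst_continuous.
      by apply: polyfun_continuous; polyfun_tac.
    apply: (@closed_forall _ _ _ (fun z => [set x | graph_on X F (row_mx z 0) -> t ^+ 2 <= \sum_i (x 0 i - z 0 i) ^+ 2])) => z.
    have [gz|ngz] := pselect (graph_on X F (row_mx z 0)).
      rewrite (_ : [set x | _] = [set x | t ^+ 2 <= \sum_i (x 0 i - z 0 i) ^+ 2]).
        apply: (@closed_lefun _ _ (fun=> t ^+ 2) (fun x => \sum_i (x 0 i - z 0 i) ^+ 2)); first exact: cst_continuous.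
        by apply: polyfun_continuous; polyfun_tac.
      by apply/seteqP; split=> w /=; [apply|].
    by rewrite (_ : [set x | _] = setT); [exact: closedT|apply/seteqP; split=> w //= _ /ngz].
  move=> y [_ [ye _]]; apply: (le_trans (norm_le_enorm y)).
  by rewrite -sqr_leE ?enorm_ge0 // enormX2.
have [||y yA hy] := @EVT_min_rV R N (fun x => \sum_i F x 0 i ^+ 2) A _ cA.
- by exists x.
- have cFA : {within A, continuous F} by apply: continuous_subspaceW cF => y [].
  move=> y; apply: (@continuous_comp _ _ _ (F : subspace A -> 'rV[R]_m) (fun v : 'rV[R]_m => \sum_i v 0 i ^+ 2)).
    exact: cFA.
  by apply: polyfun_continuous; polyfun_tac.
rewrite inE in yA; have [Xy fy] := yA.
exists (\sum_i F y 0 i ^+ 2); first by rewrite enormX2; apply: hy; rewrite inE.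
exists (row_mx y (F y)); rewrite row_mxKl row_mxKr; split.
  by split=> //; exists y.
split=> // w' [/graph_onE[Xw <-] fw]; apply: hy; rewrite inE; by split.
Qed.

End Germ.

(** * Attainment of the infimum of the exponents *)

Section Attained.
Context {R : realType}.

Definition pair_row (e t : R) : 'rV[R]_2 := \row_k (if k == ord0 then e else t).

Lemma coefficient_table (q : mpoly (2 + 1) R) M e : (mmeasure mdeg q <= M.+1)%N ->
  exists a : 'I_M.+1 -> 'I_M.+1 -> R, forall t y,
    peval q (row_mx (pair_row e t) (\row_i y)) = \sum_i \sum_j a i j * (t ^+ i * y ^+ j).
Proof.
move=> sq; pose k0 : 'I_(2 + 1) := lshift 1 ord0; pose k1 : 'I_(2 + 1) := lshift 1 ord_max.
pose k2 : 'I_(2 + 1) := rshift 2 ord0.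
pose ix (mu : multinom (2 + 1)) : 'I_M.+1 * 'I_M.+1 := (inord (mu k1), inord (mu k2)).
exists (fun i j => \sum_(mu <- msupp q | ix mu == (i, j)) mcoeff mu q * e ^+ mu k0) => t y.
rewrite pair_big /= peval_sum.
rewrite (eq_big_seq (fun mu => mcoeff mu q * e ^+ mu k0 * (t ^+ (ix mu).1 * y ^+ (ix mu).2))).
  rewrite (partition_big ix xpredT) //=; apply: eq_bigr => -[i j] _.
  by rewrite mulr_suml; apply: eq_bigr => mu /eqP[<- <-].
move=> mu mup; have lt k : (mu k < M.+1)%N.
  apply: leq_trans sq; apply: leq_ltn_trans (msize_mdeg_lt mup).
  by rewrite mdegE (bigD1 k) //= leq_addr.
rewrite /ix /= !inordK // -mulrA; congr (_ * _).
rewrite (bigD1 k0) //= (bigD1 k1) //= (bigD1 k2) //= big1 ?mulr1.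
  by rewrite /k0 /k1 /k2 2!row_mxEl row_mxEr !mxE.
by move=> k; case: (split_ordP k) => l ->; [case: l => -[|[|//]] p|rewrite (ord1 l)]; rewrite -!val_eqE.
Qed.

(** Only finitely many slopes arise from exponents below [M], so none of them lies just above
    [al]. *)
Lemma slope_gap M (al : R) : exists2 g, 0 < g & forall (i i' j j' : 'I_M) th,
  al < th -> th <= al + g -> i%:R + j%:R * th = i'%:R + j'%:R * th -> j = j'.
Proof.
have [||g g0 hg] := @fin_unif R ('I_M * 'I_M * ('I_M * 'I_M))%type (fun p g => forall th,
  al < th -> th <= al + g -> p.1.1%:R + p.2.1%:R * th = p.1.2%:R + p.2.2%:R * th -> p.2.1 = p.2.2).
- by move=> p g g' g'0 g'g h th a1 a2; apply: h => //; apply: (le_trans a2); rewrite lerD2l.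
- move=> [[i i'] [j j']] /=; have [->|jj] := eqVneq j j'; first by exists 1.
  have n0 : j'%:R - j%:R != 0 :> R by rewrite subr_eq0 eqr_nat eq_sym.
  pose s : R := (i%:R - i'%:R) / (j'%:R - j%:R).
  have sE th : i%:R + j%:R * th = i'%:R + j'%:R * th -> th = s.
    by move=> e; apply: (mulIf n0); rewrite divfK //; move: e; lra.
  have [sal|als] := leP s al.
    by exists 1 => // th a1 _ /sE e; move: a1; rewrite e ltNge sal.
  exists ((s - al) / 2); first by rewrite divr_gt0 // subr_gt0.
  by move=> th _ a2 /sE e; exfalso; move: a2; rewrite e; lra.
by exists g => // i i' j j'; exact: (hg (i, i', (j, j'))).
Qed.

(** The minimum of [|F| ^ 2] at distance at least [t] obeys the inequality with an admissible
    exponent just above the infimum. As no root lies between that curve and a multiple of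
    [t ^ (2 eta0)], it obeys the inequality with [eta0] too. *)
Lemma exponent_attained N m (X : set 'rV[R]_N) (F : 'rV[R]_N -> 'rV[R]_m) :
  closed X -> {within X, continuous F} -> X 0 -> F 0 = 0 -> semialgebraic (graph_on X F) ->
  limit_point (X `\` zeros X F) 0 -> (exists eta, lojasiewicz_inequality X F eta) ->
  exists eta0, lojasiewicz_inequality X F eta0 /\
    forall eta, lojasiewicz_inequality X F eta -> eta0 <= eta.
Proof.
move=> cX cF X0 F0 sG lim [eta heta].
have offE eta' : lojasiewicz_inequality X F eta' <-> inequality_off (X := X) (F := F) eta'.
  split; first exact: lojasiewicz_off.
  by move=> h; apply: off_lojasiewicz (inequality_off_gt0 cF X0 F0 lim h) h.
have pos eta' : lojasiewicz_inequality X F eta' -> 0 < eta'.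
  by move=> /lojasiewicz_off; exact: inequality_off_gt0.
pose S : set R := lojasiewicz_inequality X F.
have hS : has_inf S by split; [exists eta|exists 0 => t /pos/ltW].
set eta0 := inf S.
have lb eta' : S eta' -> eta0 <= eta' by move=> h; apply: ge_inf => //; exact: hS.2.
have [Se|nSe] := pselect (S eta0); first by exists eta0.
exfalso; apply: nSe; apply/offE.
have e00 : 0 <= eta0 by apply: lb_le_inf; [exact: hS.1|move=> t /pos/ltW].
have [L hL] := sa_root (sa_min_sq sG).
pose M := (\max_(q <- L) mmeasure mdeg q)%N.
have [g g0 hg] := slope_gap M.+1 (2 * eta0).
(* So close to the infimum that no slope lies above [2 eta0] and up to [2 eta1]; the factor [2]
   comes from squaring. *)
have [eta1 Se1 lt1] := inf_adherent (eps := g / 2) ltac:(by rewrite divr_gt0) hS.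
rewrite -/eta0 in lt1.
have [C1 [e1 [C10 e10 h1]]] := Se1.
have [lt01|le10] := ltP eta0 eta1; last first.
  by apply: lojasiewicz_off; suff -> : eta0 = eta1 by []; apply/eqP; rewrite eq_le le10 lb.
pose e := Order.min (e1 / 2) 1.
have e0 : 0 < e by rewrite lt_min ltr01 divr_gt0.
have ee1 : e < e1 by apply: (@le_lt_trans _ _ (e1 / 2)); [rewrite ge_min lexx|lra].
have e1' : e <= 1 by rewrite ge_min lexx orbT.
have u0E t : pair_row e t 0 ord0 = e by rewrite mxE.
have u1E t : pair_row e t 0 ord_max = t by rewrite mxE.
have C120 : 0 < C1 ^+ 2 by rewrite exprn_gt0.
have al_be : 2 * eta0 < 2 * eta1 by lra.
have beg : 2 * eta1 <= 2 * eta0 + g by lra.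
have [||d d0 hd] := @fin_unif R 'I_(size L) (fun i d => forall t y, 0 < t -> t < d ->
    C1 ^+ 2 * t `^ (2 * eta1) <= y -> y <= d * t `^ (2 * eta0) ->
    (exists y', peval (nth 0 L i) (row_mx (pair_row e t) (\row_i y')) <> 0) ->
    peval (nth 0 L i) (row_mx (pair_row e t) (\row_i y)) <> 0).
- move=> i d d' d'0 d'd h t y t0 td y1 y2 ne; apply: h => //; first exact: lt_le_trans d'd.
  by apply: (le_trans y2); rewrite ler_wpM2r // powR_ge0.
- move=> i; have sq : (mmeasure mdeg (nth 0%R L i) <= M.+1)%N.
    by apply: leqW; rewrite /M (big_rem (nth 0 L i)) ?mem_nth //= leq_maxl.
  have [a ha] := coefficient_table e sq.
  have [[i1 [j1 a1]]|none] := pselect (exists i j, a i j != 0).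
    have [|d d0 hd] := @newton_gap R M.+1 a _ _ (C1 ^+ 2) C120 al_be (ex_intro _ i1 (ex_intro _ j1 a1)).
      by move=> i' i'' j' j'' th th1 th2; apply: hg => //; exact: le_trans beg.
    by exists d => // t y t0 td y1 y2 _; rewrite ha; apply/eqP; exact: hd.
  exists 1 => // t y _ _ _ _ [y'] []; rewrite ha big1 // => i' _; rewrite big1 // => j' _.
  have [->|ne] := eqVneq (a i' j') 0; first by rewrite mul0r.
  by case: none; exists i', j'.
(* The second entry covers [t >= d], where the inequality with [eta1] suffices because [t <= 1]. *)
pose c := Order.min d (C1 ^+ 2 * d `^ (2 * eta1)).
have c0 : 0 < c by rewrite lt_min d0 mulr_gt0 // powR_gt0.
have claim t y : 0 < t -> min_sq (X := X) (F := F) (pair_row e t) y -> c * t `^ (2 * eta0) <= y.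
  move=> t0 hy; have [w [W [wy hw]]] := hy; have [gw fw] := W.
  move: fw; rewrite u0E u1E (farP X0 F0 _ (ltW e0) (ltW t0)) => -[we tw].
  have [Xw Fw] := (graph_onE _).1 gw.
  have t1 : t <= 1.
    by apply: (le_trans tw); apply: le_trans (edist_le_enorm X0 F0 _) _; exact: le_trans e1'.
  have low : C1 ^+ 2 * t `^ (2 * eta1) <= y.
    have := h1 _ Xw (le_lt_trans we ee1); rewrite Fw => hw1.
    have hw2 : C1 * t `^ eta1 <= enorm (rsubmx w).
      apply: le_trans hw1; rewrite ler_wpM2l ?(ltW C10) //.
      apply: (ge0_ler_powR (ltW (pos _ Se1))) => //; rewrite nnegrE ?(ltW t0) //.
      exact: le_trans (ltW t0) tw.
    rewrite -wy -enormX2; have -> : C1 ^+ 2 * t `^ (2 * eta1) = (C1 * t `^ eta1) ^+ 2.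
      by rewrite exprMn powR_exp // [eta1 * _]mulrC.
    by rewrite lerXn2r ?nnegrE ?enorm_ge0 // mulr_ge0 ?powR_ge0 // ltW.
  have uniq y' : min_sq (X := X) (F := F) (pair_row e t) y' <-> y' = y.
    split=> [[w' [gw' [wy' hw']]]|->//]; apply/eqP; rewrite eq_le.
    by apply/andP; split; [rewrite -wy; exact: hw'|rewrite -wy'; exact: hw].
  have [td|dt] := ltP t d; last first.
    apply: le_trans low; apply: (@le_trans _ _ (C1 ^+ 2 * d `^ (2 * eta1))).
      apply: (@le_trans _ _ (C1 ^+ 2 * d `^ (2 * eta1) * t `^ (2 * eta0))).
        by rewrite ler_wpM2r ?powR_ge0 // ge_min lexx orbT.
      have cd : 0 <= C1 ^+ 2 * d `^ (2 * eta1) by apply: mulr_ge0 (ltW C120) (powR_ge0 _ _).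
      apply: ler_piMr => //.
      rewrite -[leRHS](powRr0 t); apply: ger_powR; first by rewrite t0 t1.
      by rewrite mulr_ge0.
    rewrite ler_wpM2l ?(ltW C120) //; apply: ge0_ler_powR => //; rewrite ?nnegrE ?(ltW d0) ?(ltW t0) //.
    by rewrite mulr_ge0 // ltW // pos.
  have [q [/(nthP 0)[j jL <-] q0 q1]] := hL _ _ uniq.
  have := hd (Ordinal jL) t y t0 td low; rewrite /= => hd'.
  apply: le_trans (_ : d * t `^ (2 * eta0) <= y); first by rewrite ler_wpM2r ?powR_ge0 // ge_min lexx.
  by rewrite leNgt; apply/negP => /ltW yd; exact: hd' yd q1 q0.
exists (Num.sqrt c), e; split=> //; first by rewrite sqrtr_gt0.
move=> x Xx nZ xe; have t0 := edist_gt0 cF X0 F0 Xx nZ; set t := Defs.edist x _ in t0 *.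
have [||y yF hy] := @min_sq_exists R N m X F cX cF (pair_row e t) x Xx.
- by rewrite u0E u1E; apply/(farP X0 F0 _ (ltW e0) (ltW t0)); split; [exact: ltW|exact: lexx].
- by rewrite u0E ltW.
have E : (Num.sqrt c * t `^ eta0) ^+ 2 = c * t `^ (2 * eta0).
  by rewrite exprMn sqr_sqrtr ?(ltW c0) // powR_exp // [eta0 * _]mulrC.
have := le_trans (claim t y t0 hy) yF; rewrite -E sqr_leE ?enorm_ge0 //.
by rewrite mulr_ge0 ?sqrtr_ge0 ?powR_ge0.
Qed.

End Attained.

(** * Slack variables *)

Lemma smallest_nat (A : set nat) : A !=set0 -> A (Defs.smallest 0%N A).
Proof.
move=> [k Ak]; have ex : exists k, `[< A k >] by exists k; apply/asboolP.
have mem : (A `&` lbound A) (ex_minn ex).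
  case: ex_minnP => m /asboolP Am hm; split=> // j Aj; apply: hm; exact/asboolP.
by have [] := xgetPex 0%N (ex_intro _ _ mem).
Qed.

Lemma rnum_attained (R : realType) n (S : set 'rV[R]_n) : closed S -> semialgebraic S ->
  exists2 bs, decomposition S bs & rnum S = (\max_(b <- bs) size b.1)%N.
Proof.
move=> cS sS; have [bs hbs] := decomposition_exists cS sS.
rewrite /rnum; have [|cs h ->] := @smallest_nat [set k | exists2 bs, decomposition S bs & k = (\max_(b <- bs) size b.1)%N].
  by exists (\max_(b <- bs) size b.1)%N, bs.
by exists cs.
Qed.

Lemma kappa_attained (R : realType) n (S : set 'rV[R]_n) : closed S -> semialgebraic S ->
  exists bs : seq (description R n), [/\ S = [set x | exists2 b, b \in bs & basic_set b x],
    forall b, b \in bs -> (size b.1 <= rnum S)%N &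
    forall b p, b \in bs -> p \in b.1 ++ b.2 -> (pdeg p <= kappa S)%N].
Proof.
move=> cS sS; have [bs hbs rE] := rnum_attained cS sS.
have rb b : b \in bs -> (size b.1 <= rnum S)%N by move=> bb; rewrite rE (big_rem b) //= leq_maxl.
have [|cs [[cE _] cr kE]] := @smallest_nat [set k | exists bs : seq (description R n), [/\ decomposition S bs,
    forall b, b \in bs -> (size b.1 <= rnum S)%N & k = (\max_(b <- bs) \max_(p <- b.1 ++ b.2) pdeg p)%N]].
  by exists (\max_(b <- bs) \max_(p <- b.1 ++ b.2) pdeg p)%N, bs.
exists cs; split=> // b p bc pb; rewrite /kappa kE (big_rem b) //= leq_max.
by rewrite (big_rem p) //= leq_maxl.
Qed.

Lemma seq_lipschitz (R : realType) n (s : seq (mpoly n R)) : exists2 K, 0 <= K &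
  forall p, p \in s -> forall x y : 'rV[R]_n, `|x| <= 1 -> `|y| <= 1 ->
    `|peval p x| <= K /\ `|peval p y - peval p x| <= K * `|y - x|.
Proof.
elim: s => [|p s [K K0 hK]]; first by exists 0.
have [C C0 hC] := taylor p 1; exists (C + K) => [|q]; first exact: addr_ge0.
rewrite inE => /orP[/eqP ->|qs] x y x1 y1.
  have [h1 h2 _ _] := hC x y x1 y1; split; first by apply: (le_trans h1); rewrite lerDl.
  by apply: (le_trans h2); rewrite ler_wpM2r // lerDl.
have [h1 h2] := hK q qs x y x1 y1; split; first by apply: (le_trans h1); rewrite lerDr.
by apply: (le_trans h2); rewrite ler_wpM2r // lerDr.
Qed.

Section Piece.
Context {R : realType} {N m : nat} (X : set 'rV[R]_N) (F : 'rV[R]_N -> 'rV[R]_m).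
Context (b : description R (N + m)).
Let k := size b.1.
Implicit Types (w : 'rV[R]_(N + k)).

(** The description is evaluated with [0] in place of [F x]: the zeros of [slack] then lie over
    zeros of [F], and the error committed elsewhere is Lipschitz in [|F x|]. *)
Definition slice w : 'rV[R]_(N + m) := row_mx (lsubmx w) 0.

(* Each inequality [g >= 0] becomes an equation [g = y_j] with a slack variable
   confined to an interval [[0, B]], which keeps the degree of the square at [2 d]. *)
Definition slack w : R := \sum_(h <- b.2) peval h (slice w) ^+ 2 +
  \sum_(j < k) (peval (nth 0 b.1 j) (slice w) - w 0 (rshift N j)) ^+ 2.

Lemma slack_ge0 w : 0 <= slack w.
Proof. by rewrite /slack addr_ge0 // sumr_ge0 // => i _; exact: sqr_ge0. Qed.

Lemma slack_eq0 w : slack w = 0 -> (forall h, h \in b.2 -> peval h (slice w) = 0) /\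
  forall j : 'I_k, peval (nth 0 b.1 j) (slice w) = w 0 (rshift N j).
Proof.
rewrite /slack -(sumsqE b.2); have := sumsq_ge0 b.2 (slice w).
set S := \sum_(j < k) _; have S0 : 0 <= S by apply: sumr_ge0 => j _; exact: sqr_ge0.
move=> s0 e; split; first by apply/sumsq_eq0; lra.
have {}e : S = 0 by lra.
move=> j; apply/eqP; rewrite -subr_eq0 -sqrf_eq0; apply/eqP.
have /psumr_eq0P := e; apply=> // i _; exact: sqr_ge0.
Qed.

Lemma pfun_slack d : (0 < d)%N -> (forall p, p \in b.1 ++ b.2 -> (pdeg p <= d)%N) -> pfun (2 * d) slack.
Proof.
move=> d0 hd; have sl p : p \in b.1 ++ b.2 -> pfun d (fun w => peval p (slice w)).
  move=> pb; apply: (@pfun_comp _ _ _ d (peval p) slice); last exact: pfun_le (hd p pb) (pfun_peval p).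
  move=> i; rewrite /slice; case: (split_ordP i) => j ->.
    by apply: pfun_ext (pfun_coord (lshift k j)) => w; rewrite row_mxEl mxE.
  by apply: pfun_ext (pfun_const 1 0) => w; rewrite row_mxEr mxE.
apply: pfunD; first by apply: pfun_sumin => h hb; apply: pfunX; apply: sl; rewrite mem_cat hb orbT.
apply: pfun_sum => j; apply: pfunX; apply: pfunB.
  by apply: sl; rewrite mem_cat mem_nth.
exact: pfun_le d0 (pfun_coord _).
Qed.

(** The slack coordinates of a zero are values of the [g], so an isolated zero of [F] yields only
    one zero of the polynomial on the box. *)
Lemma slack_injective w w' : slack w = 0 -> slack w' = 0 -> lsubmx w = lsubmx w' -> w = w'.
Proof.
move=> /slack_eq0[_ h] /slack_eq0[_ h'] e; apply/rowP => i.
case: (split_ordP i) => j ->; first by have /rowP/(_ j) := e; rewrite !mxE.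
by rewrite -h -h' /slice e.
Qed.

Context (bG : forall v, basic_set b v -> graph_on X F v) (X0 : X 0) (F0 : F 0 = 0).

Lemma slack_zeros w : slack w = 0 -> (forall j : 'I_k, 0 <= w 0 (rshift N j)) -> zeros X F (lsubmx w).
Proof.
move=> /slack_eq0[h1 h2] h3; apply/zeros_graph/bG; split=> // g /(nthP 0)[j jk <-].
by rewrite (h2 (Ordinal jk)).
Qed.

(** The last hypothesis leaves open which inequality on a box is used; it records what the isolated
    case needs to know about the zeros. *)
Lemma piece_inequality d e L (eta : R) : (0 < d)%N ->
  (forall p, p \in b.1 ++ b.2 -> (pdeg p <= d)%N) -> 0 < e -> e <= 1 ->
  (forall x, X x -> `|x| <= e -> `|F x| <= 1) -> (0 < L)%N -> L%:R <= 2 * eta ->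
  (forall (f : mpoly (N + k) R) lo hi, (mmeasure mdeg f <= (2 * d).+1)%N ->
    (forall w, box lo hi w -> 0 <= peval f w) -> (exists z, box lo hi z /\ peval f z = 0) ->
    (forall z, box lo hi z -> peval f z = 0 -> zeros X F (lsubmx z) /\ `|lsubmx z| <= e) ->
    (forall z z', peval f z = 0 -> peval f z' = 0 -> lsubmx z = lsubmx z' -> z = z') ->
    exists2 C, 0 < C & forall w, box lo hi w ->
      exists z, [/\ box lo hi z, peval f z = 0 & C * `|w - z| ^+ L <= peval f w]) ->
  exists2 C, 0 < C & forall x, X x -> enorm x < e -> basic_set b (row_mx x (F x)) ->
    C * Defs.edist x (zeros X F) `^ eta <= enorm (F x).
Proof.
move=> d0 hd e0 e1 hF L0 Leta HL; have [f sf fE] := pfun_slack d0 hd.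
have {}fE w : peval f w = slack w by rewrite fE.
have [K K0 hK] := seq_lipschitz (b.1 ++ b.2).
pose lo : 'rV[R]_(N + k) := row_mx (const_mx (- e)) 0.
pose hi : 'rV[R]_(N + k) := row_mx (const_mx e) (const_mx K).
have boxE w : box lo hi w <-> (forall i, `|lsubmx w 0 i| <= e) /\
    forall j, 0 <= w 0 (rshift N j) /\ w 0 (rshift N j) <= K.
  split=> [h|[h1 h2] i].
    split=> [i|j]; first by have := h (lshift k i); rewrite /lo /hi !row_mxEl !mxE ler_norml => -[-> ->].
    by have := h (rshift N j); rewrite /lo /hi !row_mxEr !mxE.
  case: (split_ordP i) => j ->; rewrite /lo /hi.
    by rewrite !row_mxEl !mxE; have := h1 j; rewrite mxE ler_norml => /andP[].
  by rewrite !row_mxEr !mxE.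
(* The slack coordinates are the positive parts of the [g]. The negative parts are at most
   [K |F x|], since each [g] is nonnegative at the point of the graph. *)
pose pt x : 'rV[R]_(N + k) := row_mx x (\row_j Num.max (peval (nth 0 b.1 j) (row_mx x 0)) 0).
have nrow (x : 'rV[R]_N) (v : 'rV[R]_m) : `|x| <= 1 -> `|v| <= 1 -> `|row_mx x v| <= 1.
  move=> x1 v1; apply: norm_le_coord => // i; case: (split_ordP i) => j ->.
    by rewrite row_mxEl (le_trans (coord_le_norm _ _)).
  by rewrite row_mxEr (le_trans (coord_le_norm _ _)).
have ptbox x : `|x| <= e -> box lo hi (pt x).
  move=> xe; apply/boxE; rewrite /pt row_mxKl; split=> [i|j]; first exact: le_trans (coord_le_norm _ _) xe.
  rewrite row_mxEr mxE; split; first by rewrite le_max lexx orbT.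
  rewrite ge_max K0 andbT; apply: le_trans (ler_norm _) _.
  have x1 : `|row_mx x (0 : 'rV[R]_m)| <= 1 by apply: nrow; rewrite ?normr0 // (le_trans xe).
  have gb : nth 0 b.1 j \in b.1 ++ b.2 by rewrite mem_cat mem_nth.
  by have [] := hK _ gb _ _ x1 x1.
pose K1 := (size b.2 + k)%:R * K ^+ 2 + 1.
have K10 : 0 < K1 by rewrite ltr_wpDl // mulr_ge0 // exprn_ge0.
have fle x : X x -> `|x| <= e -> basic_set b (row_mx x (F x)) -> peval f (pt x) <= K1 * enorm (F x) ^+ 2.
  move=> Xx xe [bg bh]; rewrite fE.
  have lip p : p \in b.1 ++ b.2 -> `|peval p (row_mx x (F x)) - peval p (row_mx x 0)| <= K * enorm (F x).
    move=> pb; have x1 : `|x| <= 1 by exact: le_trans e1.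
    have r0 := nrow x 0 x1 ltac:(by rewrite normr0); have rF := nrow x (F x) x1 (hF x Xx xe).
    have [_ h] := hK p pb _ _ r0 rF; apply: (le_trans h); rewrite ler_wpM2l //.
    apply: le_trans (norm_le_enorm _); rewrite opp_row_mx add_row_mx subrr subr0.
    apply: norm_le_coord => // i; case: (split_ordP i) => j ->; first by rewrite row_mxEl mxE normr0.
    by rewrite row_mxEr coord_le_norm.
  have sq (r : R) : `|r| <= K * enorm (F x) -> r ^+ 2 <= K ^+ 2 * enorm (F x) ^+ 2.
    by move=> h; rewrite -real_normK ?num_real // -exprMn lerXn2r ?nnegrE // mulr_ge0 // enorm_ge0.
  have slE : slice (pt x) = row_mx x 0 by rewrite /slice /pt row_mxKl.
  rewrite /slack slE mulrDl mul1r natrD mulrDl mulrDl -[X in X <= _]addr0 lerD ?exprn_ge0 ?enorm_ge0 // lerD //.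
    rewrite -sum1_size natr_sum !mulr_suml !big_seq; apply: ler_sum => h hb; rewrite mul1r; apply: sq.
    by have := lip h; rewrite mem_cat hb orbT bh // sub0r normrN; apply.
  rewrite -[X in X%:R]card_ord -sum1_card natr_sum !mulr_suml; apply: ler_sum => j _; rewrite mul1r; apply: sq.
  rewrite /pt row_mxEr mxE; set g := nth 0 b.1 j.
  have gb : g \in b.1 by exact: mem_nth.
  have [g0|g0] := leP 0 (peval g (row_mx x 0)).
    by rewrite subrr normr0 mulr_ge0 // enorm_ge0.
  have := lip g; rewrite mem_cat gb => /(_ isT) h; rewrite subr0 ltr0_norm //.
  by apply: le_trans h; have := bg g gb; have := ler_norm (peval g (row_mx x (F x)) - peval g (row_mx x 0)); lra.
have [c c0 hc] : exists2 c, 0 < c & forall x, X x -> enorm x < e -> c * Defs.edist x (zeros X F) ^+ L <= peval f (pt x).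
  have dist1 x : enorm x < e -> Defs.edist x (zeros X F) <= 1.
    by move=> xe; apply: le_trans (edist_le_enorm X0 F0 x) _; rewrite ltW // (lt_le_trans xe).
  have dist0 x : 0 <= Defs.edist x (zeros X F) by apply: edist_set_ge0; exists 0; split.
  have xle (x : 'rV[R]_N) : enorm x < e -> `|x| <= e by move=> xe; apply: le_trans (norm_le_enorm x) (ltW xe).
  have fpos w : 0 <= peval f w by rewrite fE; exact: slack_ge0.
  (* Without a zero on the box, the positive minimum of the polynomial serves as the constant, as
     distances are at most [1]. *)
  have [hz|nz] := pselect (exists z, box lo hi z /\ peval f z = 0); last first.
    have ne : box lo hi (pt 0) by apply: ptbox; rewrite normr0 ltW.
    have [z [bz _] hz] := compact_argmin (ex_intro _ (pt 0) (conj ne I)) (compact_boxI (lo := lo) (hi := hi) closedT)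
      (@peval_continuous _ _ f).
    exists (peval f z).
      by rewrite lt_neqAle fpos andbT eq_sym; apply/eqP => e'; apply: nz; exists z.
    move=> x Xx xe; apply: le_trans (hz (pt x) _); last by split=> //; apply: ptbox; exact: xle.
    by rewrite ler_piMr // exprn_ile1 // dist1.
  have zz z : box lo hi z -> peval f z = 0 -> zeros X F (lsubmx z) /\ `|lsubmx z| <= e.
    move=> /boxE[h1 h2]; rewrite fE => fz; split; last by apply: norm_le_coord => //; exact: ltW.
    by apply: slack_zeros => // j; case: (h2 j).
  have [||C C0 hC] := HL f lo hi sf _ hz zz; first by move=> w _; exact: fpos.
    by move=> z z'; rewrite !fE; exact: slack_injective.
  have N1 : 0 < (N%:R + 1) ^+ L :> R by rewrite exprn_gt0 // ltr_wpDl.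
  exists (C / (N%:R + 1) ^+ L); first by rewrite divr_gt0.
  move=> x Xx xe; have [z [bz fz hz']] := hC _ (ptbox x (xle x xe)).
  apply: le_trans hz'; rewrite mulrAC ler_pdivrMr // -mulrA ler_pM2l // -exprMn.
  rewrite lerXn2r ?nnegrE ?mulr_ge0 ?addr_ge0 //.
  apply: le_trans (edist_le x (zz z bz fz).1) _; apply: le_trans (enorm_le _) _.
  rewrite mulrC ler_pM //; last by rewrite lerDl.
  apply: norm_le_coord => // i; apply: le_trans (coord_le_norm (pt x - z) (lshift k i)).
  by rewrite /pt !mxE; case: split_ordP => j /eqP; rewrite ?eq_lshift ?eq_lrshift // => /eqP ->.
exists (Num.sqrt (c / K1)); first by rewrite sqrtr_gt0 divr_gt0.
move=> x Xx xe bx; have xe' : `|x| <= e by apply: le_trans (norm_le_enorm x) (ltW xe).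
have := le_trans (hc x Xx xe) (fle x Xx xe' bx); set t := Defs.edist _ _ => h.
have t0 : 0 <= t by apply: edist_set_ge0; exists 0; split.
have t1 : t <= 1 by apply: le_trans (edist_le_enorm X0 F0 x) _; rewrite ltW // (lt_le_trans xe).
have eta0 : 0 < eta by have : 0 < L%:R :> R; [rewrite ltr0n|lra].
have [->|tn] := eqVneq t 0; first by rewrite powR0 ?gt_eqF // mulr0 enorm_ge0.
have tp : 0 < t by rewrite lt_neqAle eq_sym tn.
rewrite -sqr_leE ?enorm_ge0 ?mulr_ge0 ?sqrtr_ge0 ?powR_ge0 //.
rewrite exprMn sqr_sqrtr ?divr_ge0 ?(ltW c0) ?(ltW K10) // powR_exp // mulrAC ler_pdivrMr //.
rewrite [X in _ <= X]mulrC; apply: le_trans h; rewrite ler_wpM2l ?(ltW c0) //.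
rewrite -powR_mulrn //; apply: ger_powR; first by rewrite tp.
by rewrite mulrC.
Qed.

End Piece.

(** * The two bounds *)

Section Main.
Context {R : realType} {N m : nat} {X : set 'rV[R]_N} {F : 'rV[R]_N -> 'rV[R]_m}.
Context (Xclosed : closed X) (X0 : X 0) (Fcont : {within X, continuous F})
  (Fsemialg : semialgebraic (graph_on X F)) (F0 : F 0 = 0).

(** Because of the default [+oo], an admissible [e] bounds the exponent only once the infimum is
    attained. When the nonzeros do not accumulate at the origin the exponent is [0], whence
    [0 <= e]. *)
Lemma exponent_le_of (e : R) : 0 <= e ->
  (limit_point (X `\` zeros X F) 0 -> lojasiewicz_inequality X F e) ->
  (lojasiewicz_exponent X F <= e%:E)%E.
Proof.
move=> e0 h; rewrite /lojasiewicz_exponent; case: asboolP => [lim|_]; last by rewrite lee_fin.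
have [eta0 [h0 hmin]] := exponent_attained Xclosed Fcont X0 F0 Fsemialg lim (ex_intro _ e (h lim)).
set A := [set eta%:E | eta in _].
have mem : (A `&` lbound A) eta0%:E.
  by split; [exists eta0|move=> _ [eta heta <-]; rewrite /= lee_fin; exact: hmin].
have [_ lb] := xgetPex +oo%E (ex_intro _ _ mem).
by apply: lb; exists e => //; exact: h.
Qed.

(** A piece with fewer inequalities needs fewer slack variables and has a smaller exponent [L'],
    which may be raised to [L] because distances are at most [1]. *)
Lemma inequality_from_pieces d e L (eta : R) : (0 < d)%N -> (kappa (graph_on X F) <= d)%N ->
  0 < e -> e <= 1 -> (forall x, X x -> `|x| <= e -> `|F x| <= 1) -> (0 < L)%N -> L%:R <= 2 * eta ->
  (forall k, (k <= rnum (graph_on X F))%N -> exists2 L', (0 < L' <= L)%N &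
    forall (f : mpoly (N + k) R) lo hi, (mmeasure mdeg f <= (2 * d).+1)%N ->
    (forall w, box lo hi w -> 0 <= peval f w) -> (exists z, box lo hi z /\ peval f z = 0) ->
    (forall z, box lo hi z -> peval f z = 0 -> zeros X F (lsubmx z) /\ `|lsubmx z| <= e) ->
    (forall z z', peval f z = 0 -> peval f z' = 0 -> lsubmx z = lsubmx z' -> z = z') ->
    exists2 C, 0 < C & forall w, box lo hi w ->
      exists z, [/\ box lo hi z, peval f z = 0 & C * `|w - z| ^+ L' <= peval f w]) ->
  lojasiewicz_inequality X F eta.
Proof.
move=> d0 kd e0 e1 hF L0 Leta HL.
have cG := closed_graph_on Xclosed Fcont.
have [bs [GE hr hk]] := kappa_attained cG Fsemialg.
have b0 : description R (N + m) := ([::], [::]).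
have [||C C0 hC] := @fin_unif R 'I_(size bs) (fun i C => forall x, X x -> enorm x < e ->
    basic_set (nth b0 bs i) (row_mx x (F x)) -> C * Defs.edist x (zeros X F) `^ eta <= enorm (F x)).
- move=> i C C' C'0 C'C h x Xx xe bx; apply: le_trans (h x Xx xe bx).
  by rewrite ler_wpM2r // powR_ge0.
- move=> i; have bi : nth b0 bs i \in bs by exact: mem_nth.
  have [L' /andP[L'0 L'L] HL'] := HL _ (hr _ bi).
  apply: (@piece_inequality _ _ _ X F _ _ X0 F0 d e L' eta) => //.
  + by move=> v bv; rewrite GE; exists (nth b0 bs i).
  + by move=> p pb; apply: leq_trans kd; exact: hk pb.
  + by apply: le_trans Leta; rewrite ler_nat.
exists C, e; split=> // x Xx xe.
have : graph_on X F (row_mx x (F x)) by exists x.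
rewrite {1}GE => -[b /(nthP b0)[i ib <-] bx].
exact: hC (Ordinal ib) x Xx xe bx.
Qed.

(** If all polynomials were constants, the piece containing the origin would be the whole space and
    [F] would vanish everywhere. Positivity gives [2 d > 1]. *)
Lemma kappa_gt0 : limit_point (X `\` zeros X F) 0 -> (0 < kappa (graph_on X F))%N.
Proof.
move=> lim; rewrite lt0n; apply/eqP => k0.
have [bs [GE _ hk]] := kappa_attained (closed_graph_on Xclosed Fcont) Fsemialg.
have G0 : graph_on X F 0 by exists 0; rewrite // F0 row_mx0.
move: (G0); rewrite {1}GE => -[b bb [bg bh]].
have cst p : p \in b.1 ++ b.2 -> forall w, peval p w = peval p 0.
  move=> pb w; have := hk b p bb pb; rewrite k0 leqn0 /pdeg => /eqP sp.
  have : (mmeasure mdeg p <= 1)%N by move: sp; case: (mmeasure mdeg p) => // -[].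
  by move=> /msize1_polyC ->; rewrite !pevalC.
have all w : graph_on X F w.
  rewrite GE; exists b => //; split=> p pb; rewrite cst ?mem_cat ?pb ?orbT //; [exact: bg|exact: bh].
have Fz x : zeros X F x by have /graph_onE := all (row_mx x 0); rewrite row_mxKl row_mxKr.
have [y [_ [_ /(_ (Fz y))]]] := lim setT filterT; exact.
Qed.

Lemma dim_gt0 (A : set 'rV[R]_N) : limit_point A 0 -> (0 < N)%N.
Proof.
case: (posnP N) => // N0 /(_ setT filterT)[y [y0 _ _]]; exfalso; move: y0 => /eqP; apply.
by apply/rowP => i; have := ltn_ord i; rewrite {2}N0.
Qed.

Lemma bounded_near : exists2 e, 0 < e <= 1 & forall x, X x -> `|x| <= e -> `|F x| <= 1.
Proof.
have [d d0 hd] := within_near Fcont X0 ltr01; exists (Num.min (d / 2) 1).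
  by rewrite lt_min ltr01 divr_gt0 // ge_min lexx orbT.
move=> x Xx; rewrite le_min => /andP[xd _]; have := hd x Xx; rewrite subr0 F0 subr0.
by move=> h; apply: ltW; apply: h; lra.
Qed.

End Main.

Theorem corollary1p2 (R : realType) (N m : nat) (X : set 'rV[R]_N)
    (F : 'rV[R]_N -> 'rV[R]_m)
    (Xclosed : closed X) (Xsemialg : semialgebraic X)
    (X0 : X 0) (Xacc : limit_point X 0)
    (Fcont : {within X, continuous F})
    (Fsemialg : semialgebraic (graph_on X F)) (F0 : F 0 = 0) :
  let r := (rnum X + rnum (graph_on X F))%N in
  let d := maxn (kappa X) (kappa (graph_on X F)) in
  (lojasiewicz_exponent X F
     <= (d%:R * (6 * d%:R - 3) ^+ (N + r - 1))%:E)%E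
  /\ (isolated (zeros X F) 0 ->
      (lojasiewicz_exponent X F
         <= (((2 * d%:R - 1) ^+ (N + r) + 1) / 2)%:E)%E).
Proof.
move=> r d; have [e /andP[e0 e1] hF] := bounded_near X0 Fcont F0.
have kd : (kappa (graph_on X F) <= d)%N by exact: leq_maxr.
have kr k : (k <= rnum (graph_on X F))%N -> (k <= r)%N by move=> h; rewrite (leq_trans h) // leq_addl.
have dE (a b c : nat) : (0 < c)%N -> (b <= a * c)%N -> (a * c - b)%:R = a%:R * c%:R - b%:R :> R.
  by move=> _ h; rewrite natrB // natrM.
split=> [|isol]; apply: exponent_le_of => //.
- case: (posnP d) => [->|dp]; first by rewrite mul0r.
  by rewrite mulr_ge0 // -dE ?exprn_ge0 //; lia.
- move=> lim; have dp : (0 < d)%N := leq_trans (kappa_gt0 Xclosed X0 Fcont Fsemialg F0 lim) kd.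
  have Np := dim_gt0 lim.
  (* An exponent for [|F| ^ 2], hence twice the bound to be proved. *)
  pose L k := (2 * d * (3 * (2 * d) - 3) ^ (N + k).-1)%N.
  have b0 : (0 < 3 * (2 * d) - 3)%N by lia.
  have b6 : (3 * (2 * d) - 3 = 6 * d - 3)%N by lia.
  have Lp k : (0 < L k)%N by rewrite /L muln_gt0 expn_gt0 b0 andbT; lia.
  apply: (@inequality_from_pieces _ _ _ X F Xclosed X0 Fcont Fsemialg F0 d e (L r)) => //.
    rewrite /L !natrM mulrA ler_wpM2l ?mulr_ge0 // natrX -subn1.
    by rewrite b6 dE //; lia.
  move=> k /kr kler; exists (L k).
    by rewrite Lp leq_mul2l leq_pexp2l ?orbT // -!subn1 leq_sub2r // leq_add2l.
  move=> f lo hi sf fpos hz _ _; apply: box_lojasiewicz => //; last by lia.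
  by rewrite addn_gt0 Np.
(* For [d = 0] the bound reads [((-1) ^ (N + r) + 1) / 2], that is [0] or [1]. *)
- case: (posnP d) => [->|dp].
    rewrite mulr0 sub0r -signr_odd; case: odd; rewrite ?expr1 ?expr0 divr_ge0 //; lra.
  by rewrite divr_ge0 // addr_ge0 // -(dE 2 1%N) ?exprn_ge0 //; lia.
move=> lim; have dp : (0 < d)%N := leq_trans (kappa_gt0 Xclosed X0 Fcont Fsemialg F0 lim) kd.
have [_ [V /nbhs_ballP[s /= s0 hs] VZ]] := isol.
(* Over the smaller box the origin is the only zero of [F]. *)
pose e' := Num.min e (s / 2).
have e'0 : 0 < e' by rewrite lt_min e0 divr_gt0.
have e'e : e' <= e by rewrite ge_min lexx.
have uniq z : zeros X F z -> `|z| <= e' -> z = 0.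
  move=> Zz ze; have : (V `&` zeros X F) z.
    split=> //; apply: hs; rewrite -ball_normE /= sub0r normrN (le_lt_trans ze) //.
    by apply: (@le_lt_trans _ _ (s / 2)); [rewrite ge_min lexx orbT|lra].
  by rewrite VZ.
have b0 : (0 < (2 * d).-1)%N by lia.
apply: (@inequality_from_pieces _ _ _ X F Xclosed X0 Fcont Fsemialg F0 d e' ((2 * d).-1 ^ (N + r)).+1) => //.
- exact: le_trans e1.
- by move=> x Xx xe; apply: hF => //; exact: le_trans e'e.
- rewrite mulrC divfK // -natr1 natrX lerD2r.
  by rewrite (_ : (2 * d).-1%:R = 2 * d%:R - 1) // -(dE 2 1%N) ?subn1 //; lia.
move=> k /kr kler; exists ((2 * d).-1 ^ (N + k)).+1; first by rewrite /= ltnS leq_pexp2l // leq_add2l.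
move=> f lo hi sf fpos [z [bz fz]] hz inj.
(* Both zeros lie over the origin, and the slack coordinates are determined by the point below. *)
have zeq w : box lo hi w -> peval f w = 0 -> w = z.
  move=> bw fw; apply: inj => //; have [Zz zs] := hz z bz fz; have [Zw ws] := hz w bw fw.
  by rewrite (uniq _ Zz zs) (uniq _ Zw ws).
have [C C0 hC] := box_isolated dp sf bz fpos fz zeq.
by exists C => // w bw; exists z; split=> //; exact: hC.
Qed.
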